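(* Let $(B_x,B_y)\in\mathbb R^2$ and $B=\sqrt{B_x^2+B_y^2}$. The spectrum of the closure of $\mathcal H_{B_x,B_y}^{\mathrm{Sol}}$ (denoted by the same symbol) depends on $B$ as follows: (1) $\operatorname{spec}(\mathcal H_{B_x,B_y}^{\mathrm{Sol}})=\operatorname{spec}(\mathcal H_{B_y,B_x}^{\mathrm{Sol}})\supseteq[\frac12B^2,\infty)$. (2) If $0\le B\le\frac12$, then equality holds in (1), that is, $\operatorname{spec}(\mathcal H_{B_x,B_y}^{\mathrm{Sol}})=[\frac12B^2,\infty)$. (3) If $B>\frac12$, then $\lambda_0(\mathcal H_{B_x,B_y}^{\mathrm{Sol}})\ge\frac12\left(B-\frac14\right)$, with equality if also $B_y=0$. (4) If $|B_x|>\frac12$, then $\frac12\left(|B_x|+|B_y|^2-\frac14\right)\in\operatorname{spec}(\mathcal H_{B_x,B_y}^{\mathrm{Sol}})$.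
   Context: The Lie group $\mathrm{Sol}$ is $\mathbb R^3$ with multiplication $(x,y,z)(x',y',z')=(x+e^zx',y+e^{-z}y',z+z')$ and left-invariant metric $e^{-2z}dx^2+e^{2z}dy^2+dz^2$, so that $L^2(\mathrm{Sol})=L^2(\mathbb R^3,dx\,dy\,dz)$. The left-invariant magnetic potential is $B_xe^{-z}dx+B_ye^zdy$. With $\mathcal D_x=\frac1i\frac{\partial}{\partial x}$, $\mathcal D_y=\frac1i\frac{\partial}{\partial y}$, $\mathcal D_z=\frac1i\frac{\partial}{\partial z}$, the associated magnetic Schrödinger operator is $$\mathcal H_{B_x,B_y}^{\mathrm{Sol}}=\frac12\left((e^z\mathcal D_x+B_x)^2+(e^{-z}\mathcal D_y+B_y)^2+\mathcal D_z^2\right)$$ with initial domain $C_0^\infty(\mathbb R^3,\mathbb C)\subset L^2(\mathbb R^3)$. It is essentially self-adjoint; $\lambda_0$ denotes the infimum of the spectrum of the closure. *)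

(* Defs.v *)
From HB Require Import structures.
From mathcomp Require Import all_boot all_order all_algebra.
From mathcomp Require Import all_classical all_reals all_analysis.
From mathcomp Require Import complex.

Set Implicit Arguments.
Unset Strict Implicit.
Unset Printing Implicit Defensive.

Import Order.TTheory GRing.Theory Num.Theory.
Import numFieldNormedType.Exports.

Local Open Scope classical_set_scope.
Local Open Scope ring_scope.
Local Open Scope complex_scope.

(** * The Hilbert space L^2(R^3, C), on representatives

   Points of R^3 are triples [((x, y), z)].  Elements of L^2 are represented by
   square-integrable functions; almost everywhere equality plays the role of
   equality in L^2. *)

Notation space3 R := (R * R * R)%type (only parsing).
(* The same type, with the Borel sigma-algebra that carries [lebesgue_measure]. *)
Notation mspace3 R :=
  (measurableTypeR R * measurableTypeR R * measurableTypeR R)%type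
  (only parsing).
Notation cfun3 R := (R * R * R -> R[i])%type (only parsing).

Section L2.
Variable R : realType.
Implicit Types f g h : cfun3 R.

Definition leb3 := [the {measure set (mspace3 R) -> \bar R} of
  (@lebesgue_measure R \x @lebesgue_measure R \x @lebesgue_measure R)%E].

Definition cmeasurable f :=
  measurable_fun [set: mspace3 R] (fun p => complex.Re (f p)) /\
  measurable_fun [set: mspace3 R] (fun p => complex.Im (f p)).

Definition normL2 f : \bar R :=
  ('N[leb3]_2%:E[EFin \o (@ComplexField.Normc.normc R \o f)])%E.

Definition L2 : set (cfun3 R) := [set f | cmeasurable f /\ (normL2 f < +oo)%E].

Definition cvgL2 (u : nat -> cfun3 R) f :=
  (fun n => normL2 (fun p => u n p - f p)) @ \oo --> 0%E.

Definition eqL2 f g := {ae leb3, forall p, f p = g p}.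

(** * Unbounded operators on L^2 and their spectrum

   An operator is given by its graph (a relation between representatives).
   The resolvent set consists of the [zeta] for which [A - zeta] is a bijection
   from the domain of [A] onto L^2 with bounded inverse. *)

Definition closure_graph (D : set (cfun3 R)) (A : cfun3 R -> cfun3 R) :
    set (cfun3 R * cfun3 R) :=
  [set fg | [/\ L2 fg.1, L2 fg.2 &
    exists u : nat -> cfun3 R, [/\ forall n, D (u n),
      cvgL2 u fg.1 & cvgL2 (fun n => A (u n)) fg.2]]].

Definition resolvent_set (G : set (cfun3 R * cfun3 R)) : set R[i] :=
  [set zeta | [/\
    forall h, L2 h -> exists f g,
      G (f, g) /\ eqL2 (fun p => g p - zeta * f p) h,
    forall f g, G (f, g) ->
      eqL2 (fun p => g p - zeta * f p) (fun=> 0) -> eqL2 f (fun=> 0) &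
    exists c : R, forall f g, G (f, g) ->
      (normL2 f <= c%:E * normL2 (fun p => g p - zeta * f p)%R)%E]].

Definition spectrum (G : set (cfun3 R * cfun3 R)) : set R[i] :=
  ~` resolvent_set G.

End L2.

(** * Test functions and the magnetic Schroedinger operator on Sol *)

Section Sol.
Variable R : realType.
Implicit Types (u : cfun3 R) (f : space3 R -> R).

Definition ex : space3 R := (1, 0, 0).
Definition ey : space3 R := (0, 1, 0).
Definition ez : space3 R := (0, 0, 1).

Definition axis (k : 'I_3) : space3 R := nth 0 [:: ex; ey; ez] k.

Definition iter_partial (s : seq 'I_3) f : space3 R -> R :=
  foldr (fun k g => fun p => 'D_(axis k) g p) f s.

(* All iterated partial derivatives exist and are continuous. *)
Definition smooth f := forall s : seq 'I_3,
  continuous (iter_partial s f) /\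
  forall k p, derivable (iter_partial s f) p (axis k).

Definition test_fun : set (cfun3 R) :=
  [set u | [/\ smooth (fun p => complex.Re (u p)),
               smooth (fun p => complex.Im (u p)) &
               compact (closure [set p | u p != 0])]].

Definition partialC (v : space3 R) u : cfun3 R :=
  fun p => 'D_v (fun q => complex.Re (u q)) p +i*
           'D_v (fun q => complex.Im (u q)) p.

Definition Dop (v : space3 R) u : cfun3 R := fun p => 'i^-1 * partialC v u p.

Definition Px (Bx : R) u : cfun3 R :=
  fun p => (expR p.2)%:C * Dop ex u p + Bx%:C * u p.

Definition Py (By : R) u : cfun3 R :=
  fun p => (expR (- p.2))%:C * Dop ey u p + By%:C * u p.

Definition H_Sol (Bx By : R) u : cfun3 R := fun p =>
  2^-1 * (Px Bx (Px Bx u) p + Py By (Py By u) p + Dop ez (Dop ez u) p).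

Definition spec_Sol (Bx By : R) : set R[i] :=
  spectrum (closure_graph test_fun (H_Sol Bx By)).

(* The spectrum is real, so that taking real parts only changes the type; the
   infimum is taken in the extended reals. *)
Definition lambda0_Sol (Bx By : R) : \bar R :=
  ereal_inf [set (complex.Re zeta)%:E | zeta in spec_Sol Bx By].

End Sol.

(* Main.v *)
Require Import Defs.
From HB Require Import structures.
From mathcomp Require Import all_boot all_order all_algebra.
From mathcomp Require Import all_classical all_reals all_analysis.
From mathcomp Require Import measurable_realfun complex.
From mathcomp Require Import ring lra.

Set Implicit Arguments.
Unset Strict Implicit.
Unset Printing Implicit Defensive.

Import Order.TTheory GRing.Theory Num.Theory.
Import numFieldNormedType.Exports.

Local Open Scope classical_set_scope.
Local Open Scope ring_scope.
Local Open Scope complex_scope.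

(** The magnetic Schroedinger operator of Sol is [H = (P0^2 + P1^2 + P2^2) / 2] with
    [P_j = - i X_j + B_j], where [X0 = e^z d/dx], [X1 = e^-z d/dy], [X2 = d/dz] are the
    left-invariant fields and [B_2 = 0] ([P], [H_SolE]). The fields are divergence free
    ([rint_X]), so that the momenta [P_j] are symmetric ([P_sym]), and they satisfy
    [[X2, X0] = X0] and [[X2, X1] = - X1].

    The spectrum is bounded from below. For unit [(a, b)] the commutation relations
    write the form of [P2^2 + t^2 (P0^2 + P1^2)] as the sum of two squares and of the
    constant [t (b By - a Bx) - 1/4] ([form_lower_bound]). Optimizing over [(a, b)] and
    over [t >= 1] bounds the form of [H] from below by
    [B^2 / 2] for [B <= 1/2] and by [(B - 1/4) / 2] for [B > 1/2]
    ([energy_lower_bound]).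

    To conclude that the spectrum of the closure lies on the half-line above this
    bound ([spec_lower]), let [zeta] be a number off the half-line. The bound on the
    form makes [H - zeta] bounded from below, so that it is injective with closed range,
    and it remains to show that the range is dense ([resolvent_criterion]). This
    density is the essential self-adjointness of [H]. Let [k] be orthogonal to the range. Its
    convolutions with smooth kernels that depend only on the quotient [h k^-1] are
    smooth ([smooth_conv]), square-integrable by Schur's test ([intble_kop_sqr]), and
    again orthogonal to the range, because convolution commutes with the left-invariant
    fields ([X_conv], [kopC_orth]). A smooth square-integrable [v] that is orthogonal to
    the range satisfies a Caccioppoli inequality ([cutoff_bound]): [|chi v|^2] is bounded
    by a multiple of the sum of the [|(X_j chi) v|^2]. Since there are cutoffs [chi] with
    arbitrarily small derivatives [X_j chi] ([cutoff_grad]), such a [v] vanishes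
    ([orth_zero]). So the convolutions of [k] vanish, and letting the kernels tend to
    indicator functions of the sets of a pi-system gives [k = 0] almost everywhere
    ([conv_vanish]).

    Points of the spectrum are found from approximate eigenfunctions
    ([weyl_criterion]). On [e^(i kappa x) f(z)] the operator [2 H] acts as the ordinary
    differential operator [- f'' + (Bx + kappa e^z)^2 f + By^2 f]. A bounded solution of
    [- f'' + (Bx + kappa e^z)^2 f = mu f], multiplied by cutoffs whose horizontal scale
    is exponentially larger than the vertical one, shows that [(mu + By^2) / 2] belongs to
    the spectrum ([spec_of_fibre]). With [kappa = 0] and [f = cos] this gives the
    half-line from [B^2 / 2] on ([spec_half_line]); with [kappa = - sgn Bx] the potential
    is a Morse potential, whose ground state has [mu = |Bx| - 1/4] if [|Bx| > 1/2]
    ([spec_bound_state]). For [B <= 1/2] the half-line meets the lower bound, and for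
    [By = 0] the bound state does.

    Finally the automorphism [(x, y, z) |-> (y, x, - z)] of Sol exchanges [X0] and [X1]
    and takes [X2] to [- X2], so that it exchanges [Bx] and [By] ([spec_swap]). *)

(** * Completeness of the space of square-integrable functions *)

Section Completeness.
Context d (T : measurableType d) (R : realType).
Variable mu : {measure set T -> \bar R}.
Implicit Types f g : T -> R.

Definition sqint f : \bar R := (\int[mu]_x ((f x) ^+ 2)%:E)%E.

Lemma sqint_ge0 f : (0 <= sqint f)%E.
Proof. by apply: integral_ge0 => x _; rewrite lee_fin sqr_ge0. Qed.

Lemma measurable_sqr f : measurable_fun setT f ->
  measurable_fun setT (fun x => ((f x) ^+ 2)%:E).
Proof. by move=> mf; apply/measurable_EFinP; exact: measurable_funX. Qed.

(** The increments are square-summable with geometric weights almost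
    everywhere, so that the sequence converges absolutely there. *)
Lemma fast_Cauchy_ae_cvg (g : nat -> T -> R) :
  (forall n, measurable_fun setT (g n)) ->
  (forall k, (sqint (fun x => g k.+1 x - g k x)%R <= ((8^-1) ^+ k)%:E)%E) ->
  {ae mu, forall x, cvgn (fun k => g k x)}.
Proof.
move=> mg gk.
pose F k x : \bar R := (4 ^+ k * (g k.+1 x - g k x) ^+ 2)%:E.
have mF k : measurable_fun setT (F k).
  apply/measurable_EFinP; apply: measurable_funM => //.
  by apply: measurable_funX; apply: measurable_funB.
have F0 k x : (0 <= F k x)%E.
  by rewrite lee_fin mulr_ge0 ?sqr_ge0 ?exprn_ge0.
have intF : (\int[mu]_x \sum_(0 <= k <oo) F k x < +oo)%E.
  rewrite integral_nneseries//.
  apply: (@le_lt_trans _ _ (\sum_(0 <= k <oo) ((0 : R) + (2%:R / (2 ^ k.+1)%:R))%:E)%E).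
    apply: lee_nneseries => [k _ _|k _]; first exact: integral_ge0.
    rewrite /F; under eq_integral do rewrite EFinM.
    rewrite ge0_integralZl//; last 2 first.
    - by apply: (measurable_sqr (f := fun x => g k.+1 x - g k x)); apply: measurable_funB.
    - by move=> x _; rewrite lee_fin sqr_ge0.
    apply: (@le_trans _ _ ((4 ^+ k)%:E * ((8^-1) ^+ k)%:E)%E).
      apply: lee_pmul => //; [exact: sqint_ge0|exact: gk].
    rewrite -EFinM lee_fin -exprMn add0r.
    rewrite natrX exprS invfM mulrA divff ?mul1r// -exprVn.
    by rewrite (_ : 4 * 8^-1 = 2^-1 :> R)//; lra.
  have := @epsilon_trick R (fun=> 0%E) 2 xpredT (fun=> lexx _) (ler0n _ 2).
  under eq_eseriesr do rewrite -EFinD.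
  move=> /le_lt_trans; apply.
  by rewrite eseries0// add0e ltry.
have : {ae mu, forall x, setT x -> (\sum_(0 <= k <oo) F k x)%E \is a fin_num}.
  apply: integrable_ae => //; apply/integrableP; split.
    by apply: ge0_emeasurable_sum.
  under eq_integral => x _.
    rewrite gee0_abs; first by over.
    by apply: nneseries_ge0.
  exact: intF.
apply: filterS => x /(_ I) fx.
set S := (\sum_(0 <= k <oo) F k x)%E in fx.
have Sk k : 4 ^+ k * (g k.+1 x - g k x) ^+ 2 <= fine S.
  rewrite -lee_fin fineK//.
  have := @nneseries_lim_ge R (fun k => F k x) xpredT 0%N k.+1 (fun n _ _ => F0 n x).
  rewrite big_nat_recr//=; apply: le_trans.
  by rewrite leeDr// sume_ge0.
have S0 : 0 <= fine S by apply: le_trans (Sk 0%N); rewrite mulr_ge0 ?sqr_ge0.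
have bnd k : `|telescope (fun k => g k x) k| <= geometric (1 + fine S) (2^-1) k.
  rewrite /telescope /geometric/=.
  rewrite -(@ler_pXn2r _ 2)//; last first.
    by rewrite nnegrE mulr_ge0// ?exprn_ge0// addr_ge0.
  rewrite real_normK ?num_real// exprMn.
  rewrite -[leLHS](mulKf (_ : 4 ^+ k != 0 :> R)); last by rewrite expf_neq0.
  rewrite [leRHS]mulrC.
  rewrite (_ : (2^-1 ^+ k) ^+ 2 = (4 ^+ k)^-1 :> R); last first.
    by rewrite -exprM mulnC exprM -exprVn; congr (_ ^+ k); lra.
  rewrite ler_pM2l ?invr_gt0 ?exprn_gt0//.
  by apply: le_trans (Sk k) _; nra.
have : cvgn (series (telescope (fun k => g k x))).
  apply: normed_cvg; apply: series_le_cvg bnd _ => //.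
  - by move=> k; rewrite mulr_ge0 ?exprn_ge0 ?addr_ge0.
  - by apply: is_cvg_geometric_series; rewrite ger0_norm//; lra.
move=> /cvg_ex[l Hl]; apply/cvg_ex; exists (g 0%N x + l).
rewrite (_ : (fun k => g k x) =
  (fun k => g 0%N x + series (telescope (fun k => g k x)) k)); last first.
  by apply/funext => k; rewrite [LHS](eq_sum_telescope (fun k => g k x)).
by apply: cvgD => //; exact: cvg_cst.
Qed.

(** Riesz--Fischer: Fatou's lemma bounds the distance to the almost everywhere
    limit of a rapidly convergent subsequence. *)
Lemma sqint_complete (u : nat -> T -> R) :
  (forall n, measurable_fun setT (u n)) ->
  (forall e : R, 0 < e -> exists N, forall n m, (N <= n)%N -> (N <= m)%N ->
     (sqint (fun x => u n x - u m x)%R <= e%:E)%E) ->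
  exists2 f : T -> R, measurable_fun setT f &
   (forall e : R, 0 < e -> exists N, forall n, (N <= n)%N ->
     (sqint (fun x => u n x - f x)%R <= e%:E)%E).
Proof.
move=> mu_ cu.
(* passing to a subsequence whose increments decay like [8^-k], so that the
   weights [4^k] keep them summable *)
have /choice[phi phiP] : forall k : nat, exists N, forall n m, (N <= n)%N -> (N <= m)%N ->
     (sqint (fun x => u n x - u m x)%R <= ((8^-1) ^+ k)%:E)%E.
  by move=> k; apply: cu; rewrite exprn_gt0.
pose psi k := (\sum_(i < k.+1) phi i + k)%N.
have psiS k : (phi k <= psi k)%N.
  by rewrite /psi big_ord_recr/= -addnA addnC -addnA leq_addr.
have psiSS k : (phi k <= psi k.+1)%N.
  rewrite /psi big_ord_recr/= (leq_trans (psiS k))// /psi.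
  by rewrite -addnA leq_add2l addnS (leq_trans (leqnSn k))// ltnS leq_addl.
have psik k : (k <= psi k)%N by rewrite /psi leq_addl.
pose g k := u (psi k).
have mg k : measurable_fun setT (g k) by exact: mu_.
have cg := fast_Cauchy_ae_cvg mg (fun k => phiP k _ _ (psiSS k) (psiS k)).
pose f x := fine (limn_esup (fun k => (g k x)%:E)).
have mf : measurable_fun setT f.
  apply: (measurableT_comp (f := fine)); first exact: fine_measurable.
  by apply: measurable_fun_limn_esup => n; apply/measurable_EFinP.
exists f => // e e0.
have [N HN] := cu e e0.
exists N => n Nn.
have mhk k : measurable_fun setT (EFin \o (fun x => (u n x - g k x) ^+ 2 : R)).
  by apply: (measurable_sqr (f := fun x => u n x - g k x)); apply: measurable_funB.
have := @fatou _ _ _ mu _ measurableT _ mhk.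
have hk0 : (forall k x, [set: T] x -> (0%R <= ((u n x - g k x) ^+ 2)%:E)%E).
  by move=> k x _; rewrite lee_fin sqr_ge0.
move=> /(_ hk0) F.
have le1 : (sqint (fun x => u n x - f x)%R <=
    \int[mu]_x limn_einf (fun k => ((u n x - g k x) ^+ 2)%:E))%E.
  apply: ae_ge0_le_integral => //.
  - by move=> x _; rewrite lee_fin sqr_ge0.
  - by apply: (measurable_sqr (f := fun x => u n x - f x)); apply: measurable_funB.
  - move=> x _; rewrite limn_einf_lim; apply: lime_ge; first exact: is_cvg_einfs.
    by apply: nearW => k; apply: le_ereal_inf_tmp => _ [m _ <-]; rewrite lee_fin sqr_ge0.
  - rewrite (_ : (fun x => _) =
        (fun x => - limn_esup (fun k => - ((u n x - g k x) ^+ 2)%:E))%E); last first.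
      apply/funext => x; rewrite -limn_einfN; congr limn_einf.
      by apply/funext => k; rewrite /comp oppeK.
    apply: measurableT_comp => //; apply: measurable_fun_limn_esup => k.
    exact: (measurableT_comp _ (mhk k)).
  apply: filterS cg => x cx _.
  have fx : f x = limn (fun k => g k x).
    have cE : (fun k => (g k x)%:E) @ \oo --> (limn (fun k => g k x))%:E.
      by apply/fine_cvgP; split => //; exact: nearW.
    by rewrite /f (cvg_limn_einf_sup cE).2.
  have cv : (fun k => ((u n x - g k x) ^+ 2)%:E) @ \oo --> ((u n x - f x) ^+ 2)%:E.
    apply/fine_cvgP; split; first exact: nearW.
    have cB : (fun k => u n x - g k x) @ \oo --> u n x - f x.
      by rewrite fx; apply: cvgB => //; exact: cvg_cst.
    exact: (cvgM cB cB).
  by rewrite (cvg_limn_einf_sup cv).1.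
apply: le_trans le1 _; apply: le_trans F _.
rewrite limn_einf_lim; apply: lime_le; first exact: is_cvg_einfs.
near=> k.
apply: (@le_trans _ _ (sqint (fun x => u n x - g k x))).
  by apply: ereal_inf_lbound; exists k => /=.
apply: HN => //; apply: leq_trans (psik k).
by near: k; exact: nbhs_infty_ge.
Unshelve. all: by end_near. Qed.

End Completeness.

(** * The Hilbert space of square-integrable functions on three-space *)

Section Hilbert.
Variable R : realType.
Implicit Types f g h : cfun3 R.
Local Notation mu := (leb3 R).

Definition sqmod f (p : space3 R) : R :=
  (complex.Re (f p)) ^+ 2 + (complex.Im (f p)) ^+ 2.
Definition sqnorm f : R := \int[mu]_p (sqmod f p).
Definition redot f g (p : space3 R) : R :=
  complex.Re (f p) * complex.Re (g p) + complex.Im (f p) * complex.Im (g p).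
(** The real part of the Hermitian product; the imaginary part is that of
    [f] with a rotated second argument. *)
Definition rip f g : R := \int[mu]_p (redot f g p).

Definition intble (F : space3 R -> R) := mu.-integrable [set: mspace3 R] (EFin \o F).

Lemma intbleD (F G : space3 R -> R) : intble F -> intble G -> intble (fun p => F p + G p).
Proof.
move=> iF iG; rewrite /intble (_ : EFin \o _ = (EFin \o F) \+ (EFin \o G))%E//.
exact: integrableD.
Qed.

Lemma intbleZ (F : space3 R -> R) c : intble F -> intble (fun p => c * F p).
Proof.
move=> iF; rewrite /intble (_ : EFin \o _ = (fun p => c%:E * (EFin \o F) p))%E//.
exact: integrableZl.
Qed.

Lemma intbleB (F G : space3 R -> R) : intble F -> intble G -> intble (fun p => F p - G p).
Proof.
move=> iF iG; rewrite (_ : (fun _ => _) = (fun p => F p + (-1) * G p)); last first.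
  by apply/funext => p; rewrite mulN1r.
by apply: intbleD => //; exact: intbleZ.
Qed.

Lemma intble_le (F G : space3 R -> R) :
  measurable_fun [set: mspace3 R] F -> (forall p, `|F p| <= G p) -> intble G -> intble F.
Proof.
move=> mF FG iG; apply: (le_integrable _ _ _ iG) => //; first exact/measurable_EFinP.
by move=> p _; rewrite /= lee_fin (le_trans (FG p))// ler_norm.
Qed.

Lemma measurable_intble (F : space3 R -> R) : intble F -> measurable_fun [set: mspace3 R] F.
Proof. by move=> /integrableP[/measurable_EFinP]. Qed.

Definition rint (F : space3 R -> R) : R := \int[mu]_p (F p).

Lemma rintD F G : intble F -> intble G -> rint (fun p => F p + G p) = rint F + rint G.
Proof. by move=> iF iG; rewrite /rint RintegralD. Qed.

Lemma rintB F G : intble F -> intble G -> rint (fun p => F p - G p) = rint F - rint G.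
Proof. by move=> iF iG; rewrite /rint RintegralB. Qed.

Lemma rintZ F c : intble F -> rint (fun p => c * F p) = c * rint F.
Proof. by move=> iF; rewrite /rint RintegralZl. Qed.

Lemma rint_ge0 F : (forall p, 0 <= F p) -> 0 <= rint F.
Proof. by move=> F0; apply: Rintegral_ge0. Qed.

Lemma le_rint F G : intble F -> intble G -> (forall p, F p <= G p) -> rint F <= rint G.
Proof. by move=> iF iG FG; apply: le_Rintegral. Qed.

Lemma rintE F : intble F -> (rint F)%:E = (\int[mu]_p (F p)%:E)%E.
Proof. by move=> iF; rewrite /rint /Rintegral fineK//; apply: integrable_fin_num. Qed.

Lemma sqmod_ge0 f p : 0 <= sqmod f p.
Proof. by rewrite addr_ge0 ?sqr_ge0. Qed.

Lemma measurable_sqmod f : cmeasurable f -> measurable_fun [set: mspace3 R] (sqmod f).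
Proof. by move=> [m1 m2]; apply: measurable_funD; apply: measurable_funX. Qed.

Lemma measurable_redot f g : cmeasurable f -> cmeasurable g ->
  measurable_fun [set: mspace3 R] (redot f g).
Proof. by move=> [m1 m2] [n1 n2]; apply: measurable_funD; apply: measurable_funM. Qed.

Lemma normL2E f : normL2 f = ((\int[mu]_p (sqmod f p)%:E) `^ (2^-1))%E.
Proof.
rewrite /normL2 unlock; congr (_ `^ _)%E; apply: eq_integral => p _ /=.
rewrite powR_mulrn// ger0_norm; last first.
  by rewrite /ComplexField.Normc.normc; case: (f p) => a b; exact: sqrtr_ge0.
rewrite /sqmod /ComplexField.Normc.normc; case: (f p) => a b /=.
by rewrite sqr_sqrtr// addr_ge0 ?sqr_ge0.
Qed.

Lemma L2P f : L2 f <-> cmeasurable f /\ intble (sqmod f).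
Proof.
have i0 : (0 <= \int[mu]_p (sqmod f p)%:E)%E.
  by apply: integral_ge0 => p _; rewrite lee_fin sqmod_ge0.
split=> [[mf]|[mf imf]]; rewrite /L2 /= ?normL2E.
  move=> lt; split => //; apply/integrableP; split.
    by apply/measurable_EFinP; exact: measurable_sqmod.
  under eq_integral do rewrite /= ger0_norm ?sqmod_ge0//.
  rewrite ltNge; apply/negP; rewrite leye_eq => /eqP E.
  by move: lt; rewrite E poweRyr ?ltxx// invr_neq0.
split => //; rewrite -rintE// poweR_EFin; exact: ltry.
Qed.

Lemma normL2_sqnorm f : L2 f -> normL2 f = (Num.sqrt (sqnorm f))%:E.
Proof.
move=> /L2P[mf imf]; rewrite normL2E -rintE// poweR_EFin.
by rewrite powR12_sqrt// rint_ge0// => p; exact: sqmod_ge0.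
Qed.

Lemma sqnorm_ge0 f : 0 <= sqnorm f.
Proof. by apply: rint_ge0 => p; exact: sqmod_ge0. Qed.

Lemma cmeasurableD f g : cmeasurable f -> cmeasurable g -> cmeasurable (fun p => f p + g p).
Proof.
move=> [f1 f2] [g1 g2]; split.
  under eq_fun => p do rewrite raddfD/=; exact: measurable_funD.
under eq_fun => p do rewrite raddfD/=; exact: measurable_funD.
Qed.

Lemma cReM (a b : R[i]) : complex.Re (a * b) =
  complex.Re a * complex.Re b - complex.Im a * complex.Im b.
Proof. by case: a b => [a1 a2] [b1 b2]. Qed.
Lemma cImM (a b : R[i]) : complex.Im (a * b) =
  complex.Re a * complex.Im b + complex.Im a * complex.Re b.
Proof. by case: a b => [a1 a2] [b1 b2]. Qed.
Lemma cReD (a b : R[i]) : complex.Re (a + b) = complex.Re a + complex.Re b.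
Proof. by case: a b => [a1 a2] [b1 b2]. Qed.
Lemma cImD (a b : R[i]) : complex.Im (a + b) = complex.Im a + complex.Im b.
Proof. by case: a b => [a1 a2] [b1 b2]. Qed.
Lemma cReB (a b : R[i]) : complex.Re (a - b) = complex.Re a - complex.Re b.
Proof. by case: a b => [a1 a2] [b1 b2]. Qed.
Lemma cImB (a b : R[i]) : complex.Im (a - b) = complex.Im a - complex.Im b.
Proof. by case: a b => [a1 a2] [b1 b2]. Qed.
Lemma complex_ext (a b : R[i]) : complex.Re a = complex.Re b -> complex.Im a = complex.Im b -> a = b.
Proof. by case: a b => [a1 a2] [b1 b2] /= -> ->. Qed.

Lemma cmeasurableZ f c : cmeasurable f -> cmeasurable (fun p => c * f p).
Proof.
move=> [f1 f2]; split.
  under eq_fun => p do rewrite cReM.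
  by apply: measurable_funB; apply: measurable_funM.
under eq_fun => p do rewrite cImM.
by apply: measurable_funD; apply: measurable_funM.
Qed.

Lemma sqrD_le (a b c d : R) :
  (a + b) ^+ 2 + (c + d) ^+ 2 <= 2 * (a ^+ 2 + c ^+ 2) + 2 * (b ^+ 2 + d ^+ 2).
Proof. have := sqr_ge0 (a - b); have := sqr_ge0 (c - d); nra. Qed.

Lemma dot_le (a b c d : R) :
  - (a ^+ 2 + b ^+ 2 + (c ^+ 2 + d ^+ 2)) <= a * c + b * d /\
  a * c + b * d <= a ^+ 2 + b ^+ 2 + (c ^+ 2 + d ^+ 2).
Proof.
have := sqr_ge0 (a - c); have := sqr_ge0 (b - d).
have := sqr_ge0 (a + c); have := sqr_ge0 (b + d); split; nra.
Qed.

Lemma L2D f g : L2 f -> L2 g -> L2 (fun p => f p + g p).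
Proof.
move=> /L2P[mf jf] /L2P[mg jg]; apply/L2P; split; first exact: cmeasurableD.
apply: (@intble_le _ (fun p => 2 * sqmod f p + 2 * sqmod g p)).
- by apply: measurable_sqmod; exact: cmeasurableD.
- move=> p; rewrite ger0_norm ?sqmod_ge0// /sqmod cReD cImD; exact: sqrD_le.
- by apply: intbleD; apply: intbleZ.
Qed.

Lemma L2Z f c : L2 f -> L2 (fun p => c * f p).
Proof.
move=> /L2P[mf jf]; apply/L2P; split; first exact: cmeasurableZ.
rewrite (_ : sqmod _ = fun p => (complex.Re c ^+ 2 + complex.Im c ^+ 2) * sqmod f p).
  exact: intbleZ.
by apply/funext => p; rewrite /sqmod cReM cImM; ring.
Qed.

Lemma L2B f g : L2 f -> L2 g -> L2 (fun p => f p - g p).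
Proof.
move=> lf lg; rewrite (_ : (fun p => _) = fun p => f p + (-1) * g p).
  by apply: L2D => //; exact: L2Z.
by apply/funext => p; rewrite mulN1r.
Qed.

Lemma intble_redot f g : L2 f -> L2 g -> intble (redot f g).
Proof.
move=> /L2P[mf jf] /L2P[mg jg].
apply: (@intble_le _ (fun p => sqmod f p + sqmod g p)).
- exact: measurable_redot.
- move=> p; rewrite ler_norml /sqmod /redot; have [H1 H2] := dot_le (complex.Re (f p)) (complex.Im (f p)) (complex.Re (g p)) (complex.Im (g p)); apply/andP; split; lra.
- exact: intbleD.
Qed.

Lemma intble_sqmod f : L2 f -> intble (sqmod f).
Proof. by move=> /L2P[]. Qed.

Lemma sqnormDZ f g (t : R) : L2 f -> L2 g ->
  sqnorm (fun p => f p + t%:C * g p) = sqnorm f + 2 * t * rip f g + t ^+ 2 * sqnorm g.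
Proof.
move=> lf lg.
have jf := intble_sqmod lf; have jg := intble_sqmod lg; have jfg := intble_redot lf lg.
rewrite /sqnorm /rip -!/(rint _) -!rintZ// -!rintD//; last 3 first.
- by apply: intbleD => //; exact: intbleZ.
- exact: intbleZ.
- exact: intbleZ.
by congr rint; apply/funext => p; rewrite /sqmod /redot cReD cImD cReM cImM /=; ring.
Qed.

Lemma ripDl f g h : L2 f -> L2 g -> L2 h -> rip (fun p => f p + g p) h = rip f h + rip g h.
Proof.
move=> lf lg lh; rewrite /rip -!/(rint _) -rintD; [|exact: intble_redot..].
by congr rint; apply/funext => p; rewrite /redot cReD cImD; ring.
Qed.

Lemma ripBl f g h : L2 f -> L2 g -> L2 h -> rip (fun p => f p - g p) h = rip f h - rip g h.
Proof.
move=> lf lg lh; rewrite /rip -!/(rint _) -rintB; [|exact: intble_redot..].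
by congr rint; apply/funext => p; rewrite /redot cReB cImB; ring.
Qed.

(** Cauchy--Schwarz and the weighted arithmetic-geometric mean inequality in
    one; the weight [s] is used to absorb error terms. *)
Lemma le_rip f g (s : R) : 0 < s -> L2 f -> L2 g ->
  `|2 * rip f g| <= s * sqnorm f + s^-1 * sqnorm g.
Proof.
move=> s0 lf lg.
have : 0 <= sqnorm (fun p => f p + (s^-1)%:C * g p) by exact: sqnorm_ge0.
have : 0 <= sqnorm (fun p => f p + (- s^-1)%:C * g p) by exact: sqnorm_ge0.
rewrite !sqnormDZ// => h1 h2.
have E x : x = s * (s^-1 * x) by rewrite mulrA divff ?mul1r// gt_eqF.
rewrite [X in `|X|]E (_ : s^-1 * sqnorm g = s * (s^-1 ^+ 2 * sqnorm g)); last first.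
  by rewrite expr2 -mulrA -E.
rewrite -mulrDr normrM gtr0_norm// ler_pM2l// ler_norml; apply/andP; split; lra.
Qed.

Lemma sqnormD f g : L2 f -> L2 g ->
  sqnorm (fun p => f p + g p) <= 2 * sqnorm f + 2 * sqnorm g.
Proof.
move=> lf lg; rewrite /sqnorm -!/(rint _) -!rintZ; [|exact: intble_sqmod..].
rewrite -rintD; [|apply: intbleZ; exact: intble_sqmod..].
apply: le_rint.
- by apply: intble_sqmod; exact: L2D.
- by apply: intbleD; apply: intbleZ; exact: intble_sqmod.
- by move=> p; rewrite /sqmod cReD cImD; exact: sqrD_le.
Qed.

Lemma sqnormZ f c : L2 f -> sqnorm (fun p => c * f p) =
  (complex.Re c ^+ 2 + complex.Im c ^+ 2) * sqnorm f.
Proof.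
move=> lf; rewrite /sqnorm -!/(rint _) -rintZ; last exact: intble_sqmod.
by congr rint; apply/funext => p; rewrite /sqmod cReM cImM; ring.
Qed.

Lemma sqnorm_opp f g : sqnorm (fun p => f p - g p) = sqnorm (fun p => g p - f p).
Proof.
rewrite /sqnorm; congr Rintegral; apply/funext => p.
by rewrite /sqmod !cReB !cImB; ring.
Qed.

Lemma sqnorm_tri f g h : L2 f -> L2 g -> L2 h ->
  sqnorm (fun p => f p - h p) <=
  2 * sqnorm (fun p => f p - g p) + 2 * sqnorm (fun p => g p - h p).
Proof.
move=> lf lg lh; rewrite (_ : (fun p => f p - h p) = fun p => (f p - g p) + (g p - h p)).
  by apply: sqnormD; exact: L2B.
by apply/funext => p; rewrite addrA subrK.
Qed.

Definition cvgN (u : nat -> cfun3 R) f :=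
  forall e : R, 0 < e -> exists N, forall n, (N <= n)%N ->
    sqnorm (fun p => u n p - f p) <= e.

(** Convergence in norm is that of the real number [sqnorm], which is stated
    with epsilons so that neither filters nor extended reals occur below. *)
Lemma cvgL2P u f : (forall n, L2 (u n)) -> L2 f -> cvgL2 u f <-> cvgN u f.
Proof.
move=> lu lf; have lB n : L2 (fun p => u n p - f p) by exact: L2B.
rewrite /cvgL2 (_ : (fun n => _) =
  (fun n => (Num.sqrt (sqnorm (fun p => u n p - f p)))%:E)); last first.
  by apply/funext => n; rewrite normL2_sqnorm.
split=> [/fine_cvgP[_ /cvgrPdist_le H] e e0|H].
  have se : 0 < Num.sqrt e by rewrite sqrtr_gt0.
  have [N _ HN] := H _ se; exists N => n Nn.
  have := HN n Nn; rewrite /= sub0r normrN ger0_norm ?sqrtr_ge0//.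
  by rewrite ler_sqrt// ltW.
apply/fine_cvgP; split; first exact: nearW.
apply/cvgrPdist_le => e e0.
have [N HN] := H (e ^+ 2) (exprn_gt0 _ e0); exists N => // n /= Nn.
rewrite sub0r normrN ger0_norm ?sqrtr_ge0//.
by rewrite -(ger0_norm (ltW e0)) -sqrtr_sqr ler_sqrt ?HN// exprn_ge0// ltW.
Qed.

Lemma L2_complete (u : nat -> cfun3 R) : (forall n, L2 (u n)) ->
  (forall e : R, 0 < e -> exists N, forall n m, (N <= n)%N -> (N <= m)%N ->
    sqnorm (fun p => u n p - u m p) <= e) ->
  exists2 f, L2 f & cvgN u f.
Proof.
move=> lu cu.
have mu_ n : cmeasurable (u n) by have /L2P[] := lu n.
have lB n m : L2 (fun p => u n p - u m p) by exact: L2B.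
have part (P : R[i] -> R) : (forall a b, P (a - b) = P a - P b) ->
    (forall n, measurable_fun [set: mspace3 R] (fun p => P (u n p))) ->
    (forall n m p, (P (u n p) - P (u m p)) ^+ 2 <= sqmod (fun p => u n p - u m p) p) ->
    exists2 a : space3 R -> R, measurable_fun [set: mspace3 R] a &
     (forall e : R, 0 < e -> exists N, forall n, (N <= n)%N ->
     (sqint mu (fun p => P (u n p) - a p)%R <= e%:E)%E).
  move=> PB mP Ple; apply: (@sqint_complete _ _ _ mu (fun n p => P (u n p))) => //.
  move=> e e0; have [N HN] := cu e e0; exists N => n m Nn Nm.
  apply: (@le_trans _ _ (sqnorm (fun p => u n p - u m p))%:E); last first.
    by rewrite lee_fin HN.
  rewrite /sqnorm -/(rint _) rintE ?intble_sqmod//.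
  apply: ge0_le_integral => //.
  - by move=> p _; rewrite lee_fin sqr_ge0.
  - apply/measurable_EFinP; apply: measurable_funX.
    by apply: measurable_funB.
  - apply/measurable_EFinP; apply: measurable_sqmod.
    by have /L2P[] := lB n m.
  - by move=> p _; rewrite lee_fin; exact: Ple.
have leRe n m p : (complex.Re (u n p) - complex.Re (u m p)) ^+ 2 <=
    sqmod (fun p => u n p - u m p) p by rewrite /sqmod cReB lerDl sqr_ge0.
have leIm n m p : (complex.Im (u n p) - complex.Im (u m p)) ^+ 2 <=
    sqmod (fun p => u n p - u m p) p by rewrite /sqmod cImB lerDr sqr_ge0.
have [a ma Ha] := part (@complex.Re R) cReB (fun n => (mu_ n).1)
  leRe.
have [b mb Hb] := part (@complex.Im R) cImB (fun n => (mu_ n).2)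
  leIm.
pose f : cfun3 R := fun p => a p +i* b p.
have mf : cmeasurable f by split.
have mB n : cmeasurable (fun p => u n p - f p).
  by rewrite (_ : (fun p => _) = (fun p => u n p + (-1) * f p));
   [apply: cmeasurableD => //; exact: cmeasurableZ|apply/funext => p; rewrite mulN1r].
have E n : (\int[mu]_p (sqmod (fun p => u n p - f p) p)%:E =
   sqint mu (fun p => complex.Re (u n p) - a p)%R + sqint mu (fun p => complex.Im (u n p) - b p)%R)%E.
  rewrite /sqint -ge0_integralD//; last 4 first.
  - by move=> p _; rewrite lee_fin sqr_ge0.
  - apply/measurable_EFinP; apply: measurable_funX.
    by apply: measurable_funB => //; have [] := mu_ n.
  - by move=> p _; rewrite lee_fin sqr_ge0.
  - apply/measurable_EFinP; apply: measurable_funX.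
    by apply: measurable_funB => //; have [] := mu_ n.
  by apply: eq_integral => p _; rewrite -EFinD /sqmod cReB cImB.
have K (e : R) : 0 < e -> exists N, forall n, (N <= n)%N ->
   (\int[mu]_p (sqmod (fun p => u n p - f p) p)%:E <= e%:E)%E.
  move=> e0; have e2 : 0 < e / 2 by lra.
  have [N1 H1] := Ha _ e2; have [N2 H2] := Hb _ e2.
  exists (maxn N1 N2) => n; rewrite geq_max => /andP[n1 n2].
  rewrite E (_ : e%:E = (e / 2)%:E + (e / 2)%:E)%E; last by rewrite -EFinD; congr EFin; lra.
  by apply: leeD; [exact: H1|exact: H2].
have lfin n : (\int[mu]_p (sqmod (fun p => u n p - f p) p)%:E < +oo)%E ->
    L2 (fun p => u n p - f p).
  move=> lt; apply/L2P; split => //; apply/integrableP; split.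
    by apply/measurable_EFinP; exact: measurable_sqmod.
  by under eq_integral do rewrite /= ger0_norm ?sqmod_ge0//.
have lf : L2 f.
  have [N HN] := K 1 ltr01.
  rewrite (_ : f = fun p => u N p - (u N p - f p)); last first.
    by apply/funext => p; rewrite opprB addrC subrK.
  apply: L2B => //; apply: lfin; apply: (le_lt_trans (HN N (leqnn _))).
  exact: ltry.
exists f => // e e0; have [N HN] := K e e0; exists N => n Nn.
rewrite -lee_fin /sqnorm -/(rint _) rintE; first exact: HN.
by apply: intble_sqmod; exact: L2B.
Qed.

(** The projection theorem: a minimizing sequence for the distance from [h] to
    the real subspace [V] is Cauchy by the parallelogram identity, and the
    remainder is orthogonal to [V] by the first variation. *)
Lemma projection (V : set (cfun3 R)) h : L2 h ->
  (forall v, V v -> L2 v) -> V (fun=> 0) ->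
  (forall v w (t : R), V v -> V w -> V (fun p => v p + t%:C * w p)) ->
  exists v k, [/\ forall n, V (v n), L2 k, cvgN v (fun p => h p - k p) &
    forall w, V w -> rip k w = 0].
Proof.
move=> lh VL V0 VD.
pose S := [set sqnorm (fun p => h p - v p) | v in V].
have S0 : has_inf S.
  split; first by exists (sqnorm (fun p => h p - (fun=> 0) p)); exists (fun=> 0).
  by exists 0 => _ [v _ <-]; exact: sqnorm_ge0.
pose d := inf S.
have dle v : V v -> d <= sqnorm (fun p => h p - v p).
  by move=> Vv; apply: ge_inf; [exact: S0.2|exists v].
have /choice[v vP] : forall n : nat, exists v, V v /\ sqnorm (fun p => h p - v p) < d + n.+1%:R^-1.
  move=> n; have /inf_adherent : 0 < n.+1%:R^-1 :> R by rewrite invr_gt0.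
  by move=> /(_ _ S0)[_ [w Vw <-] lt]; exists w.
have Vv n := (vP n).1; have vlt n := (vP n).2.
have lv n : L2 (v n) by exact: VL.
have lhv n : L2 (fun p => h p - v n p) by exact: L2B.
have para n m : sqnorm (fun p => v n p - v m p) <= 2 * n.+1%:R^-1 + 2 * m.+1%:R^-1.
  have Vm : V (fun p => v n p + (2^-1)%:C * (v m p + (-1)%:C * v n p)).
    by apply: (VD _ (fun p => v m p + (-1)%:C * v n p)) => //; exact: VD.
  have := dle _ Vm.
  have -> : (fun p => h p - (v n p + (2^-1)%:C * (v m p + (-1)%:C * v n p))) =
      (fun p => (h p - v n p) + (- 2^-1)%:C * (v m p - v n p)).
    apply/funext => p; apply: complex_ext; rewrite ?(cReB, cImB, cReD, cImD, cReM, cImM) /=; ring.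
  have e2 : (fun p => h p - v m p) = (fun p => (h p - v n p) + (-1)%:C * (v m p - v n p)).
    apply/funext => p; apply: complex_ext; rewrite ?(cReB, cImB, cReD, cImD, cReM, cImM) /=; ring.
  have lmn : L2 (fun p => v m p - v n p) by exact: L2B.
  have := vlt m; have := vlt n; rewrite e2 !sqnormDZ// (sqnorm_opp (v n)).
  set a := sqnorm _; set b := sqnorm _; set c := rip _ _.
  set i := n.+1%:R^-1; set j := m.+1%:R^-1.
  rewrite !sqrrN expr1n expr2 => *; lra.
have [g lg vg] : exists2 g, L2 g & cvgN v g.
  apply: L2_complete => // e e0.
  have e4 : 0 < e / 4 by lra.
  have [N HN] : exists N : nat, forall n, (N <= n)%N -> n.+1%:R^-1 <= e / 4.
    have := @cvg_harmonic R => /cvgrPdist_le/(_ _ e4)[N _ HN]; exists N => n Nn.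
    by have := HN n Nn; rewrite /= sub0r normrN ger0_norm ?invr_ge0.
  exists N => n m Nn Nm; apply: le_trans (para n m) _.
  by have := HN n Nn; have := HN m Nm; set i := n.+1%:R^-1; set j := m.+1%:R^-1 => *; lra.
exists v, (fun p => h p - g p); split => //.
- exact: L2B.
- by under eq_fun do rewrite subKr.
move=> w Vw; have lw := VL w Vw.
set k := fun p => h p - g p; have lk : L2 k by exact: L2B.
apply/eqP; rewrite -normr_le0; apply/ler_addgt0Pl => e e0; rewrite addr0.
set W := sqnorm w; have W0 : 0 <= W by exact: sqnorm_ge0.
(* the first variation in the direction [w], with a step of the order of [e] *)
pose t := e / (2 * (1 + W)).
have t0 : 0 < t by rewrite divr_gt0// mulr_gt0// ltr_pwDl.
have tW : t * W <= e / 2.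
  rewrite /t (_ : e / 2 = e / (2 * (1 + W)) * (1 + W)).
    by rewrite ler_pM2l// lerDr.
  by field; rewrite gt_eqF// ltr_pwDl.
have [n [n1 n2]] : exists n : nat, n.+1%:R^-1 <= t * e / 4 /\
    sqnorm (fun p => v n p - g p) <= t * e / 4.
  have te : 0 < t * e / 4 by rewrite divr_gt0// mulr_gt0.
  have := @cvg_harmonic R => /cvgrPdist_le/(_ _ te)[N _ HN].
  have [M HM] := vg _ te; exists (maxn N M); split; last by apply: HM; rewrite leq_maxr.
  have := HN (maxn N M) (leq_maxl _ _).
  by rewrite /= sub0r normrN ger0_norm ?invr_ge0.
move: n1 (vlt n); set i := n.+1%:R^-1 => n1 vln.
have var (s : R) : - i <= 2 * s * rip (fun p => h p - v n p) w + s ^+ 2 * W.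
  have := dle _ (VD _ _ (- s) (Vv n) Vw).
  rewrite (_ : (fun p => _) = (fun p => (h p - v n p) + s%:C * w p)); last first.
    apply/funext => p; apply: complex_ext; rewrite ?(cReB, cImB, cReD, cImD, cReM, cImM) /=; ring.
  rewrite sqnormDZ// -/W; lra.
have kE : rip k w = rip (fun p => h p - v n p) w + rip (fun p => v n p - g p) w.
  rewrite -ripDl//; last exact: L2B.
  by congr (rip _ w); apply/funext => p; rewrite addrA subrK.
have ti : 0 < t^-1 by rewrite invr_gt0.
have := le_rip ti (L2B (lv n) lg) lw; rewrite invrK -/W.
have : t^-1 * sqnorm (fun p => v n p - g p) <= e / 4.
  rewrite mulrC ler_pdivrMr//; lra.
move=> b1 b2.
have b3 : `|2 * rip (fun p => v n p - g p) w| <= 3 / 4 * e by lra.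
have b4 : `|2 * rip (fun p => h p - v n p) w| <= 3 / 4 * e.
  have := var t; have := var (- t); rewrite sqrrN => v1 v2.
  rewrite -(ler_pM2l t0) -[t in t * `|_|]gtr0_norm// -normrM.
  rewrite ler_norml; apply/andP; split; nra.
rewrite kE; move: b3 b4; rewrite !ler_norml => /andP[? ?] /andP[? ?].
apply/andP; split; lra.
Qed.

End Hilbert.

(** * Smooth functions of three variables *)

Section Smooth.
Variable R : realType.
Implicit Types (f g : space3 R -> R) (p q : space3 R) (k : 'I_3).

Definition crd k p : R := nth 0 [:: p.1.1; p.1.2; p.2] k.
Definition upd k (t : R) p : space3 R := (t - crd k p) *: axis R k + p.
Definition pd k f : space3 R -> R := fun p => 'D_(axis R k) f p.
Definition pdable f := forall k p, derivable f p (axis R k).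
Definition inbox (M : R) p := [/\ `|p.1.1| <= M, `|p.1.2| <= M & `|p.2| <= M].
Definition lbnd f := forall M : R, exists C : R, forall p, inbox M p -> `|f p| <= C.

Definition k0 : 'I_3 := @Ordinal 3 0 isT.
Definition k1 : 'I_3 := @Ordinal 3 1 isT.
Definition k2 : 'I_3 := @Ordinal 3 2 isT.

Lemma ord3P k : [\/ k = k0, k = k1 | k = k2].
Proof.
by case: k => [[|[|[|//]]] lt]; [apply: Or31|apply: Or32|apply: Or33]; apply: val_inj.
Qed.

Lemma upd0 t p : upd k0 t p = (t, p.1.2, p.2).
Proof.
case: p => [[x y] z]; rewrite /upd /crd /axis/= /ex.
by congr (_, _, _) => /=; rewrite ?scaler0 ?add0r// /GRing.scale/= mulr1 subrK.
Qed.
Lemma upd1 t p : upd k1 t p = (p.1.1, t, p.2).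
Proof.
case: p => [[x y] z]; rewrite /upd /crd /axis/= /ey.
by congr (_, _, _) => /=; rewrite ?scaler0 ?add0r// /GRing.scale/= mulr1 subrK.
Qed.
Lemma upd2 t p : upd k2 t p = (p.1.1, p.1.2, t).
Proof.
case: p => [[x y] z]; rewrite /upd /crd /axis/= /ez.
by congr (_, _, _) => /=; rewrite ?scaler0 ?add0r// /GRing.scale/= mulr1 subrK.
Qed.

Lemma upd_id k p : upd k (crd k p) p = p.
Proof. by rewrite /upd subrr scale0r add0r. Qed.

Lemma is_derive_line k f p (df : R) :
  is_derive p (axis R k) f df <-> is_derive (crd k p) 1 (fun t => f (upd k t p)) df.
Proof.
have E : (fun h : R => h^-1 *: (f (h *: axis R k + p) - f p)) =
  (fun h : R => h^-1 *: (f (upd k (h *: 1 + crd k p) p) - f (upd k (crd k p) p))).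
  by apply/funext => h; rewrite upd_id /upd addrK [h *: 1]mulr1.
split=> -[d1 d2]; split.
- by move: d1; rewrite /derivable /= E.
- by move: d2; rewrite /derive /= E.
- by rewrite /derivable /= E.
- by rewrite /derive /= E.
Qed.

Lemma pdableP f k p : pdable f -> is_derive p (axis R k) f (pd k f p).
Proof. by move=> H; split => //; exact: H. Qed.

Lemma is_derive0 f (x y z : R) : pdable f ->
  is_derive x 1 (fun t => f (t, y, z)) (pd k0 f (x, y, z)).
Proof.
move=> H; have /is_derive_line := pdableP k0 (x, y, z) H.
by under eq_fun do rewrite upd0.
Qed.
Lemma is_derive1 f (x y z : R) : pdable f ->
  is_derive y 1 (fun t => f (x, t, z)) (pd k1 f (x, y, z)).
Proof.
move=> H; have /is_derive_line := pdableP k1 (x, y, z) H.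
by under eq_fun do rewrite upd1.
Qed.
Lemma is_derive2 f (x y z : R) : pdable f ->
  is_derive z 1 (fun t => f (x, y, t)) (pd k2 f (x, y, z)).
Proof.
move=> H; have /is_derive_line := pdableP k2 (x, y, z) H.
by under eq_fun do rewrite upd2.
Qed.

Lemma derivable_continuous1 (g : R -> R) : (forall x : R, derivable g x 1) -> continuous g.
Proof. by move=> H x; apply: differentiable_continuous; apply/derivable1_diffP. Qed.

Lemma mean_value_bound (g dg : R -> R) (a b C M : R) :
  (forall x : R, is_derive x 1 g (dg x)) -> `|a| <= M -> `|b| <= M ->
  (forall x, `|x| <= M -> `|dg x| <= C) -> `|g b - g a| <= C * `|b - a|.
Proof.
move=> dgP aM bM dC.
wlog ab : a b aM bM / a <= b.
  move=> W; have [ab|/ltW ba] := leP a b; first exact: W.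
  by rewrite -normrN opprB -[X in _ <= _ * X]normrN opprB; exact: W.
have cg : continuous g by apply: derivable_continuous1 => x; have [] := dgP x.
have [c] := @MVT_segment R g dg a b ab (fun x _ => dgP x) (continuous_subspaceT cg).
rewrite in_itv/= => /andP[ac cb] ->; rewrite normrM ler_wpM2r// dC//.
move: aM bM; rewrite !ler_norml => /andP[? ?] /andP[? ?]; apply/andP; split; lra.
Qed.

(** Bounded partial derivatives make a function Lipschitz along the three edges
    joining two points. *)
Lemma lbnd_pd_continuous f : pdable f -> (forall k, lbnd (pd k f)) -> continuous f.
Proof.
move=> df bf [[x y] z]; apply/cvgrPdist_le => e e0.
pose M := `|x| + `|y| + `|z| + 1.
have [C0 H0] := bf k0 M; have [C1 H1] := bf k1 M; have [C2 H2] := bf k2 M.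
pose C := 1 + `|C0| + `|C1| + `|C2|.
have C_gt0 : 0 < C by rewrite /C -!addrA ltr_pwDl// !addr_ge0.

pose r := Num.min 1 (e / (3 * C)).
have r0 : 0 < r by rewrite lt_min ltr01 divr_gt0// mulr_gt0.
exists ([set q | ball x r q.1 /\ ball y r q.2], ball z r).
  split; last exact: nbhsx_ballx.
  by exists (ball x r, ball y r) => [|[]//]; split; exact: nbhsx_ballx.
move=> [[x' y'] z'] [[/= b0 b1] b2].
rewrite /ball/= in b0 b1 b2.
have r1 : r <= 1 by rewrite ge_min lexx.
have rC : 3 * C * r <= e.
  have : r <= e / (3 * C) by rewrite ge_min lexx orbT.
  by rewrite ler_pdivlMr ?mulr_gt0// mulrC.
have bd (u u' : R) : `|u - u'| < r -> `|u'| <= `|u| + 1.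
  move=> b; have := ler_normB u (u - u'); rewrite opprB addrC subrK; lra.
have nx := bd _ _ b0; have ny := bd _ _ b1; have nz := bd _ _ b2.
have nn (u : R) : 0 <= `|u| by [].
have := nn x; have := nn y; have := nn z => zz yy xx.
have le0 : `|f (x, y, z) - f (x', y, z)| <= C0 * `|x - x'|.
  apply: (@mean_value_bound (fun t => f (t, y, z)) (fun t => pd k0 f (t, y, z)) x' x C0 M).
  - by move=> t; exact: is_derive0.
  - rewrite /M; lra.
  - rewrite /M; lra.
  - by move=> t tM; apply: H0; split => /=; first [exact: tM|rewrite /M; lra].
have le1 : `|f (x', y, z) - f (x', y', z)| <= C1 * `|y - y'|.
  apply: (@mean_value_bound (fun t => f (x', t, z)) (fun t => pd k1 f (x', t, z)) y' y C1 M).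
  - by move=> t; exact: is_derive1.
  - rewrite /M; lra.
  - rewrite /M; lra.
  - by move=> t tM; apply: H1; split => /=; first [exact: tM|rewrite /M; lra].
have le2 : `|f (x', y', z) - f (x', y', z')| <= C2 * `|z - z'|.
  apply: (@mean_value_bound (fun t => f (x', y', t)) (fun t => pd k2 f (x', y', t)) z' z C2 M).
  - by move=> t; exact: is_derive2.
  - rewrite /M; lra.
  - rewrite /M; lra.
  - by move=> t tM; apply: H2; split => /=; first [exact: tM|rewrite /M; lra].
have leC (c u : R) : c <= C -> 0 <= u -> u < r -> c * u <= C * r.
  move=> cC u0 ur; apply: (@le_trans _ _ (C * u)); first exact: ler_wpM2r.
  by rewrite ler_pM2l// ltW.
have l0 : C0 * `|x - x'| <= C * r by apply: leC => //; have := ler_norm C0; rewrite /C; have := nn C1; have := nn C2; lra.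
have l1 : C1 * `|y - y'| <= C * r by apply: leC => //; have := ler_norm C1; rewrite /C; have := nn C0; have := nn C2; lra.
have l2 : C2 * `|z - z'| <= C * r by apply: leC => //; have := ler_norm C2; rewrite /C; have := nn C1; have := nn C0; lra.
have -> : f (x, y, z) - f (x', y', z') = (f (x, y, z) - f (x', y, z)) +
  (f (x', y, z) - f (x', y', z)) + (f (x', y', z) - f (x', y', z')) by ring.
apply: le_trans (ler_normD _ _) _.
have := ler_normD (f (x, y, z) - f (x', y, z)) (f (x', y, z) - f (x', y', z)).
nra.
Qed.

(** Smoothness by coinduction: local boundedness is stable under taking the
    next derivative, and that is enough for continuity of the previous one. *)
Lemma smooth_coind (C : set (space3 R -> R)) :
  (forall f, C f -> lbnd f) -> (forall f, C f -> pdable f) ->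
  (forall f k, C f -> C (pd k f)) -> C `<=` @smooth R.
Proof.
move=> Cb Cd Cp f Cf s.
have Ci : C (iter_partial s f) by elim: s => [//|k s IH] /=; exact: Cp.
split; last by move=> k p; exact: Cd.
by apply: lbnd_pd_continuous; [exact: Cd|move=> k; apply: Cb; exact: Cp].
Qed.

(** The derivatives of a generator are in general sums of products of generators,
    so that smoothness is proved for the whole algebra at once. *)
Inductive alg (G : set (space3 R -> R)) : set (space3 R -> R) :=
| alg_gen f of G f : alg G f
| alg_cst (c : R) : alg G (fun=> c)
| alg_add f g of alg G f & alg G g : alg G (fun p => f p + g p)
| alg_mul f g of alg G f & alg G g : alg G (fun p => f p * g p).

Lemma inbox_le M N p : M <= N -> inbox M p -> inbox N p.
Proof. by move=> MN [a b c]; split; exact: le_trans MN. Qed.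

Lemma lbnd_cst c : lbnd (fun=> c).
Proof. by move=> M; exists `|c|. Qed.
Lemma lbndD f g : lbnd f -> lbnd g -> lbnd (fun p => f p + g p).
Proof.
move=> bf bg M; have [C H] := bf M; have [D K] := bg M; exists (C + D) => p ip.
by apply: le_trans (ler_normD _ _) _; apply: lerD; [exact: H|exact: K].
Qed.
Lemma lbndM f g : lbnd f -> lbnd g -> lbnd (fun p => f p * g p).
Proof.
move=> bf bg M; have [C H] := bf M; have [D K] := bg M; exists (C * D) => p ip.
by rewrite normrM; apply: ler_pM => //; [exact: H|exact: K].
Qed.

Lemma pd_cst k c : pd k (fun=> c) = fun=> 0.
Proof. by apply/funext => p; rewrite /pd derive_cst. Qed.
Lemma pdable_cst c : pdable (fun=> c).
Proof. by move=> k p; exact: derivable_cst. Qed.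
Lemma pdD k f g : pdable f -> pdable g -> pd k (fun p => f p + g p) = fun p => pd k f p + pd k g p.
Proof. by move=> df dg; apply/funext => p; rewrite /pd deriveD. Qed.
Lemma pdableD f g : pdable f -> pdable g -> pdable (fun p => f p + g p).
Proof. by move=> df dg k p; apply: derivableD; [exact: df|exact: dg]. Qed.
Lemma pdM k f g : pdable f -> pdable g ->
  pd k (fun p => f p * g p) = fun p => pd k f p * g p + f p * pd k g p.
Proof.
move=> df dg; apply/funext => p; rewrite /pd deriveM// addrC [_ *: _]mulrC; congr (_ + _).
Qed.
Lemma pdableM f g : pdable f -> pdable g -> pdable (fun p => f p * g p).
Proof. by move=> df dg k p; apply: derivableM; [exact: df|exact: dg]. Qed.

(** A class of locally bounded functions whose partial derivatives lie in the
    algebra that it generates consists of smooth functions: continuity of each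
    derivative comes from local boundedness of the next ones. *)
Lemma alg_smooth (G : set (space3 R -> R)) :
  (forall f, G f -> lbnd f) -> (forall f, G f -> pdable f) ->
  (forall f k, G f -> alg G (pd k f)) -> alg G `<=` @smooth R.
Proof.
move=> Gb Gd Gp.
have Ad f : alg G f -> pdable f.
  elim=> [{}f|c|{}f g _ H1 _ H2|{}f g _ H1 _ H2]; [exact: Gd|exact: pdable_cst|exact: pdableD|exact: pdableM].
apply: smooth_coind => // [f|f k].
  elim=> [{}f|c|{}f g _ H1 _ H2|{}f g _ H1 _ H2]; [exact: Gb|exact: lbnd_cst|exact: lbndD|exact: lbndM].
elim=> [{}f|c|{}f g a1 H1 a2 H2|{}f g a1 H1 a2 H2]; first exact: Gp.
- by rewrite pd_cst; exact: alg_cst.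
- by rewrite pdD; [exact: alg_add|exact: Ad..].
- by rewrite pdM; [apply: alg_add; apply: alg_mul|exact: Ad..].
Qed.

Lemma smooth_continuous f : smooth f -> continuous f.
Proof. by move=> /(_ [::])[]. Qed.
Lemma smooth_pdable f : smooth f -> pdable f.
Proof. by move=> /(_ [::])[_ H] k p; exact: H. Qed.
Lemma smooth_pd f k : smooth f -> smooth (pd k f).
Proof. by move=> sf s; have := sf (rcons s k); rewrite /iter_partial foldr_rcons. Qed.

Lemma compact_inbox M : compact [set p : space3 R | inbox M p].
Proof.
rewrite (_ : [set p | _] = (`[-M, M] `*` `[-M, M] `*` `[-M, M])%classic).
  by apply: compact_setX; [apply: compact_setX|]; exact: segment_compact.
apply/seteqP; split=> -[[x y] z] /=; rewrite /inbox /= !in_itv /= -!ler_norml.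
  by case.
by case=> -[].
Qed.

Lemma continuous_lbnd f : continuous f -> lbnd f.
Proof.
move=> cf M.
have : compact (f @` [set p | inbox M p]).
  by apply: continuous_compact; [exact: continuous_subspaceT|exact: compact_inbox].
move=> /compact_bounded[N [_ HN]]; exists (N + 1) => p ip.
by apply: HN; [rewrite ltrDl|exists p].
Qed.

Lemma smooth_lbnd f : smooth f -> lbnd f.
Proof. by move=> /smooth_continuous/continuous_lbnd. Qed.

Lemma smooth_alg : alg (@smooth R) `<=` @smooth R.
Proof.
apply: alg_smooth; [exact: smooth_lbnd|exact: smooth_pdable|].
by move=> f k sf; apply: alg_gen; exact: smooth_pd.
Qed.

Lemma smooth_cst c : smooth (fun _ : space3 R => c).
Proof. by apply: smooth_alg; exact: alg_cst. Qed.
Lemma smoothD f g : smooth f -> smooth g -> smooth (fun p => f p + g p).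
Proof. by move=> sf sg; apply: smooth_alg; apply: alg_add; exact: alg_gen. Qed.
Lemma smoothM f g : smooth f -> smooth g -> smooth (fun p => f p * g p).
Proof. by move=> sf sg; apply: smooth_alg; apply: alg_mul; exact: alg_gen. Qed.
Lemma smoothZ f c : smooth f -> smooth (fun p => c * f p).
Proof. by move=> sf; exact: (smoothM (smooth_cst c) sf). Qed.
Lemma smoothN f : smooth f -> smooth (fun p => - f p).
Proof. by move=> sf; under eq_fun do rewrite -mulN1r; exact: smoothZ. Qed.
Lemma smoothB f g : smooth f -> smooth g -> smooth (fun p => f p - g p).
Proof. by move=> sf sg; apply: (smoothD sf); exact: smoothN. Qed.

Lemma pdN k f : pdable f -> pd k (fun p => - f p) = fun p => - pd k f p.
Proof. by move=> df; apply/funext => p; rewrite /pd deriveN//; exact: df. Qed.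
Lemma pdB k f g : pdable f -> pdable g -> pd k (fun p => f p - g p) = fun p => pd k f p - pd k g p.
Proof. by move=> df dg; apply/funext => p; rewrite /pd deriveB. Qed.
Lemma pdZ k f c : pdable f -> pd k (fun p => c * f p) = fun p => c * pd k f p.
Proof.
move=> df; rewrite (pdM k (@pdable_cst c) df).
by apply/funext => p; rewrite pd_cst mul0r add0r.
Qed.

End Smooth.

(** * Smooth functions of one variable and bump functions *)

Section OneVariable.
Variable R : realType.
Implicit Types (F G : R -> R) (f g : space3 R -> R) (k : 'I_3).

(** Smoothness in one variable is that of the function of the last coordinate,
    which makes the calculus of the three-dimensional case available. *)
Definition sm1 F := smooth (fun p : space3 R => F p.2).
Definition d1 F : R -> R := fun x => 'D_1 F x.

Lemma d1P F (x : R) : derivable F x 1 -> is_derive x 1 F (d1 F x).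
Proof. by move=> H; split. Qed.

Lemma is_derive_comp k F g p (a b : R) :
  is_derive (g p) 1 F a -> is_derive p (axis R k) g b ->
  is_derive p (axis R k) (fun q => F (g q)) (a * b).
Proof.
move=> dF /is_derive_line dg; apply/is_derive_line.
have := @is_derive1_comp R F (fun t => g (upd k t p)) (crd k p) a b.
by rewrite upd_id; apply.
Qed.

Lemma pdable_comp F g : (forall x : R, derivable F x 1) -> pdable g ->
  pdable (fun q => F (g q)).
Proof.
by move=> dF dg k p; have [] := is_derive_comp (d1P (dF (g p))) (pdableP k p dg).
Qed.

Lemma pd_comp k F g : (forall x : R, derivable F x 1) -> pdable g ->
  pd k (fun q => F (g q)) = fun p => d1 F (g p) * pd k g p.
Proof.
move=> dF dg; apply/funext => p.
by have [] := is_derive_comp (d1P (dF (g p))) (pdableP k p dg).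
Qed.

Lemma is_derive_crd j k p : is_derive p (axis R k) (crd j) (j == k)%:R.
Proof.
apply/is_derive_line.
have E t : crd j (upd k t p) = if j == k then t else crd j p.
  by case: (ord3P j) => ->; case: (ord3P k) => ->; rewrite ?(upd0, upd1, upd2).
under eq_fun do rewrite E.
by case: (j == k); [exact: is_derive_id|exact: is_derive_cst].
Qed.

Lemma pdable_crd j : pdable (@crd R j).
Proof. by move=> k p; have [] := is_derive_crd j k p. Qed.
Lemma pd_crd j k : pd k (@crd R j) = fun=> (j == k)%:R.
Proof. by apply/funext => p; have [] := is_derive_crd j k p. Qed.

Lemma lbnd_crd j : lbnd (@crd R j).
Proof.
by move=> M; exists M => p [h0 h1 h2]; case: (ord3P j) => ->; rewrite /crd.
Qed.

Lemma smooth_crd j : smooth (@crd R j).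
Proof.
apply: (@alg_smooth R [set @crd R j]); last exact: alg_gen.
- by move=> _ ->; exact: lbnd_crd.
- by move=> _ ->; exact: pdable_crd.
- by move=> _ k ->; rewrite pd_crd; exact: alg_cst.
Qed.

Lemma sm1_derivable F (x : R) : sm1 F -> derivable F x 1.
Proof. by move=> /smooth_pdable sF; have [] := is_derive2 0 0 x sF. Qed.

Lemma pd_snd k F : (forall x : R, derivable F x 1) ->
  pd k (fun p => F p.2) = fun p => d1 F p.2 * (k2 == k)%:R.
Proof. by move=> dF; rewrite (pd_comp k dF (@pdable_crd k2)) pd_crd. Qed.

Lemma sm1_d1 F : sm1 F -> sm1 (d1 F).
Proof.
move=> sF; have := smooth_pd k2 sF.
rewrite pd_snd; last by move=> x; exact: sm1_derivable.
by rewrite eqxx; under eq_fun do rewrite mulr1.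
Qed.

Lemma lbnd_comp F g : continuous F -> lbnd g -> lbnd (fun p => F (g p)).
Proof.
move=> cF bg M; have [C gC] := bg M.
have : compact (F @` `[-C, C]%classic).
  by apply: continuous_compact; [exact: continuous_subspaceT|exact: segment_compact].
move=> /compact_bounded[N [_ HN]]; exists (N + 1) => p ip.
apply: HN; first by rewrite ltrDl.
by exists (g p) => //=; rewrite in_itv/= -ler_norml gC.
Qed.

Lemma sm1_coind (C : set (R -> R)) :
  (forall F, C F -> (forall x : R, derivable F x 1) /\ C (d1 F)) -> C `<=` sm1.
Proof.
move=> HC F CF.
apply: (@alg_smooth R [set h | exists2 G, C G & h = fun p => G p.2]); last first.
- by apply: alg_gen; exists F.
- move=> _ k [G CG ->]; rewrite pd_snd; last exact: (HC _ CG).1.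
  apply: alg_mul; last exact: alg_cst.
  by apply: alg_gen; exists (d1 G) => //; exact: (HC _ CG).2.
- move=> _ [G CG ->]; apply: (@pdable_comp G (@crd R k2)); [exact: (HC _ CG).1|exact: pdable_crd].
- move=> _ [G CG ->]; apply: (@lbnd_comp G (@crd R k2)); last exact: lbnd_crd.
  by apply: derivable_continuous1; exact: (HC _ CG).1.
Qed.

Lemma sm1_comp F g : sm1 F -> smooth g -> smooth (fun p => F (g p)).
Proof.
move=> sF sg.
apply: (@alg_smooth R [set h | smooth h \/ exists2 G, sm1 G & h = fun p => G (g p)]);
  last by apply: alg_gen; right; exists F.
- move=> h [sh|[G sG ->]]; first exact: smooth_lbnd.
  apply: lbnd_comp; last exact: smooth_lbnd.
  by apply: derivable_continuous1 => x; exact: sm1_derivable.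
- move=> h [sh|[G sG ->]]; first exact: smooth_pdable.
  by apply: pdable_comp; [move=> x; exact: sm1_derivable|exact: smooth_pdable].
- move=> h k [sh|[G sG ->]]; first by apply: alg_gen; left; exact: smooth_pd.
  rewrite pd_comp; [|by move=> x; exact: sm1_derivable|exact: smooth_pdable].
  apply: alg_mul; apply: alg_gen; last by left; exact: smooth_pd.
  by right; exists (d1 G); [exact: sm1_d1|].
Qed.

Lemma sm1_affine F a b : sm1 F -> sm1 (fun x => F (a * x + b)).
Proof.
move=> sF; apply: (sm1_comp sF); apply: (smoothD _ (smooth_cst b)).
by apply: smoothZ; exact: (smooth_crd k2).
Qed.

Lemma sm1M F G : sm1 F -> sm1 G -> sm1 (fun x => F x * G x).
Proof. exact: smoothM. Qed.
Lemma sm1_cst c : sm1 (fun=> c).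
Proof. exact: smooth_cst. Qed.
Lemma sm1_id : sm1 id.
Proof. exact: (smooth_crd k2). Qed.

Lemma d1_eq F G : (forall x : R, is_derive x 1 F (G x)) -> d1 F = G.
Proof. by move=> H; apply/funext => x; have [] := H x. Qed.

Lemma sm1_expR : sm1 expR.
Proof.
apply: (@sm1_coind [set expR]) => // _ ->; split; first by move=> x; exact: derivable_expR.
by apply: d1_eq => x; exact: is_derive_expR.
Qed.

Lemma sm1_cos_sin : sm1 cos /\ sm1 sin.
Proof.
pose C := [set h | exists a b : R, h = fun x : R => a * cos x + b * sin x].
have CP : C `<=` sm1.
  apply: sm1_coind => _ [a [b ->]].
  have H (x : R) : is_derive x 1 (fun x : R => a * cos x + b * sin x) (b * cos x + (- a) * sin x).
    rewrite (_ : b * cos x + _ = a *: (- sin x) + b *: cos x).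
      exact: (@is_deriveD _ _ _ (a *: cos) (b *: sin)).
    by rewrite /GRing.scale/=; ring.
  split; first by move=> x; have [] := H x.
  by exists b, (- a); exact: d1_eq.
split; apply: CP.
  by exists 1, 0; apply/funext => x; rewrite mul1r mul0r addr0.
by exists 0, 1; apply/funext => x; rewrite mul1r mul0r add0r.
Qed.

(** The functions [P(1/x) exp(-1/x)], extended by zero to the left half-line, form a
    class that is closed under derivation and contains the flat step. *)
Definition flat (P : {poly R}) (x : R) : R :=
  if 0 < x then P.[x^-1] * expR (- x^-1) else 0.
Definition estep (x : R) : R := if 0 < x then expR (- x^-1) else 0.

(** The exponential beats a polynomial; by induction on the polynomial, half
    of the decay being spent on each factor of the variable. *)
Lemma poly_expR_bound (P : {poly R}) : forall a : R, 0 < a ->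
  exists C : R, forall y : R, 0 < y -> `|P.[y]| * expR (- (a * y)) <= C.
Proof.
elim/poly_ind: P => [|P c IH] a a0.
  by exists 0 => y y0; rewrite horner0 normr0 mul0r.
have a2 : 0 < a / 2 by rewrite divr_gt0.
have [C HC] := IH _ a2.
exists (C * (a / 2)^-1 + `|c|) => y y0.
rewrite hornerMXaddC.
have e1 : expR (- (a * y)) <= 1 by rewrite -expR0 ler_expR oppr_le0 mulr_ge0// ltW.
apply: (@le_trans _ _ (`|P.[y]| * y * expR (- (a * y)) + `|c| * expR (- (a * y)))).
  rewrite -mulrDl ler_wpM2r ?expR_ge0//; apply: le_trans (ler_normD _ _) _.
  by rewrite normrM (gtr0_norm y0).
apply: lerD; last by rewrite ler_piMr.
have ye : y * expR (- (a / 2 * y)) <= (a / 2)^-1.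
  rewrite expRN ler_pdivrMr ?expR_gt0// -ler_pdivrMl ?invr_gt0// invrK.
  by apply: le_trans (expR_ge1Dx _); rewrite lerDr.
have -> : `|P.[y]| * y * expR (- (a * y)) =
    (`|P.[y]| * expR (- (a / 2 * y))) * (y * expR (- (a / 2 * y))).
  by rewrite (_ : - (a * y) = - (a / 2 * y) + - (a / 2 * y)) ?expRD; [ring|field].
apply: ler_pM => //; rewrite ?mulr_ge0 ?expR_ge0//; [exact: ltW|exact: HC].
Qed.

(** Away from the origin this is the chain rule; at the origin the function is
    [O(h^2)] because [y^2 P(y) exp(-y)] is bounded. *)
Lemma flat_is_derive (P : {poly R}) (x : R) :
  is_derive x 1 (flat P) (flat ('X^2 * (P - P^`())) x).
Proof.
have [x0|x0|<-] := ltgtP 0 x.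
- have E : {near x, (fun t : R => P.[t^-1] * expR (- t^-1)) =1 flat P}.
    near=> t; rewrite /flat; suff -> : 0 < t by [].
    by near: t; exact: lt_nbhsr.
  have iV : is_derive x 1 (fun t : R => t^-1) (- x ^- 2).
    rewrite (_ : - x ^- 2 = - x ^- 2 *: 1); last by rewrite /GRing.scale/= mulr1.
    by apply: (@is_deriveV R id); rewrite gt_eqF.
  have iN : is_derive x 1 (fun t : R => - t^-1) (x ^- 2).
    by rewrite (_ : x ^- 2 = - - x ^- 2); [exact: is_deriveN|rewrite opprK].
  have iP := is_derive1_comp (is_derive_poly P x^-1) iV.
  have iE := @is_derive1_comp R expR (fun t : R => - t^-1) x _ _ (is_derive_expR _) iN.
  apply: (near_eq_is_derive E).
  apply: (is_derive_eq (is_deriveM iP iE)).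
  rewrite /flat x0 /GRing.scale/= !hornerE /= exprVn; ring.
- have E : {near x, (fun t : R => 0 : R) =1 flat P}.
    near=> t; rewrite /flat; suff -> : 0 < t = false by [].
    by apply/negbTE; rewrite -leNgt ltW//; near: t; exact: lt_nbhsl.
  rewrite /flat [0 < x]ltNge (ltW x0) /=.
  by apply: (near_eq_is_derive E); exact: is_derive_cst.
rewrite [flat _ 0]/flat ltxx.
have [C HC] := poly_expR_bound ('X^2 * P) ltr01.
have C0 : 0 <= C by apply: le_trans (HC 1 ltr01); rewrite mulr_ge0 ?expR_ge0.
have F0 (h : R) : `|flat P h| <= C * h ^+ 2.
  rewrite /flat; case: ifPn => h0; last by rewrite normr0 mulr_ge0 ?sqr_ge0.
  have := HC h^-1; rewrite invr_gt0 mul1r hornerM hornerXn normrM => /(_ h0) H.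
  rewrite normrM (ger0_norm (expR_ge0 _)).
  have h2 : 0 < h ^+ 2 by rewrite exprn_gt0.
  rewrite exprVn normfV (ger0_norm (ltW h2)) -mulrA in H.
  by rewrite -(ler_pdivrMr _ _ h2) mulrC.
have cv : (fun h : R => h^-1 *: (flat P (h *: 1 + 0) - flat P 0)) @ 0^' --> (0 : R).
  apply/cvgrPdist_le => e e0.
  near=> h.
  have hn : h != 0 by near: h; exact: nbhs_dnbhs_neq.
  rewrite sub0r normrN /GRing.scale/= mulr1 addr0 [flat _ 0]/flat ltxx subr0.
  rewrite normrM normfV ler_pdivrMl ?normr_gt0//; apply: le_trans (F0 h) _.
  rewrite -(real_normK (num_real h)) expr2 mulrA mulrC ler_pM2l ?normr_gt0//.
  have : `|h| <= e / (C + 1).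
    near: h; apply: nbhs_dnbhs; near=> h.
    rewrite -[h]subr0 distrC; near: h; apply: cvgr_dist_le => //.
    by rewrite divr_gt0// ltr_wpDl.
  rewrite ler_pdivlMr ?ltr_wpDl// => H; apply: le_trans H.
  by rewrite mulrC ler_wpM2l// lerDl.
split; first by apply/cvg_ex; exists 0.
exact: (cvg_lim _ cv).
Unshelve. all: end_near. Qed.

Lemma sm1_flat (P : {poly R}) : sm1 (flat P).
Proof.
apply: (@sm1_coind [set h | exists P, h = flat P]); last by exists P.
move=> _ [Q ->]; split; first by move=> x; have [] := flat_is_derive Q x.
by exists ('X^2 * (Q - Q^`())); apply: d1_eq => x; exact: flat_is_derive.
Qed.

Lemma sm1_estep : sm1 estep.
Proof.
rewrite (_ : estep = flat 1); first exact: sm1_flat.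
by apply/funext => x; rewrite /flat /estep hornerE mul1r.
Qed.

Lemma estep_ge0 x : 0 <= estep x.
Proof. by rewrite /estep; case: ifP => // _; exact: expR_ge0. Qed.
Lemma estep_gt0 x : 0 < x -> 0 < estep x.
Proof. by rewrite /estep => ->; exact: expR_gt0. Qed.
Lemma estep_le1 x : estep x <= 1.
Proof.
rewrite /estep; case: ifP => // x0.
by rewrite -expR0 ler_expR oppr_le0 invr_ge0 ltW.
Qed.
Lemma estep_le0 x : x <= 0 -> estep x = 0.
Proof. by rewrite /estep ltNge => ->. Qed.

(** A bump supported in the interval from [s] to [t + 1/n]; it tends to the
    indicator function of the half-open interval from [s] to [t] as [n] grows. *)
Definition ebump s t n (x : R) : R := estep (n * (x - s)) * estep (n * (n * (t - x) + 1)).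

Lemma sm1_ebump s t n : sm1 (ebump s t n).
Proof.
apply: sm1M.
  rewrite (_ : (fun _ => _) = (fun x => estep (n * x + - (n * s)))).
    exact: (sm1_affine _ _ sm1_estep).
  by apply/funext => x; rewrite mulrBr.
rewrite (_ : (fun _ => _) = (fun x => estep (- (n * n) * x + (n * n * t + n)))).
  exact: (sm1_affine _ _ sm1_estep).
by apply/funext => x; congr estep; ring.
Qed.

Lemma ebump_ge0 s t n x : 0 <= ebump s t n x.
Proof. by rewrite mulr_ge0 ?estep_ge0. Qed.
Lemma ebump_le1 s t n x : ebump s t n x <= 1.
Proof. by rewrite mulr_ile1 ?estep_ge0 ?estep_le1. Qed.

Lemma ebump_out s t n x : 1 <= n -> ~ (s < x < t + 1) -> ebump s t n x = 0.
Proof.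
move=> n1 H; have n0 : 0 <= n by apply: le_trans n1.
rewrite /ebump; have [xs|sx] := leP x s.
  by rewrite estep_le0 ?mul0r// mulr_ge0_le0// subr_le0.
rewrite [X in _ * X]estep_le0 ?mulr0// mulr_ge0_le0//.
have tx : t + 1 <= x by rewrite leNgt; apply/negP => xt; apply: H; rewrite sx.
nra.
Qed.

Lemma estep_cvg1 (u : nat -> R) (d : R) : 0 < d -> (forall n, n.+1%:R * d <= u n) ->
  (fun n => estep (u n)) @ \oo --> (1 : R).
Proof.
move=> d0 ud; apply/cvgrPdist_le => e e0.
have de : 0 < d * e by rewrite mulr_gt0.
have /cvgrPdist_le/(_ _ de) := @cvg_harmonic R.
apply: filterS => n; rewrite /= sub0r normrN ger0_norm ?invr_ge0// => H.
have n0 : 0 < n.+1%:R :> R by [].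
have u0 : 0 < u n by apply: lt_le_trans (ud n); rewrite mulr_gt0.
rewrite ger0_norm ?subr_ge0 ?estep_le1// /estep u0.
have := expR_ge1Dx (- (u n)^-1); suff : (u n)^-1 <= e by lra.
rewrite -[_^-1]mul1r ler_pdivrMr//; apply: le_trans (_ : e * (n.+1%:R * d) <= _); last first.
  by rewrite ler_wpM2l// ltW.
by move: H; rewrite -[_^-1]mul1r ler_pdivrMr// => H; lra.
Qed.

Lemma ebump_cvg s t x :
  (fun n => ebump s t n.+1%:R x) @ \oo --> (\1_(`]s, t]%classic) x : R).
Proof.
rewrite indicE; have [sx|xs] := ltP s x; last first.
  rewrite memNset /= ?in_itv/= ?ltNge ?xs//; apply: cvg_near_cst; apply: nearW => n.
  by rewrite /ebump estep_le0 ?mul0r// mulr_ge0_le0// subr_le0.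
have c1 : (fun n => estep (n.+1%:R * (x - s))) @ \oo --> (1 : R).
  by apply: (@estep_cvg1 _ (x - s)); rewrite ?subr_gt0.
have [xt|tx] := leP x t.
  rewrite mem_set /= ?in_itv/= ?sx// -[1%:R]mul1r.
  apply: cvgM => //; apply: (@estep_cvg1 _ 1) => // n; rewrite ler_wpM2l//.
  by rewrite lerDr mulr_ge0// subr_ge0.
rewrite memNset /= ?in_itv/= ?sx ?leNgt ?tx//; apply: cvg_near_cst.
have xt0 : 0 < x - t by rewrite subr_gt0.
have /cvgrPdist_le/(_ _ xt0) := @cvg_harmonic R.
apply: filterS => n; rewrite /= sub0r normrN ger0_norm ?invr_ge0// => H.
rewrite /ebump [X in _ * X]estep_le0 ?mulr0// mulr_ge0_le0//.
by move: H; rewrite -[_^-1]mul1r ler_pdivrMr// => H; lra.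
Qed.

End OneVariable.

(** * Compactly supported functions and integration by parts *)

Section Measurability.
Context d (T : measurableType d) (R : realType).

(** A function that is measurable in one variable and continuous in the other
    is jointly measurable: freeze the second variable on a finer and finer
    grid. *)
Lemma caratheodory_measurable (f : T -> R -> R) :
  (forall y, measurable_fun [set: T] (f ^~ y)) -> (forall x, continuous (f x)) ->
  measurable_fun [set: T * measurableTypeR R] (fun p : T * measurableTypeR R => f p.1 p.2).
Proof.
move=> mf cf.
pose g (n : nat) (y : R) : R := (Num.floor (y * n.+1%:R))%:~R / n.+1%:R.
apply: (@measurable_fun_cvg _ _ _ _ (fun n p => f p.1 (g n p.2))).
  move=> n _ A mA; rewrite setTI.
  rewrite (_ : _ @^-1` A = \bigcup_(i : int)
    ((f ^~ (i%:~R / n.+1%:R)) @^-1` A `*` [set y : R | Num.floor (y * n.+1%:R) = i])); last first.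
    apply/seteqP; split=> -[x y] /=; first by move=> H; exists (Num.floor (y * n.+1%:R)).
    by move=> [i _ [/= H E]]; rewrite /g E.
  apply: countable_bigcupT_measurable; first exact: countableP.
  move=> i; apply: measurableX; first by rewrite -[X in measurable X]setTI; exact: mf.
  rewrite (_ : [set y | _] = `[i%:~R / n.+1%:R, (i + 1)%:~R / n.+1%:R[%classic).
    exact: measurable_itv.
  apply/seteqP; split => y; rewrite /= in_itv/= ler_pdivrMr// ltr_pdivlMr//.
    by move=> <-; exact: floor_itv.
  by move=> H; exact: floor_def.
move=> [x y] _ /=; apply: continuous_cvg; first exact: cf.
apply/cvgrPdist_le => e e0; near=> n.
have n0 : 0 < n.+1%:R :> R by [].
rewrite /g; set i := Num.floor _.
have /andP[i1 i2] : i%:~R <= y * n.+1%:R < (i + 1)%:~R by exact: floor_itv.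
have i3 : i%:~R / n.+1%:R <= y by rewrite ler_pdivrMr.
have ie : n.+1%:R^-1 <= e.
  near: n; have := @cvg_harmonic R => /cvgrPdist_le/(_ _ e0).
  by apply: filterS => n; rewrite /= sub0r normrN ger0_norm ?invr_ge0.
rewrite ger0_norm ?subr_ge0//; apply: le_trans ie.
rewrite lerBlDr -[X in X + _]mul1r -mulrDl ler_pdivlMr// ltW//.
by move: i2; rewrite intrD addrC.
Unshelve. all: end_near. Qed.

Lemma integrable_bounded (mu : {measure set T -> \bar R}) (f : T -> R) (B : set T) (C : R) :
  measurable B -> (mu B < +oo)%E -> measurable_fun [set: T] f ->
  (forall x, `|f x| <= C) -> (forall x, ~ B x -> f x = 0) ->
  mu.-integrable [set: T] (EFin \o f).
Proof.
move=> mB Bfin mf fC fB; apply/integrableP; split; first exact/measurable_EFinP.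
apply: (@le_lt_trans _ _ (\int[mu]_(x in B) C%:E)%E); last first.
  rewrite integral_cst//; have : (0 <= mu B)%E by [].
  case: (mu B) Bfin => [r _ r0|//|//].
  by rewrite -EFinM ltry.
rewrite [leRHS]integral_mkcond; apply: ge0_le_integral => //.
- by apply/measurable_EFinP; apply: measurableT_comp.
- by apply/(measurable_restrictT _ _).1 => //; exact: measurable_cst.
move=> x _; rewrite /patch /=; case: ifPn => [_|/negP xB]; first by rewrite lee_fin.
by rewrite fB ?normr0// => Bx; apply: xB; rewrite inE.
Qed.

End Measurability.

(** The plane measure, registered as a sigma-finite measure of its own so that
    Fubini's theorem applies to its product with the measure of the line. *)
Definition leb2 (R : realType) : set (measurableTypeR R * measurableTypeR R)%type -> \bar R :=
  (@lebesgue_measure R \x @lebesgue_measure R)%E.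
HB.instance Definition _ (R : realType) := Measure.on (@leb2 R).

Definition box2 (R : realType) (M : R) : set (measurableTypeR R * measurableTypeR R) :=
  `[-M, M]%classic `*` `[-M, M]%classic.

Lemma measurable_box2 (R : realType) (M : R) : measurable (box2 M).
Proof. by apply: measurableX; exact: measurable_itv. Qed.

Lemma lebesgue_itv_lty (R : realType) (M : R) :
  (@lebesgue_measure R `[(- M)%R, M]%classic < +oo)%E.
Proof. by rewrite lebesgue_measure_itv/=; case: ifP => // _; rewrite -EFinB ltry. Qed.

Lemma leb2_box (R : realType) (M : R) : (leb2 (box2 M) < +oo)%E.
Proof.
rewrite /leb2/= product_measure1E; [|exact: measurable_itv..].
by apply: lte_mul_pinfty => //; rewrite ?ge0_fin_numE// lebesgue_itv_lty.
Qed.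

Lemma leb2_sigma_finite (R : realType) : sigma_finite setT (@leb2 R).
Proof.
exists (fun n : nat => box2 n%:R); last first.
  by move=> n; split; [exact: measurable_box2|exact: leb2_box].
apply/seteqP; split => // -[x y] _.
exists (Num.truncn (`|x| + `|y|)).+1 => //=; rewrite /box2/= !in_itv/= -!ler_norml.
have := truncnS_gt (`|x| + `|y|); set N := _%:R => xyN.
by split; apply: le_trans (ltW xyN); rewrite ?lerDl ?lerDr.
Qed.

HB.instance Definition _ (R : realType) :=
  Measure_isSigmaFinite.Build _ _ _ (@leb2 R) (@leb2_sigma_finite R).

Section Compact_support.
Variable R : realType.
Implicit Types (f g F : space3 R -> R) (k : 'I_3).

Lemma pair_continuous1 (X Y Z : topologicalType) (f : X * Y -> Z) (y : Y) :
  continuous f -> continuous (fun x => f (x, y)).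
Proof.
move=> cf x; apply: (@continuous_comp _ _ _ (fun x => (x, y)) f); last exact: cf.
by apply: cvg_pair; [exact: cvg_id|exact: cvg_cst].
Qed.
Lemma pair_continuous2 (X Y Z : topologicalType) (f : X * Y -> Z) (x : X) :
  continuous f -> continuous (fun y => f (x, y)).
Proof.
move=> cf y; apply: (@continuous_comp _ _ _ (fun y => (x, y)) f); last exact: cf.
by apply: cvg_pair; [exact: cvg_cst|exact: cvg_id].
Qed.

Lemma continuous_measurable2 (f : R * R -> R) : continuous f ->
  measurable_fun [set: measurableTypeR R * measurableTypeR R] f.
Proof.
move=> cf.
have := @caratheodory_measurable _ (measurableTypeR R) R (fun x y => f (x, y)).
rewrite (_ : (fun p => f (p.1, p.2)) = f); last by apply/funext => -[].
apply.
  by move=> y; apply: continuous_measurable_fun; exact: pair_continuous1.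
by move=> x; exact: pair_continuous2.
Qed.

Lemma continuous_measurable3 f : continuous f -> measurable_fun [set: mspace3 R] f.
Proof.
move=> cf.
have := @caratheodory_measurable _ (measurableTypeR R * measurableTypeR R)%type R
  (fun x y => f (x, y)).
rewrite (_ : (fun p => f (p.1, p.2)) = f); last by apply/funext => -[].
apply.
  by move=> y; apply: continuous_measurable2; exact: (pair_continuous1 (f := f)).
by move=> x; exact: (pair_continuous2 (f := f)).
Qed.

Definition bsupp F := exists M : R, forall p, ~ inbox M p -> F p = 0.
Definition Cc F := continuous F /\ bsupp F.
Definition Ccs F := smooth F /\ bsupp F.

Definition box (M : R) : set (mspace3 R) := box2 M `*` `[-M, M]%classic.

Lemma boxP M p : box M p <-> inbox M p.
Proof.
case: p => -[x y] z; rewrite /box /box2 /inbox /= !in_itv /= -!ler_norml.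
by split=> [[[? ?] ?]|[? ? ?]].
Qed.

Lemma measurable_box M : measurable (box M).
Proof. by apply: measurableX; [exact: measurable_box2|exact: measurable_itv]. Qed.

Lemma leb3_box M : (leb3 R (box M) < +oo)%E.
Proof.
rewrite /leb3/= product_measure1E; [|exact: measurable_box2|exact: measurable_itv].
apply: lte_mul_pinfty => //; rewrite ?ge0_fin_numE//; first exact: leb2_box.
exact: lebesgue_itv_lty.
Qed.

Lemma bounded_intble F M C : measurable_fun [set: mspace3 R] F ->
  (forall p, `|F p| <= C) -> (forall p, ~ inbox M p -> F p = 0) -> intble F.
Proof.
move=> mF FC FM; apply: (@integrable_bounded _ _ _ _ _ (box M) C) => //.
- exact: measurable_box.
- exact: leb3_box.
- by move=> p pM; apply: FM => /boxP.
Qed.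

Lemma Cc_bounded F : Cc F -> exists C : R, forall p, `|F p| <= C.
Proof.
move=> [cF [M FM]]; have [C HC] := continuous_lbnd cF M.
exists (Num.max C 0) => p; rewrite le_max; have [ip|ip] := pselect (inbox M p).
  by rewrite HC.
by rewrite FM// normr0 lexx orbT.
Qed.

Lemma Cc_intble F : Cc F -> intble F.
Proof.
move=> cF; have [C HC] := Cc_bounded cF; have [cont [M FM]] := cF.
by apply: (@bounded_intble _ M C) => //; exact: continuous_measurable3.
Qed.

Lemma Ccs_Cc F : Ccs F -> Cc F.
Proof. by move=> [/smooth_continuous cF sF]. Qed.
Lemma Ccs_intble F : Ccs F -> intble F.
Proof. by move=> /Ccs_Cc/Cc_intble. Qed.

Lemma bsupp0 : bsupp (fun=> 0).
Proof. by exists 0. Qed.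
Lemma bsuppD f g : bsupp f -> bsupp g -> bsupp (fun p => f p + g p).
Proof.
move=> [M fM] [N gN]; exists (Num.max M N) => p H; rewrite fM ?gN ?addr0//.
  by move=> i; apply: H; apply: inbox_le i; rewrite le_max lexx orbT.
by move=> i; apply: H; apply: inbox_le i; rewrite le_max lexx.
Qed.
Lemma bsuppMl f g : bsupp g -> bsupp (fun p => f p * g p).
Proof. by move=> [M gM]; exists M => p /gM ->; rewrite mulr0. Qed.

Lemma CcsD f g : Ccs f -> Ccs g -> Ccs (fun p => f p + g p).
Proof. by move=> [sf bf] [sg bg]; split; [exact: smoothD|exact: bsuppD]. Qed.
Lemma CcsMl f g : smooth f -> Ccs g -> Ccs (fun p => f p * g p).
Proof. by move=> sf [sg bg]; split; [exact: smoothM|exact: bsuppMl]. Qed.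
Lemma CcsZ f c : Ccs f -> Ccs (fun p => c * f p).
Proof. by move=> sf; apply: (CcsMl (f := fun=> c)) => //; exact: smooth_cst. Qed.
Lemma CcsN f : Ccs f -> Ccs (fun p => - f p).
Proof. by move=> sf; under eq_fun do rewrite -mulN1r; exact: CcsZ. Qed.
Lemma CcsB f g : Ccs f -> Ccs g -> Ccs (fun p => f p - g p).
Proof. by move=> sf sg; apply: CcsD => //; exact: CcsN. Qed.
Lemma Ccs0 : Ccs (fun=> 0).
Proof. by split; [exact: smooth_cst|exact: bsupp0]. Qed.

Lemma hausdorff3 : hausdorff_space (space3 R).
Proof. exact: (@norm_hausdorff R (R * R * R)%type). Qed.

Lemma closed_inbox M : closed [set p : space3 R | inbox M p].
Proof. by apply: compact_closed; [exact: hausdorff3|exact: compact_inbox]. Qed.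

(** Off the closed box a function that vanishes there is locally constant. *)
Lemma pd_support F k M : (forall p, ~ inbox M p -> F p = 0) ->
  forall p, ~ inbox M p -> pd k F p = 0.
Proof.
move=> FM p pM; rewrite /pd (@near_eq_derive _ _ _ F (fun=> 0)) ?derive_cst//.
have /open_nbhs_nbhs : open_nbhs p (~` [set p : space3 R | inbox M p]).
  by split => //; apply: closed_openC; exact: closed_inbox.
by apply: filterS => q; exact: FM.
Qed.

Lemma Ccs_pd F k : Ccs F -> Ccs (pd k F).
Proof.
move=> [sF [M FM]]; split; first exact: smooth_pd.
by exists M; exact: pd_support.
Qed.

Lemma integral_derive_eq0 (G g : R -> R) (M : R) :
  (forall x : R, is_derive x 1 G (g x)) -> continuous g ->
  (forall x, M < `|x| -> G x = 0) -> (forall x, M < `|x| -> g x = 0) ->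
  (\int[@lebesgue_measure R]_x (g x)%:E = 0)%E.
Proof.
move=> dG cg G0 g0.
pose N : R := `|M| + 1.
have MN : M < N by rewrite /N (le_lt_trans (ler_norm M))// ltrDl.
have N0 : 0 < N by rewrite /N ltr_wpDl.
have cG : continuous G by apply: derivable_continuous1 => x; have [] := dG x.
transitivity (\int[@lebesgue_measure R]_(x in `[(- N)%R, N]) (g x)%:E)%E.
  rewrite [RHS]integral_mkcond; apply: eq_integral => x _.
  rewrite /patch; case: ifPn => // /negP xN; rewrite g0//.
  rewrite ltNge; apply/negP => xM; apply: xN; rewrite inE/= in_itv/= -ler_norml.
  by apply: le_trans xM _; exact: ltW.
rewrite (@continuous_FTC2 R g G).
- by rewrite !G0 ?subee// ?normrN ger0_norm// ltW.
- by apply: (@lt_trans _ _ 0); rewrite ?oppr_lt0.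
- exact: continuous_subspaceT.
- split.
  + by move=> x _; have [] := dG x.
  + by apply: cvg_at_right_filter; exact: cG.
  + by apply: cvg_at_left_filter; exact: cG.
- by move=> x _; rewrite derive1E; have [] := dG x.
Qed.

Lemma leb3_fubini F : intble F ->
  (\int[leb3 R]_p (F p)%:E = \int[@leb2 R]_q \int[@lebesgue_measure R]_z (F (q, z))%:E)%E.
Proof.
by move=> jF; rewrite -(@integral12_prod_meas1 _ _ _ _ R (@leb2 R) (@lebesgue_measure R) _ jF).
Qed.
Lemma leb3_fubini2 F : intble F ->
  (\int[leb3 R]_p (F p)%:E = \int[@lebesgue_measure R]_z \int[@leb2 R]_q (F (q, z))%:E)%E.
Proof.
by move=> jF; rewrite -(@integral21_prod_meas1 _ _ _ _ R (@leb2 R) (@lebesgue_measure R) _ jF).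
Qed.

(** A derivative along a coordinate integrates to zero along each line in that
    direction. *)
Lemma rint_pd F k : Ccs F -> rint (pd k F) = 0.
Proof.
move=> cF; have [sF [M FM]] := cF; have cpF := Ccs_pd k cF.
have [spF _] := cpF; have FpM := pd_support k FM.
have jF := Ccs_intble cpF; have dF := smooth_pdable sF.
have cc := smooth_continuous spF.
rewrite /rint /Rintegral.
case: (ord3P k) => kE; rewrite kE in FpM jF cc *; last first.
  rewrite leb3_fubini// integral0_eq// => -[x y] _ /=.
  apply: (@integral_derive_eq0 (fun z => F (x, y, z)) _ M).
  - by move=> z; exact: is_derive2.
  - exact: (pair_continuous2 (f := pd k2 F)).
  - by move=> z zM; apply: FM => -[/= _ _]; rewrite leNgt zM.
  - by move=> z zM; apply: FpM => -[/= _ _]; rewrite leNgt zM.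
all: rewrite leb3_fubini2// integral0_eq// => z _.
all: have [C HC] := Cc_bounded (Ccs_Cc cpF); rewrite kE in HC.
all: have j2 : (@leb2 R).-integrable setT (EFin \o (fun q => pd k F (q, z))) by
  apply: (@integrable_bounded _ _ _ _ _ (box2 M) C) => [|||//|];
  [exact: measurable_box2|exact: leb2_box|
   rewrite kE; apply: continuous_measurable2; exact: (pair_continuous1 (f := pd _ F))|
   move=> q; rewrite kE; exact: HC|
   move=> q qM; rewrite kE; apply: FpM => -[/= b1 b2 _]; apply: qM; rewrite /box2/= !in_itv/= -!ler_norml].
all: rewrite kE in j2.
- rewrite -(@integral12_prod_meas1 _ _ _ _ R (@lebesgue_measure R) (@lebesgue_measure R) _ j2).
  rewrite integral0_eq// => x _ /=.
  apply: (@integral_derive_eq0 (fun y => F (x, y, z)) _ M).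
  + by move=> y; exact: is_derive1.
  + by apply: (pair_continuous2 (f := fun q => pd k1 F (q, z))); exact: (pair_continuous1 (f := pd k1 F)).
  + by move=> y yM; apply: FM => -[/= _]; rewrite leNgt yM.
  + by move=> y yM; apply: FpM => -[/= _]; rewrite leNgt yM.
rewrite -(@integral21_prod_meas1 _ _ _ _ R (@lebesgue_measure R) (@lebesgue_measure R) _ j2).
rewrite integral0_eq// => y _ /=.
apply: (@integral_derive_eq0 (fun x => F (x, y, z)) _ M).
- by move=> x; exact: is_derive0.
- by apply: (pair_continuous1 (f := fun q => pd k0 F (q, z))); exact: (pair_continuous1 (f := pd k0 F)).
- by move=> x xM; apply: FM => -[/=]; rewrite leNgt xM.
- by move=> x xM; apply: FpM => -[/=]; rewrite leNgt xM.
Qed.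

(** The support of a test function is replaced by a coordinate box, which avoids
    closures and compactness in all that follows. *)
Lemma test_funP (u : cfun3 R) : test_fun u <->
  Ccs (fun p => complex.Re (u p)) /\ Ccs (fun p => complex.Im (u p)).
Proof.
split.
  move=> [s1 s2 cu].
  have [M HM] : exists M : R, forall p, ~ inbox M p -> u p = 0.
    move: cu => /(@compact_bounded R (R * R * R)%type)[M [_ HM]]; exists (M + 1) => p ip.
    apply/eqP; rewrite -[_ == _]negbK; apply/negP => up; apply: ip.
    have : `|p| <= M + 1 by apply: HM; [rewrite ltrDl|apply: subset_closure].
    by rewrite !prod_normE /= !ge_max => /andP[/andP[? ?] ?].
  by split; split => //; exists M => p /HM ->.
move=> [[s1 [M1 H1]] [s2 [M2 H2]]]; split => //.
apply: (@subclosed_compact _ _ [set p | inbox (Num.max M1 M2) p]).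
- exact: closed_closure.
- exact: compact_inbox.
have /closure_id -> := @closed_inbox (Num.max M1 M2).
apply: closure_subset => p /=; apply: contra_neqP => pM.
apply: (@complex_ext R (u p) 0); [apply: H1|apply: H2] => i; apply: pM; apply: inbox_le i.
  by rewrite le_max lexx.
by rewrite le_max lexx orbT.
Qed.

End Compact_support.

(** * Left-invariant fields and the magnetic operator *)

Section Schwarz.
Variable R : realType.

Lemma mean_value (g dg : R -> R) (a h : R) : 0 < h ->
  (forall x : R, is_derive x 1 g (dg x)) ->
  exists2 c, `|a - c| <= h & g (a + h) - g a = dg c * h.
Proof.
move=> h0 dgP.
have cg : continuous g by apply: derivable_continuous1 => x; have [] := dgP x.
have ah : a <= a + h by rewrite lerDl ltW.
have [c] := @MVT_segment R g dg a (a + h) ah (fun x _ => dgP x) (continuous_subspaceT cg).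
rewrite in_itv/= => /andP[c1 c2] ->; exists c; last by congr (_ * _); ring.
by rewrite ler_norml; apply/andP; split; lra.
Qed.

(** Both mixed derivatives are values at nearby points of the same second
    difference quotient. *)
Lemma schwarz2 (g gx gt gxt gtx : R -> R -> R) (x0 t0 : R) :
  (forall x t : R, is_derive x 1 (g ^~ t) (gx x t)) ->
  (forall x t : R, is_derive t 1 (g x) (gt x t)) ->
  (forall x t : R, is_derive t 1 (gx x) (gxt x t)) ->
  (forall x t : R, is_derive x 1 (gt ^~ t) (gtx x t)) ->
  (forall e : R, 0 < e -> exists2 r : R, 0 < r & forall x t, `|x0 - x| <= r -> `|t0 - t| <= r ->
     `|gxt x0 t0 - gxt x t| <= e) ->
  (forall e : R, 0 < e -> exists2 r : R, 0 < r & forall x t, `|x0 - x| <= r -> `|t0 - t| <= r ->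
     `|gtx x0 t0 - gtx x t| <= e) ->
  gxt x0 t0 = gtx x0 t0.
Proof.
move=> d1 d2 d3 d4 c1 c2.
apply/eqP; rewrite -subr_eq0 -normr_le0; apply/ler_addgt0Pl => e e0; rewrite addr0.
have e2 : 0 < e / 2 by rewrite divr_gt0.
have [r1 r10 H1] := c1 _ e2; have [r2 r20 H2] := c2 _ e2.
pose h := Num.min r1 r2.
have h0 : 0 < h by rewrite lt_min r10.
have hr1 : h <= r1 by rewrite ge_min lexx.
have hr2 : h <= r2 by rewrite ge_min lexx orbT.
have [x xh Ex] := @mean_value (fun x => g x (t0 + h) - g x t0)
  (fun x => gx x (t0 + h) - gx x t0) x0 h h0 (fun x => is_deriveB (d1 _ _) (d1 _ _)).
have [t th Et] := @mean_value (gx x) (gxt x) t0 h h0 (d3 x).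
have [t' th' Et'] := @mean_value (fun t => g (x0 + h) t - g x0 t)
  (fun t => gt (x0 + h) t - gt x0 t) t0 h h0 (fun t => is_deriveB (d2 _ _) (d2 _ _)).
have [x' xh' Ex'] := @mean_value (gt ^~ t') (gtx ^~ t') x0 h h0 (fun x => d4 x t').
have E : gxt x t = gtx x' t'.
  have hn : h != 0 by rewrite gt_eqF.
  apply: (mulIf hn); apply: (mulIf hn); rewrite -Et -Ex -Ex' -Et'; ring.
have A := H1 x t (le_trans xh hr1) (le_trans th hr1).
have B := H2 x' t' (le_trans xh' hr2) (le_trans th' hr2).
rewrite (_ : _ - _ = (gxt x0 t0 - gxt x t) - (gtx x0 t0 - gtx x' t')); last by rewrite E; ring.
by apply: le_trans (ler_normB _ _) _; lra.
Qed.

Lemma continuous_delta (f : space3 R -> R) (x0 y0 z0 : R) : continuous f ->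
  forall e : R, 0 < e -> exists2 r : R, 0 < r & forall x y z,
   `|x0 - x| <= r -> `|y0 - y| <= r -> `|z0 - z| <= r ->
     `|f (x0, y0, z0) - f (x, y, z)| <= e.
Proof.
move=> cf e e0.
have /cvgrPdist_le/(_ e e0) := cf (x0, y0, z0).
move=> [[A B] /= [[[C D] /= [/nbhs_ballP[c c0 Cc] /nbhs_ballP[d d0 Dd]] CDA] /nbhs_ballP[b b0 Bb]] AB].
pose r := Num.min (Num.min c d) b / 2.
have m0 : 0 < Num.min (Num.min c d) b by rewrite !lt_min c0 d0 b0.
have rm : r < Num.min (Num.min c d) b by rewrite /r; lra.
move: (rm); rewrite !lt_min => /andP[/andP[rc rd] rb].
exists r; first by rewrite divr_gt0.
move=> x y z hx hy hz; apply: (AB ((x, y), z)); split => /=.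
  apply: (CDA (x, y)); split => /=; [apply: Cc|apply: Dd]; rewrite /ball/=.
    exact: le_lt_trans rc.
  exact: le_lt_trans rd.
by apply: Bb; rewrite /ball/=; exact: le_lt_trans rb.
Qed.

Lemma pd02 (f : space3 R -> R) : smooth f -> pd k2 (pd k0 f) = pd k0 (pd k2 f).
Proof.
move=> sf; apply/funext => -[[x y] z].
have df := smooth_pdable sf.
have d0 := smooth_pdable (smooth_pd k0 sf); have d2 := smooth_pdable (smooth_pd k2 sf).
have c1 := continuous_delta x y z (smooth_continuous (smooth_pd k2 (smooth_pd k0 sf))).
have c2 := continuous_delta x y z (smooth_continuous (smooth_pd k0 (smooth_pd k2 sf))).
apply: (@schwarz2 (fun x z => f (x, y, z)) (fun x z => pd k0 f (x, y, z))
  (fun x z => pd k2 f (x, y, z)) (fun x z => pd k2 (pd k0 f) (x, y, z))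
  (fun x z => pd k0 (pd k2 f) (x, y, z))).
- by move=> *; exact: is_derive0.
- by move=> *; exact: is_derive2.
- by move=> *; exact: is_derive2.
- by move=> *; exact: is_derive0.
- move=> e e0; have [r r0 H] := c1 e e0; exists r => // a b ar br.
  by apply: H => //; rewrite subrr normr0 ltW.
- move=> e e0; have [r r0 H] := c2 e e0; exists r => // a b ar br.
  by apply: H => //; rewrite subrr normr0 ltW.
Qed.

Lemma pd12 (f : space3 R -> R) : smooth f -> pd k2 (pd k1 f) = pd k1 (pd k2 f).
Proof.
move=> sf; apply/funext => -[[x y] z].
have df := smooth_pdable sf.
have d0 := smooth_pdable (smooth_pd k1 sf); have d2 := smooth_pdable (smooth_pd k2 sf).
have c1 := continuous_delta x y z (smooth_continuous (smooth_pd k2 (smooth_pd k1 sf))).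
have c2 := continuous_delta x y z (smooth_continuous (smooth_pd k1 (smooth_pd k2 sf))).
apply: (@schwarz2 (fun y z => f (x, y, z)) (fun y z => pd k1 f (x, y, z))
  (fun y z => pd k2 f (x, y, z)) (fun y z => pd k2 (pd k1 f) (x, y, z))
  (fun y z => pd k1 (pd k2 f) (x, y, z))).
- by move=> *; exact: is_derive1.
- by move=> *; exact: is_derive2.
- by move=> *; exact: is_derive2.
- by move=> *; exact: is_derive1.
- move=> e e0; have [r r0 H] := c1 e e0; exists r => // a b ar br.
  by apply: H => //; rewrite subrr normr0 ltW.
- move=> e e0; have [r r0 H] := c2 e e0; exists r => // a b ar br.
  by apply: H => //; rewrite subrr normr0 ltW.
Qed.

End Schwarz.

Opaque smooth.

Section Fields.
Variable R : realType.
Implicit Types (f g : space3 R -> R) (j : 'I_3) (u v w : cfun3 R).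

(** The fields [e^z d/dx], [e^-z d/dy] and [d/dz] are the left-invariant fields of
    Sol; [cX] gives their coefficients. *)
Definition cX j (p : space3 R) : R := nth 0 [:: expR p.2; expR (- p.2); 1] j.
Definition X j f : space3 R -> R := fun p => cX j p * pd j f p.

Lemma smooth_cX j : smooth (cX j).
Proof.
case: (ord3P j) => ->; rewrite /cX /=.
- exact: (sm1_comp (sm1_expR R) (@smooth_crd R k2)).
- by apply: (sm1_comp (sm1_expR R)); apply: smoothN; exact: (@smooth_crd R k2).
- exact: smooth_cst.
Qed.

Lemma pd_cX j : pd j (cX j) = fun=> 0.
Proof.
have dE := fun x : R => @derivable_expR R x.
case: (ord3P j) => ->; rewrite /cX /=; last exact: pd_cst.
  by rewrite (pd_snd _ dE); apply/funext => p; rewrite mulr0.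
have dN : pdable (fun p : space3 R => - p.2) by apply: smooth_pdable; apply: smoothN; exact: (@smooth_crd R k2).
rewrite (pd_comp _ dE dN); apply/funext => p.
rewrite (pdN _ (smooth_pdable (@smooth_crd R k2))) (@pd_crd R k2).
by rewrite /= oppr0 mulr0.
Qed.

Lemma smooth_X j f : smooth f -> smooth (X j f).
Proof. by move=> sf; apply: smoothM; [exact: smooth_cX|exact: smooth_pd]. Qed.
Lemma Ccs_X j f : Ccs f -> Ccs (X j f).
Proof. by move=> sf; apply: CcsMl; [exact: smooth_cX|exact: Ccs_pd]. Qed.

Lemma XD j f g : smooth f -> smooth g -> X j (fun p => f p + g p) = fun p => X j f p + X j g p.
Proof.
move=> sf sg; apply/funext => p; rewrite /X pdD; [|exact: smooth_pdable..].
by rewrite mulrDr.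
Qed.
Lemma XB j f g : smooth f -> smooth g -> X j (fun p => f p - g p) = fun p => X j f p - X j g p.
Proof.
move=> sf sg; apply/funext => p; rewrite /X pdB; [|exact: smooth_pdable..].
by rewrite mulrBr.
Qed.
Lemma XM j f g : smooth f -> smooth g ->
  X j (fun p => f p * g p) = fun p => X j f p * g p + f p * X j g p.
Proof.
move=> sf sg; apply/funext => p; rewrite /X pdM; [|exact: smooth_pdable..].
by ring.
Qed.
Lemma XZ j f c : smooth f -> X j (fun p => c * f p) = fun p => c * X j f p.
Proof.
move=> sf; apply/funext => p; rewrite /X pdZ; last exact: smooth_pdable.
by ring.
Qed.
Lemma XN j f : smooth f -> X j (fun p => - f p) = fun p => - X j f p.
Proof.
move=> sf; apply/funext => p; rewrite /X pdN; last exact: smooth_pdable.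
by rewrite mulrN.
Qed.

(** Each coefficient is constant along its own direction, so that the fields are
    divergence free and integrals of derivatives vanish. *)
Lemma rint_X j f : Ccs f -> rint (X j f) = 0.
Proof.
move=> cf; have [sf _] := cf; have sc := smooth_cX j.
rewrite -(rint_pd j (CcsMl sc cf)); congr rint; apply/funext => p.
by rewrite pdM ?pd_cX ?mul0r ?add0r//; exact: smooth_pdable.
Qed.

(** The structure relations [[Z, X0] = X0] and [[Z, X1] = - X1] of the Lie algebra;
    the derivative of the exponential factor produces the commutator. *)
Lemma XzX0 f : smooth f -> X k2 (X k0 f) = fun p => X k0 f p + X k0 (X k2 f) p.
Proof.
move=> sf; apply/funext => p.
have E : X k2 f = pd k2 f by apply/funext => q; rewrite /X /cX /= mul1r.
rewrite E [LHS]/X [cX k2 p]/cX /= mul1r /X pdM; last 2 first.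
- exact: smooth_pdable (smooth_cX k0).
- by apply: smooth_pdable; exact: smooth_pd.
rewrite pd02//; congr (_ * _ + _).
rewrite /cX /= (pd_snd _ (fun x : R => @derivable_expR R x)) eqxx mulr1.
by have [_] := is_derive_expR p.2.
Qed.

Lemma XzX1 f : smooth f -> X k2 (X k1 f) = fun p => - X k1 f p + X k1 (X k2 f) p.
Proof.
move=> sf; apply/funext => p.
have E : X k2 f = pd k2 f by apply/funext => q; rewrite /X /cX /= mul1r.
rewrite E [LHS]/X [cX k2 p]/cX /= mul1r /X pdM; last 2 first.
- exact: smooth_pdable (smooth_cX k1).
- by apply: smooth_pdable; exact: smooth_pd.
rewrite pd12// -mulNr; congr (_ * _ + _).
have sN : smooth (fun p : space3 R => - p.2) by apply: smoothN; exact: (@smooth_crd R k2).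
rewrite /cX /= (pd_comp _ (fun x : R => @derivable_expR R x) (smooth_pdable sN)).
rewrite (pdN _ (smooth_pdable (@smooth_crd R k2))) (@pd_crd R k2) eqxx mulrN mulr1.
by congr (- _); have [_] := is_derive_expR (- p.2).
Qed.

Opaque X pd.

Definition Tf u := Ccs (fun p => complex.Re (u p)) /\ Ccs (fun p => complex.Im (u p)).
Definition smC u := smooth (fun p => complex.Re (u p)) /\ smooth (fun p => complex.Im (u p)).

(** The magnetic momentum [-i X_j + B], in real and imaginary parts. *)
Definition P j (B : R) u : cfun3 R := fun p =>
  (X j (fun q => complex.Im (u q)) p + B * complex.Re (u p)) +i*
  (- X j (fun q => complex.Re (u q)) p + B * complex.Im (u p)).

Lemma invi : 'i^-1 = (0 : R) +i* (-1).
Proof.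
apply: (@mulfI _ ('i : R[i])); first by rewrite eq_complex /= oner_eq0 andbF.
rewrite divff; last by rewrite eq_complex /= oner_eq0 andbF.
by apply: complex_ext => /=; ring.
Qed.

Lemma XE j f p : X j f p = cX j p * 'D_(axis R j) f p.
Proof. by []. Qed.

Lemma Px_P (B : R) u : Px B u = P k0 B u.
Proof.
apply/funext => p; apply: complex_ext;
 rewrite /Px /Dop invi ?(cReD, cImD, cReM, cImM) /= XE /cX /axis /=; ring.
Qed.
Lemma Py_P (B : R) u : Py B u = P k1 B u.
Proof.
apply/funext => p; apply: complex_ext;
 rewrite /Py /Dop invi ?(cReD, cImD, cReM, cImM) /= XE /cX /axis /=; ring.
Qed.
Lemma Dz_P u : Dop (ez R) u = P k2 0 u.
Proof.
apply/funext => p; apply: complex_ext;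
 rewrite /Dop invi ?(cReD, cImD, cReM, cImM) /= XE /cX /axis /=; ring.
Qed.

Lemma H_SolE (Bx By : R) u p : H_Sol Bx By u p =
  2^-1 * (P k0 Bx (P k0 Bx u) p + P k1 By (P k1 By u) p + P k2 0 (P k2 0 u) p).
Proof. by rewrite /H_Sol !Px_P !Py_P !Dz_P. Qed.

Lemma Tf_smC u : Tf u -> smC u.
Proof. by move=> [[? _] [? _]]. Qed.

Lemma smC_P j B u : smC u -> smC (P j B u).
Proof.
move=> [s1 s2]; split => /=.
  by apply: smoothD; [exact: smooth_X|exact: smoothZ].
by apply: smoothD; [apply: smoothN; exact: smooth_X|exact: smoothZ].
Qed.
Lemma Tf_P j B u : Tf u -> Tf (P j B u).
Proof.
move=> [s1 s2]; split => /=.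
  by apply: CcsD; [exact: Ccs_X|exact: CcsZ].
by apply: CcsD; [apply: CcsN; exact: Ccs_X|exact: CcsZ].
Qed.
Lemma TfD u v : Tf u -> Tf v -> Tf (fun p => u p + v p).
Proof.
move=> [u1 u2] [v1 v2]; split.
  by under eq_fun do rewrite cReD; exact: CcsD.
by under eq_fun do rewrite cImD; exact: CcsD.
Qed.
Lemma TfZ u (c : R[i]) : Tf u -> Tf (fun p => c * u p).
Proof.
move=> [u1 u2]; split.
  by under eq_fun do rewrite cReM; apply: CcsB; exact: CcsZ.
by under eq_fun do rewrite cImM; apply: CcsD; exact: CcsZ.
Qed.
Lemma TfB u v : Tf u -> Tf v -> Tf (fun p => u p - v p).
Proof.
move=> [u1 u2] [v1 v2]; split.
  by under eq_fun do rewrite cReB; exact: CcsB.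
by under eq_fun do rewrite cImB; exact: CcsB.
Qed.
Lemma Tf_H (Bx By : R) u : Tf u -> Tf (H_Sol Bx By u).
Proof.
move=> tu; rewrite (funext (H_SolE Bx By u)).
apply: (TfZ (u := fun p => P k0 Bx (P k0 Bx u) p + P k1 By (P k1 By u) p + P k2 0 (P k2 0 u) p)).
apply: (TfD (u := fun p => P k0 Bx (P k0 Bx u) p + P k1 By (P k1 By u) p)).
  by apply: TfD; do 2!apply: Tf_P.
by do 2!apply: Tf_P.
Qed.

Lemma Tf_cmeasurable u : Tf u -> cmeasurable u.
Proof.
by move=> [u1 u2]; split; apply: continuous_measurable3; apply: smooth_continuous;
  [case: u1|case: u2].
Qed.
Lemma smC_cmeasurable u : smC u -> cmeasurable u.
Proof. by move=> [u1 u2]; split; apply: continuous_measurable3; exact: smooth_continuous. Qed.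

Lemma Ccs_redot u v : Tf u -> smC v -> Ccs (redot u v).
Proof.
move=> [u1 u2] [v1 v2]; rewrite /redot; apply: CcsD.
  by under eq_fun do rewrite mulrC; exact: CcsMl.
by under eq_fun do rewrite mulrC; exact: CcsMl.
Qed.

Lemma Tf_L2 u : Tf u -> L2 u.
Proof.
move=> tu; apply/L2P; split; first exact: Tf_cmeasurable.
exact: Ccs_intble (Ccs_redot tu (Tf_smC tu)).
Qed.

(** Multiplication by the imaginary unit; since [rip] is only the real part of the
    Hermitian product, the imaginary part is obtained by pairing with [mulI]. *)
Definition mulI u : cfun3 R := fun p => (- complex.Im (u p)) +i* complex.Re (u p).

(** Integration by parts: the difference of the two sides is the integral of
    [X_j] applied to a compactly supported function. *)
Lemma P_sym j B w v : Tf w -> smC v -> rip (P j B w) v = rip w (P j B v).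
Proof.
move=> tw sv; apply/eqP; rewrite -subr_eq0 /rip -!/(rint _) -rintB; last 2 first.
- exact: (Ccs_intble (Ccs_redot (Tf_P j B tw) sv)).
- exact: (Ccs_intble (Ccs_redot tw (smC_P j B sv))).
have [v1 v2] := sv; have [c1 c2] := tw.
pose F p := complex.Re (v p) * complex.Im (w p) - complex.Im (v p) * complex.Re (w p).
have cF : Ccs F by apply: CcsB; apply: CcsMl.
apply/eqP; rewrite -(rint_X j cF); congr rint; apply/funext => p.
have [[s1 _] [s2 _]] := tw.
rewrite /F XB; [|exact: smoothM..]; rewrite !XM// /redot /=; ring.
Qed.

Definition cut (chi : space3 R -> R) u : cfun3 R := fun p => (chi p)%:C * u p.

Lemma Re_cut chi u : (fun p => complex.Re (cut chi u p)) = fun p => chi p * complex.Re (u p).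
Proof. by apply/funext => p; rewrite /cut cReM /=; ring. Qed.
Lemma Im_cut chi u : (fun p => complex.Im (cut chi u p)) = fun p => chi p * complex.Im (u p).
Proof. by apply/funext => p; rewrite /cut cImM /=; ring. Qed.

Lemma smC_cut chi u : smooth chi -> smC u -> smC (cut chi u).
Proof. by move=> sc [u1 u2]; split; rewrite ?Re_cut ?Im_cut; exact: smoothM. Qed.
Lemma Tf_cut chi u : smooth chi -> Tf u -> Tf (cut chi u).
Proof. by move=> sc [u1 u2]; split; rewrite ?Re_cut ?Im_cut; exact: CcsMl. Qed.

Lemma Re_cutE chi u p : complex.Re (cut chi u p) = chi p * complex.Re (u p).
Proof. by rewrite /cut cReM /=; ring. Qed.
Lemma Im_cutE chi u p : complex.Im (cut chi u p) = chi p * complex.Im (u p).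
Proof. by rewrite /cut cImM /=; ring. Qed.

Lemma XRe_cut j chi u p : smooth chi -> smC u ->
  X j (fun q => complex.Re (cut chi u q)) p =
  X j chi p * complex.Re (u p) + chi p * X j (fun q => complex.Re (u q)) p.
Proof. by move=> sc [u1 u2]; rewrite Re_cut (XM j sc u1). Qed.
Lemma XIm_cut j chi u p : smooth chi -> smC u ->
  X j (fun q => complex.Im (cut chi u q)) p =
  X j chi p * complex.Im (u p) + chi p * X j (fun q => complex.Im (u q)) p.
Proof. by move=> sc [u1 u2]; rewrite Im_cut (XM j sc u2). Qed.

(** Localization: the commutator of a momentum with the cutoff is a
    multiplication operator, whose contribution to the real part of the form
    has no first-order term. *)
Lemma redot_cut j B chi v p : smooth chi -> smC v ->
  redot (P j B (cut chi (cut chi v))) (P j B v) p =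
  sqmod (P j B (cut chi v)) p - sqmod (cut (X j chi) v) p.
Proof.
move=> sc sv; have scv := smC_cut sc sv.
rewrite /sqmod /redot /= (XRe_cut _ _ sc scv) (XIm_cut _ _ sc scv).
rewrite (XRe_cut _ _ sc sv) (XIm_cut _ _ sc sv) !Re_cutE !Im_cutE; ring.
Qed.

Lemma redot_mulI_cut j B chi v p : smooth chi -> smC v ->
  redot (P j B (cut chi (cut chi v))) (mulI (P j B v)) p =
  - 2 * redot (P j B (cut chi v)) (cut (X j chi) v) p.
Proof.
move=> sc sv; have scv := smC_cut sc sv.
rewrite /redot /= (XRe_cut _ _ sc scv) (XIm_cut _ _ sc scv).
rewrite (XRe_cut _ _ sc sv) (XIm_cut _ _ sc sv) !Re_cutE !Im_cutE; ring.
Qed.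

Lemma Tf_cut_X j chi v : smooth chi -> smC v -> Tf (cut chi v) -> bsupp chi -> Tf (cut (X j chi) v).
Proof.
move=> sc [v1 v2] tw bc; have cX : Ccs (X j chi) by exact: Ccs_X.
split; rewrite ?Re_cut ?Im_cut; under eq_fun do rewrite mulrC; exact: CcsMl.
Qed.

Lemma Tf_mulI u : Tf u -> Tf (mulI u).
Proof. by move=> [u1 u2]; split => /=; [exact: CcsN|exact: u1]. Qed.
Lemma smC_mulI u : smC u -> smC (mulI u).
Proof. by move=> [u1 u2]; split => /=; [exact: smoothN|exact: u1]. Qed.

Lemma XRe_mulI j u : smC u ->
  X j (fun q => complex.Re (mulI u q)) = fun p => - X j (fun q => complex.Im (u q)) p.
Proof. by move=> [u1 u2]; rewrite /mulI /= (XN j u2). Qed.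

Lemma P_mulI j B u : smC u -> P j B (mulI u) = mulI (P j B u).
Proof.
move=> su; apply/funext => p; apply: complex_ext => /=; last by rewrite (XRe_mulI j su); ring.
ring.
Qed.

Lemma rip_sym u v : rip u v = rip v u.
Proof. by rewrite /rip; congr Rintegral; apply/funext => p; rewrite /redot; ring. Qed.

Lemma rintN f : intble f -> rint (fun p => - f p) = - rint f.
Proof. by move=> jf; under eq_fun do rewrite -mulN1r; rewrite rintZ// mulN1r. Qed.

Section Cutoff_energy.
Variables (B : 'I_3 -> R) (chi : space3 R -> R) (v : cfun3 R).
Hypotheses (cchi : Ccs chi) (sv : smC v).

Let sc : smooth chi. Proof. by case: cchi. Qed.
Let tw : Tf (cut chi v).
Proof.
have [v1 v2] := sv.
by split; rewrite ?Re_cut ?Im_cut; under eq_fun do rewrite mulrC; exact: CcsMl.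
Qed.
Let te j : Tf (cut (X j chi) v).
Proof. by apply: (Tf_cut_X j sc sv tw); case: cchi. Qed.

Lemma cut_form_re j : rip (P j (B j) (P j (B j) (cut chi (cut chi v)))) v =
  sqnorm (P j (B j) (cut chi v)) - sqnorm (cut (X j chi) v).
Proof.
have tcw := Tf_cut sc tw.
rewrite (P_sym j (B j) (Tf_P j (B j) tcw) sv) /rip (funext (fun p => redot_cut j (B j) p sc sv)).
by apply: rintB; apply: intble_sqmod; apply: Tf_L2; [exact: Tf_P|exact: te].
Qed.

Lemma cut_form_im j : rip (P j (B j) (P j (B j) (cut chi (cut chi v)))) (mulI v) =
  - 2 * rip (P j (B j) (cut chi v)) (cut (X j chi) v).
Proof.
have tcw := Tf_cut sc tw.
rewrite (P_sym j (B j) (Tf_P j (B j) tcw) (smC_mulI sv)) (P_mulI j (B j) sv) /rip.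
rewrite (_ : redot _ _ = fun p => - 2 * redot (P j (B j) (cut chi v)) (cut (X j chi) v) p); last first.
  by apply/funext => p; exact: redot_mulI_cut.
apply: rintZ; apply: intble_redot; apply: Tf_L2; [exact: Tf_P|exact: te].
Qed.

End Cutoff_energy.

Definition Zd u : cfun3 R := fun p =>
  X k2 (fun q => complex.Re (u q)) p +i* X k2 (fun q => complex.Im (u q)) p.

Lemma Tf_Zd u : Tf u -> Tf (Zd u).
Proof. by move=> [u1 u2]; split => /=; exact: Ccs_X. Qed.

Lemma sqnorm_Zd u : sqnorm (Zd u) = sqnorm (P k2 0 u).
Proof.
rewrite /sqnorm; congr Rintegral; apply/funext => p.
by rewrite /sqmod /Zd /P /=; ring.
Qed.

(** The integrand is half of the derivative of [|u|^2]. *)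
Lemma rip_Zd_id u : Tf u -> rip (Zd u) u = 0.
Proof.
move=> [u1 u2]; have [s1 _] := u1; have [s2 _] := u2.
have c1 : Ccs (fun p => 2^-1 * (complex.Re (u p) * complex.Re (u p) + complex.Im (u p) * complex.Im (u p))).
  by apply: CcsZ; apply: CcsD; apply: CcsMl.
rewrite -(rint_X k2 c1) /rip -/(rint _); congr rint; apply/funext => p.
rewrite XZ; last by apply: smoothD; exact: smoothM.
rewrite (XD k2 (smoothM s1 s1) (smoothM s2 s2)) (XM k2 s1 s1) (XM k2 s2 s2).
by rewrite /redot /Zd /=; field.
Qed.

Lemma rint_XX i j f g : Ccs f -> Ccs g -> rint (fun p => X i f p + X j g p) = 0.
Proof.
move=> cf cg; have jf := Ccs_intble (Ccs_X i cf); have jg := Ccs_intble (Ccs_X j cg).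
by rewrite (rintD jf jg) !rint_X// addr0.
Qed.

Section Commutator.
Variables (j : 'I_3) (eps B : R) (u : cfun3 R).
Hypothesis comm : forall f, smooth f -> X k2 (X j f) = fun p => eps * X j f p + X j (X k2 f) p.
Hypothesis tu : Tf u.

(** Since [Z] is antisymmetric and [P_j] is symmetric, twice the left product is the
    form of a commutator; the commutator of the vertical field with a horizontal
    momentum is again that momentum, up to a sign and to the constant [B]. *)
Lemma rip_Zd_P : 2 * rip (Zd u) (P j B u) = - eps * rip u (P j B u) + eps * B * sqnorm u.
Proof.
have [u1 u2] := tu; have [s1 _] := u1; have [s2 _] := u2.
have sX1 := smooth_X j s1; have sX2 := smooth_X j s2.
have sZ1 := smooth_X k2 s1; have sZ2 := smooth_X k2 s2.
pose F p := complex.Re (u p) * X j (fun q => complex.Im (u q)) p -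
  complex.Im (u p) * X j (fun q => complex.Re (u q)) p.
pose G p := complex.Im (u p) * X k2 (fun q => complex.Re (u q)) p -
  complex.Re (u p) * X k2 (fun q => complex.Im (u q)) p.
have cF : Ccs F by apply: CcsB; apply: CcsMl => //; exact: Ccs_X.
have cG : Ccs G by apply: CcsB; apply: CcsMl => //; exact: Ccs_X.
have tP := Tf_P j B tu; have tZ := Tf_Zd tu.
have i1 : intble (redot (Zd u) (P j B u)) by apply: intble_redot; exact: Tf_L2.
have i2 : intble (redot u (P j B u)) by apply: intble_redot; exact: Tf_L2.
have i3 : intble (redot (Zd u) u) by apply: intble_redot; exact: Tf_L2.
have i4 : intble (sqmod u) by apply: intble_sqmod; exact: Tf_L2.
have E' : rint (fun p => (2 * redot (Zd u) (P j B u) p + eps * redot u (P j B u) p) -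
   (2 * B * redot (Zd u) u p + eps * B * sqmod u p)) = rint (fun p => X k2 F p + X j G p).
  congr rint; apply/funext => p.
  rewrite /F /G (XB k2 (smoothM s1 sX2) (smoothM s2 sX1)) (XM k2 s1 sX2) (XM k2 s2 sX1).
  rewrite (XB j (smoothM s2 sZ1) (smoothM s1 sZ2)) (XM j s2 sZ1) (XM j s1 sZ2).
  rewrite (comm s1) (comm s2) /redot /sqmod /Zd /P /=.
  generalize (X j (X k2 (fun q => complex.Re (u q))) p) (X j (X k2 (fun q => complex.Im (u q))) p)
    (X j (fun q => complex.Re (u q)) p) (X j (fun q => complex.Im (u q)) p)
    (X k2 (fun q => complex.Re (u q)) p) (X k2 (fun q => complex.Im (u q)) p)
    (complex.Re (u p)) (complex.Im (u p)) => *; ring.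
have E0 : rint (fun p => X k2 F p + X j G p) = 0.
  exact: rint_XX cF cG.
have := etrans E' E0; rewrite (rintB (intbleD (intbleZ 2 i1) (intbleZ eps i2))
  (intbleD (intbleZ (2 * B) i3) (intbleZ (eps * B) i4))).
rewrite (rintD (intbleZ 2 i1) (intbleZ eps i2)) (rintD (intbleZ (2 * B) i3) (intbleZ (eps * B) i4)).
rewrite (rintZ 2 i1) (rintZ eps i2) (rintZ (2 * B) i3) (rintZ (eps * B) i4).
have -> : rint (redot (Zd u) u) = 0 by exact: rip_Zd_id.
rewrite /rip /sqnorm -!/(rint _); move: (rint _) (rint _) (rint _) => x y z E; lra.
Qed.

End Commutator.

Lemma ripZl u v (t : R) : L2 u -> L2 v -> rip (fun p => t%:C * u p) v = t * rip u v.
Proof.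
move=> lu lv; rewrite /rip -!/(rint _) -rintZ; last exact: intble_redot.
by congr rint; apply/funext => p; rewrite /redot cReM cImM /=; ring.
Qed.

(** The factorization behind the spectral bound: for unit [(a, b)] the form
    [|Z|^2 + t^2 (|P0|^2 + |P1|^2)], with [Z] the vertical field, is the sum of
    the squares of [Z + a t P0 + b t P1 + (a^2 - b^2)/2] and [b t P0 - a t P1 + a b], plus
    a constant. *)
Lemma form_lower_bound (Bx By t a b : R) u : Tf u -> a ^+ 2 + b ^+ 2 = 1 ->
  (t * (b * By - a * Bx) - 4^-1) * sqnorm u <=
  sqnorm (P k2 0 u) + t ^+ 2 * (sqnorm (P k0 Bx u) + sqnorm (P k1 By u)).
Proof.
move=> tu ab.
have lu := Tf_L2 tu; have lz := Tf_L2 (Tf_Zd tu).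
have l0 := Tf_L2 (Tf_P k0 Bx tu); have l1 := Tf_L2 (Tf_P k1 By tu).
have c0 f : smooth f -> X k2 (X k0 f) = fun p => 1 * X k0 f p + X k0 (X k2 f) p.
  by move=> sf; rewrite XzX0//; apply/funext => p; rewrite mul1r.
have c1 f : smooth f -> X k2 (X k1 f) = fun p => (-1) * X k1 f p + X k1 (X k2 f) p.
  by move=> sf; rewrite XzX1//; apply/funext => p; rewrite mulN1r.
have g0 := rip_Zd_P Bx c0 tu; have g1 := rip_Zd_P By c1 tu; have g2 := rip_Zd_id tu.
rewrite -sqnorm_Zd.
pose c := (a ^+ 2 - b ^+ 2) / 2.
pose A1 : cfun3 R := fun p => Zd u p + (a * t)%:C * P k0 Bx u p.
pose A2 : cfun3 R := fun p => A1 p + (b * t)%:C * P k1 By u p.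
pose N0 : cfun3 R := fun p => (b * t)%:C * P k0 Bx u p.
pose N1 : cfun3 R := fun p => N0 p + (- (a * t))%:C * P k1 By u p.
have lA1 : L2 A1 := L2D lz (L2Z _ l0).
have lA2 : L2 A2 := L2D lA1 (L2Z _ l1).
have lN0 : L2 N0 := L2Z _ l0.
have lN1 : L2 N1 := L2D lN0 (L2Z _ l1).
have H1 := sqnorm_ge0 (fun p => A2 p + c%:C * u p).
have H2 := sqnorm_ge0 (fun p => N1 p + (a * b)%:C * u p).
rewrite (sqnormDZ c lA2 lu) (sqnormDZ (b * t) lA1 l1) (sqnormDZ (a * t) lz l0) in H1.
rewrite (ripDl lA1 (L2Z _ l1) lu) (ripDl lz (L2Z _ l0) lu) (ripDl lz (L2Z _ l0) l1) in H1.
rewrite (ripZl _ l1 lu) (ripZl _ l0 lu) (ripZl _ l0 l1) g2 in H1.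
rewrite (sqnormDZ (a * b) lN1 lu) (sqnormDZ (- (a * t)) lN0 l1) in H2.
rewrite (ripDl lN0 (L2Z _ l1) lu) (ripZl _ l0 l1) (ripZl _ l1 lu) (ripZl _ l0 lu) (sqnormZ _ l0) /= in H2.
move: g0 g1 H1 H2; rewrite (rip_sym (P k0 Bx u) u) (rip_sym (P k1 By u) u).
set D := sqnorm (Zd u); set p0 := sqnorm (P k0 _ _); set p1 := sqnorm (P k1 _ _).
set n := sqnorm u; set s0 := rip u _; set s1 := rip u _; set q := rip (P k0 _ _) _.
set y0 := rip (Zd u) _; set y1 := rip (Zd u) _ => g0 g1 H1 H2.
(* the commutation relations turn the cross terms with [Z] into horizontal ones *)
have E0 : y0 = 2^-1 * (Bx * n - s0) by lra.
have E1 : y1 = 2^-1 * (s1 - By * n) by lra.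
rewrite {}E0 {}E1 in H1; rewrite -subr_ge0.
set S := a ^+ 2 + b ^+ 2 in ab.
have -> : D + t ^+ 2 * (p0 + p1) - (t * (b * By - a * Bx) - 4^-1) * n =
  (D + 2 * (a * t) * (2^-1 * (Bx * n - s0)) + (a * t) ^+ 2 * p0 +
    2 * (b * t) * (2^-1 * (s1 - By * n) + a * t * q) + (b * t) ^+ 2 * p1 +
    2 * c * (0 + a * t * s0 + b * t * s1) + c ^+ 2 * n) +
  (((b * t) ^+ 2 + 0 ^+ 2) * p0 + 2 * - (a * t) * (b * t * q) + (- (a * t)) ^+ 2 * p1 +
    2 * (a * b) * (b * t * s0 + - (a * t) * s1) + (a * b) ^+ 2 * n) +
  (1 - S) * (t ^+ 2 * (p0 + p1) + a * t * s0 - b * t * s1 + (1 + S) / 4 * n).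
  by rewrite /c /S; field.
by rewrite ab subrr mul0r addr0; exact: addr_ge0.
Qed.

Definition bottom (B : R) : R := if B <= 2^-1 then 2^-1 * B ^+ 2 else 2^-1 * (B - 4^-1).

(** The vector [(a, b)] is chosen along [(-Bx, By)], which makes [b By - a Bx] equal
    to [B]. For [B > 1/2] the value [t = 1] is used; for [B <= 1/2] it is
    [t = 1/(2B)], which corresponds to the critical field [1/2]. *)
Lemma energy_lower_bound (Bx By B : R) u : B = Num.sqrt (Bx ^+ 2 + By ^+ 2) -> Tf u ->
  2 * bottom B * sqnorm u <= sqnorm (P k2 0 u) + (sqnorm (P k0 Bx u) + sqnorm (P k1 By u)).
Proof.
move=> hB tu.
have B0 : 0 <= B by rewrite hB sqrtr_ge0.
have B2 : B ^+ 2 = Bx ^+ 2 + By ^+ 2 by rewrite hB sqr_sqrtr// addr_ge0 ?sqr_ge0.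
have z0 := sqnorm_ge0 (P k2 0 u); have z1 := sqnorm_ge0 (P k0 Bx u).
have z2 := sqnorm_ge0 (P k1 By u).
have [Bz|Bn] := eqVneq B 0.
  by rewrite /bottom Bz invr_ge0 ler0n expr0n/= !mulr0 mul0r !addr_ge0.
have Bp : 0 < B by rewrite lt_neqAle eq_sym Bn.
have ab : (- (Bx / B)) ^+ 2 + (By / B) ^+ 2 = 1.
  by rewrite sqrrN !exprMn -mulrDl -B2 -exprMn divff// expr1n.
have key t := @form_lower_bound Bx By t (- (Bx / B)) (By / B) u tu ab.
have E : By / B * By - - (Bx / B) * Bx = B.
  by apply: (mulIf Bn); rewrite -expr2 B2; field.
rewrite /bottom; case: ifPn => [Bh|]; last first.
  by move=> _; have := key 1; rewrite E expr1n !mul1r; lra.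
have := key ((2 * B)^-1); rewrite E => H.
have c0 : 0 <= (2 * B) ^+ 2 by exact: sqr_ge0.
have := ler_wpM2l c0 H; rewrite mulrDr.
set p := _ + sqnorm (P k1 By u); set n := sqnorm u; set D := sqnorm (P k2 _ _).
rewrite mulrA [X in X * n](_ : _ = B ^+ 2); last by field.
rewrite [X in _ <= _ + X](_ : _ = p); last by field.
have : (2 * B) ^+ 2 * D <= D.
  by rewrite ler_piMl// expr_le1// ?mulr_ge0//; lra.
move=> h1; rewrite (_ : (2 * B) ^+ 2 * ((2 * B)^-1 * B - 4^-1) = B ^+ 2); last by field.
by move=> h2; lra.
Qed.

End Fields.

(** * Group convolution with smooth kernels *)

Section Kernel_operators.
Variable R : realType.
Implicit Types (Phi Psi : space3 R -> space3 R -> R) (u : space3 R -> R) (j : 'I_3).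

Definition ind (M : R) (k : space3 R) : R := \1_(box M) k.

Lemma ind_ge0 M k : 0 <= ind M k.
Proof. by rewrite /ind indicE. Qed.
Lemma ind_le1 M k : ind M k <= 1.
Proof. by rewrite /ind indicE; case: (_ \in _). Qed.
Lemma ind1 M k : inbox M k -> ind M k = 1.
Proof. by move=> /boxP bk; rewrite /ind indicE mem_set. Qed.
Lemma measurable_ind M : measurable_fun [set: mspace3 R] (ind M).
Proof. by apply: measurable_indic; exact: measurable_box. Qed.
Lemma intble_ind M : intble (ind M).
Proof.
apply: (@bounded_intble _ _ M 1); first exact: measurable_ind.
- by move=> p; rewrite ger0_norm ?ind_ge0// ind_le1.
- by move=> p pM; rewrite /ind indicE memNset// => /boxP.
Qed.

Definition locint u := measurable_fun [set: mspace3 R] u /\ forall M, intble (fun k => ind M k * u k).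

Lemma locint_sq u : measurable_fun [set: mspace3 R] u -> intble (fun k => u k ^+ 2) -> locint u.
Proof.
move=> mu ju; split => // M.
apply: (@intble_le _ _ (fun k => ind M k + u k ^+ 2)).
- by apply: measurable_funM => //; exact: measurable_ind.
- move=> p; rewrite normrM ger0_norm ?ind_ge0//.
  have := ind_ge0 M p; have := ind_le1 M p; have := sqr_ge0 (`|u p| - 1).
  rewrite -(real_normK (num_real (u p))); have := normr_ge0 (u p); nra.
- by apply: intbleD => //; exact: intble_ind.
Qed.

(** Kernels that are bounded and compactly supported in the second variable,
    locally uniformly in the first. *)
Definition kgood Phi := (forall h, measurable_fun [set: mspace3 R] (Phi h)) /\
  forall M, exists C N : R, 0 <= C /\
    forall h, inbox M h -> forall k, `|Phi h k| <= C * ind N k.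

Definition kop Phi u : space3 R -> R := fun h => rint (fun k => Phi h k * u k).

Definition hnorm (h : space3 R) : R := `|h.1.1| + `|h.1.2| + `|h.2|.
Lemma inbox_hnorm h (M : R) : hnorm h <= M -> inbox M h.
Proof.
rewrite /hnorm => H; have := normr_ge0 h.1.1; have := normr_ge0 h.1.2; have := normr_ge0 h.2.
by split; lra.
Qed.

Lemma kop_dominated Phi u M : kgood Phi -> locint u -> exists G : space3 R -> R,
  [/\ intble G, forall k, 0 <= G k &
   forall h, inbox M h -> forall k, `|Phi h k * u k| <= G k].
Proof.
move=> [mP bP] [mu ju]; have [C [N [C0 HC]]] := bP M.
exists (fun k => C * `|ind N k * u k|); split.
- apply: intbleZ; apply: (@intble_le _ _ (fun k => `|ind N k * u k|)) => [||].
  + by apply: measurableT_comp => //; apply: measurable_funM => //; exact: measurable_ind.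
  + by move=> p; rewrite normr_id.
  + by have /integrable_abse := ju N.
- by move=> k; rewrite mulr_ge0.
- move=> h hM k; rewrite !normrM mulrA ler_wpM2r//; apply: le_trans (HC h hM k) _.
  by rewrite (ger0_norm (ind_ge0 _ _)).
Qed.

Lemma intble_kop Phi u h : kgood Phi -> locint u -> intble (fun k => Phi h k * u k).
Proof.
move=> gP lu; have [G [jG G0 HG]] := kop_dominated (hnorm h) gP lu.
apply: (intble_le _ _ jG); first by apply: measurable_funM; [exact: gP.1|exact: lu.1].
by apply: HG; exact: inbox_hnorm.
Qed.

Lemma lbnd_kop Phi u : kgood Phi -> locint u -> lbnd (kop Phi u).
Proof.
move=> gP lu M; have [G [jG G0 HG]] := kop_dominated M gP lu.
exists (rint G) => h hM; rewrite /kop.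
have jh := intble_kop h gP lu.
apply: le_trans (le_normr_Rintegral _ jh) _ => //.
apply: le_rint => //; last by move=> k; exact: HG.
by have /integrable_abse := jh.
Qed.

(** The derivative of the kernel is dominated uniformly for [h] in a neighbourhood,
    which allows differentiation under the integral sign. *)
Lemma is_derive_kop j Phi Psi u h : kgood Phi -> kgood Psi -> locint u ->
  (forall h k, is_derive h (axis R j) (Phi ^~ k) (Psi h k)) ->
  is_derive h (axis R j) (kop Phi u) (kop Psi u h).
Proof.
move=> gP gQ lu dP; apply/is_derive_line.
pose f (t : R) (k : space3 R) : R := Phi (upd j t h) k * u k.
have df (t : R) k : is_derive t 1 (f ^~ k) (Psi (upd j t h) k * u k).
  have /is_derive_line := dP (upd j t h) k.
  have -> : crd j (upd j t h) = t.
    by case: (ord3P j) => ->; rewrite ?(upd0, upd1, upd2).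
  have E s : upd j s (upd j t h) = upd j s h.
    by case: (ord3P j) => ->; rewrite ?(upd0, upd1, upd2).
  under eq_fun do rewrite E.
  move=> d; have := @is_deriveM R R _ (cst (u k)) t 1 _ _ d (is_derive_cst _ _ _).
  rewrite scaler0 add0r => H; apply: (is_derive_eq H).
  by rewrite /GRing.scale/= mulrC.
have [G [jG G0 HG]] := kop_dominated (hnorm h + 1) gQ lu.
set a := crd j h.
have Ia : `]a - 1, a + 1[%classic a by rewrite /= in_itv/=; apply/andP; split; lra.
have inb t : `]a - 1, a + 1[%classic t -> inbox (hnorm h + 1) (upd j t h).
  rewrite /= in_itv/= => /andP[t1 t2].
  have : `|t - a| <= 1 by rewrite ler_norml; apply/andP; split; lra.
  have := ler_normD (t - a) a; rewrite subrK => tn t3.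
  have := normr_ge0 h.1.1; have := normr_ge0 h.1.2; have := normr_ge0 h.2.
  rewrite /hnorm => n1 n2 n3; move: tn t3; rewrite /a.
  by case: (ord3P j) => ->; rewrite /crd ?(upd0, upd1, upd2) /= => tn t3; split => /=; lra.
have i1 t : `]a - 1, a + 1[%classic t -> intble (f t).
  by move=> _; exact: intble_kop.
have i2 (t : R) k : `]a - 1, a + 1[%classic t -> [set: mspace3 R] k -> derivable (f ^~ k) t 1.
  by move=> _ _; have [] := df t k.
have PE t k : partial1of2 f t k = Psi (upd j t h) k * u k.
  by rewrite partial1of2E; have [_] := df t k.
have i3 (t : R) k : `]a - 1, a + 1[%classic t -> [set: mspace3 R] k -> `|partial1of2 f t k| <= G k.
  by move=> It _; rewrite PE; apply: HG; exact: inb.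
have D1 := @derivable_under_integral R _ _ (leb3 R) f _ measurableT _ _ _ Ia i1 i2 _ G0 jG i3.
have D2 := @differentiation_under_integral R _ _ (leb3 R) f _ measurableT _ _ _ Ia i1 i2 _ G0 jG i3.
split; first exact: D1.
rewrite -derive1E; rewrite [LHS]D2; apply: eq_Rintegral => k _.
by rewrite PE upd_id.
Qed.

Lemma kgoodD Phi Psi : kgood Phi -> kgood Psi -> kgood (fun h k => Phi h k + Psi h k).
Proof.
move=> [m1 b1] [m2 b2]; split=> [h|M]; first exact: measurable_funD.
have [C [N [C0 H1]]] := b1 M; have [D [L [D0 H2]]] := b2 M.
exists (C + D), (Num.max N L); split=> [|h hM k]; first exact: addr_ge0.
apply: le_trans (ler_normD _ _) _; rewrite mulrDl.
have mono (S : R) : S <= Num.max N L -> ind S k <= ind (Num.max N L) k.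
  move=> SM; have [ik|ik] := pselect (inbox S k).
    by rewrite !ind1//; exact: inbox_le ik.
  by rewrite [ind S k]/ind indicE memNset ?ind_ge0// => /boxP.
apply: lerD; [apply: le_trans (H1 h hM k) _|apply: le_trans (H2 h hM k) _]; apply: ler_wpM2l => //;
 apply: mono; by rewrite le_max lexx ?orbT.
Qed.

Lemma kgoodZ Phi (g : space3 R -> R) : kgood Phi -> lbnd g -> kgood (fun h k => g h * Phi h k).
Proof.
move=> [m1 b1] bg; split=> [h|M]; first by apply: measurable_funM => //; exact: measurable_cst.
have [C [N [C0 H1]]] := b1 M; have [D H2] := bg M.
exists (`|D| * C), N; split=> [|h hM k]; first exact: mulr_ge0.
rewrite normrM -mulrA; apply: ler_pM => //; last exact: H1.
by apply: le_trans (H2 h hM) (ler_norm _).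
Qed.

Lemma kopD Phi Psi u h : kgood Phi -> kgood Psi -> locint u ->
  kop (fun h k => Phi h k + Psi h k) u h = kop Phi u h + kop Psi u h.
Proof.
move=> g1 g2 lu; rewrite /kop -rintD; [|exact: intble_kop..].
by congr rint; apply/funext => k; rewrite mulrDl.
Qed.
Lemma kopZ Phi (g : space3 R -> R) u h : kgood Phi -> locint u ->
  kop (fun h k => g h * Phi h k) u h = g h * kop Phi u h.
Proof.
move=> g1 lu; rewrite /kop -rintZ; last exact: intble_kop.
by congr rint; apply/funext => k; rewrite mulrA.
Qed.

End Kernel_operators.

Section Group_kernel.
Variables (R : realType) (N : R).
Hypothesis N0 : 0 <= N.
Implicit Types (a b c : R -> R) (h k : space3 R) (u : space3 R -> R) (j : 'I_3).

Definition cs1 a := sm1 a /\ forall t, N < `|t| -> a t = 0.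

Lemma cs1_bounded a : cs1 a -> exists2 C : R, 0 <= C & forall t, `|a t| <= C.
Proof.
move=> [sa a0]; have [C HC] := smooth_lbnd sa N.
have C0 : 0 <= C by apply: le_trans (HC (0, 0, 0) _) => //; split; rewrite /= normr0.
exists C => // t; have [tN|tN] := leP `|t| N; last by rewrite a0// normr0.
by apply: (HC (0, 0, t)); split; rewrite //= normr0.
Qed.

Lemma cs1_mul a b : sm1 b -> cs1 a -> cs1 (fun t => b t * a t).
Proof. by move=> sb [sa a0]; split; [exact: sm1M|move=> t /a0 ->; rewrite mulr0]. Qed.

Lemma cs1_d1 a : cs1 a -> cs1 (d1 a).
Proof.
move=> [sa a0]; split; first exact: sm1_d1.
move=> t tN; rewrite /d1 (@near_eq_derive _ _ _ a (fun=> 0)) ?derive_cst//.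
have /cvgr_gt/(_ N tN) : (fun s : R => `|s|) @ t --> `|t| by exact: norm_continuous.
by apply: filterS => s; exact: a0.
Qed.

Lemma cs1_opp a : cs1 a -> cs1 (fun t => a (- t)).
Proof.
move=> [sa a0]; split; last by move=> t tN; apply: a0; rewrite normrN.
by have := sm1_affine (-1) 0 sa; under eq_fun do rewrite mulN1r addr0.
Qed.

Definition vdiff h k : R := h.2 - k.2.
Definition xdiff h k : R := expR (- (vdiff h k) / 2) * h.1.1 - expR (vdiff h k / 2) * k.1.1.
Definition ydiff h k : R := expR (vdiff h k / 2) * h.1.2 - expR (- (vdiff h k) / 2) * k.1.2.

(** A product of functions of three coordinates of [h k^-1]. Being a function of
    [h k^-1] makes the kernel invariant under simultaneous right translations, which
    are generated by the left-invariant fields. The coordinates are normalized by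
    [e^(w/2)] and [e^(-w/2)] so that exchanging [h] and [k] changes their signs. *)
Definition Kr a b c h k : R := a (xdiff h k) * b (ydiff h k) * c (vdiff h k).

Lemma Kr_sym a b c h k : Kr a b c h k =
  Kr (fun t => a (- t)) (fun t => b (- t)) (fun t => c (- t)) k h.
Proof.
rewrite /Kr /xdiff /ydiff /vdiff.
by congr (a _ * b _ * c _); rewrite ?opprB; try ring;
 rewrite (_ : k.2 - h.2 = - (h.2 - k.2)) ?opprK; try ring.
Qed.

Lemma smooth_vdiff k : smooth (vdiff ^~ k).
Proof. by apply: smoothB; [exact: (@smooth_crd R k2)|exact: smooth_cst]. Qed.

Lemma smooth_expv (s : R) k : smooth (fun h => expR (s * vdiff h k)).
Proof. by apply: (sm1_comp (sm1_expR R)); apply: smoothZ; exact: smooth_vdiff. Qed.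

Let expE1 h k : expR (- (vdiff h k) / 2) = expR ((- 2^-1) * vdiff h k).
Proof. by congr expR; ring. Qed.
Let expE2 h k : expR (vdiff h k / 2) = expR (2^-1 * vdiff h k).
Proof. by congr expR; ring. Qed.

Lemma smooth_xdiff k : smooth (xdiff ^~ k).
Proof.
rewrite /xdiff; under eq_fun do rewrite expE1 expE2.
apply: smoothB; apply: smoothM; rewrite ?(@smooth_expv (- 2^-1) k) //.
- exact: (@smooth_expv (- 2^-1) k).
- exact: (@smooth_crd R k0).
- exact: (@smooth_expv (2^-1) k).
- exact: smooth_cst.
Qed.
Lemma smooth_ydiff k : smooth (ydiff ^~ k).
Proof.
rewrite /ydiff; under eq_fun do rewrite expE1 expE2.
apply: smoothB; apply: smoothM.
- exact: (@smooth_expv (2^-1) k).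
- exact: (@smooth_crd R k1).
- exact: (@smooth_expv (- 2^-1) k).
- exact: smooth_cst.
Qed.

Lemma smooth_Kr a b c k : sm1 a -> sm1 b -> sm1 c -> smooth (Kr a b c ^~ k).
Proof.
move=> sa sb sc; apply: smoothM; first apply: smoothM.
- exact: sm1_comp sa (smooth_xdiff k).
- exact: sm1_comp sb (smooth_ydiff k).
- exact: sm1_comp sc (smooth_vdiff k).
Qed.

Lemma smooth_Kr2 a b c h : sm1 a -> sm1 b -> sm1 c -> smooth (Kr a b c h).
Proof.
move=> sa sb sc; rewrite (funext (Kr_sym a b c h)).
have opp (f : R -> R) : sm1 f -> sm1 (fun t => f (- t)).
  by move=> sf; have := sm1_affine (-1) 0 sf; under eq_fun do rewrite mulN1r addr0.
by apply: smooth_Kr; exact: opp.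
Qed.

Definition suppK (M : R) : R := expR N * (N + M).

(** A bound on [h k^-1] and on [h] bounds [k], up to the exponential distortion of
    the horizontal coordinates. *)
Lemma Kr_support a b c h k M : cs1 a -> cs1 b -> cs1 c -> inbox M h ->
  ~ inbox (suppK M) k -> Kr a b c h k = 0.
Proof.
move=> [_ a0] [_ b0] [_ c0] [hx hy hz] nk; apply: contrapT => K0.
have M0 : 0 <= M by apply: le_trans hx.
have nz (f : R -> R) t : (forall t, N < `|t| -> f t = 0) -> f t != 0 -> `|t| <= N.
  by move=> f0 ft; rewrite leNgt; apply/negP => tN; rewrite f0 ?eqxx in ft.
move/eqP: K0; rewrite /Kr !mulf_eq0 !negb_or => /andP[/andP[/(nz _ _ a0) xN /(nz _ _ b0) yN] /(nz _ _ c0) vN].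
have e1 : 1 <= expR N by rewrite -expR0 ler_expR.
have eN s : `|s| <= N -> expR (s / 2) <= expR (N / 2).
  by rewrite ler_expR ler_norml => /andP[? ?]; lra.
have eE : expR N = expR (N / 2) * expR (N / 2) by rewrite -expRD; congr expR; field.
have e2 : 1 <= expR (N / 2) by rewrite -expR0 ler_expR divr_ge0.
(* solving for the second point costs a factor [exp(N/2)] twice *)
have key (s p q : R) : `|s| <= N -> `|p| <= M -> `|expR (- s / 2) * p - expR (s / 2) * q| <= N ->
   `|q| <= suppK M.
  move=> sN pM d.
  have q1 : q = expR (- s / 2) * (expR (- s / 2) * p - (expR (- s / 2) * p - expR (s / 2) * q)).
    by rewrite subKr mulrA -expRD (_ : - s / 2 + s / 2 = 0) ?expR0 ?mul1r//; ring.
  have sN' : `|- s| <= N by rewrite normrN.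
  have es := eN _ sN'; have ep := expR_gt0 (- s / 2).
  rewrite q1 normrM (gtr0_norm ep) /suppK eE -mulrA; apply: (ler_pM (ltW ep) (normr_ge0 _) es).
  apply: le_trans (ler_normB _ _) _; rewrite normrM (gtr0_norm ep) mulrDr addrC.
  apply: lerD; first by apply: le_trans d _; rewrite ler_peMl.
  exact: (ler_pM (ltW ep) (normr_ge0 _) es pM).
apply: nk; split.
- exact: (key _ _ _ vN hx xN).
- have vN' : `|- vdiff h k| <= N by rewrite normrN.
  by apply: (key _ _ _ vN' hy); rewrite opprK.
- have := ler_normB h.2 (vdiff h k); rewrite /vdiff subKr => H; apply: le_trans H _.
  apply: (@le_trans _ _ (N + M)); first by rewrite addrC; exact: lerD.
  by rewrite /suppK ler_peMl// addr_ge0.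
Qed.

Lemma kgood_Kr a b c : cs1 a -> cs1 b -> cs1 c -> kgood (Kr a b c).
Proof.
move=> ca cb cc; split=> [h|M].
  apply: continuous_measurable3; apply: smooth_continuous.
  by apply: smooth_Kr2; [case: ca|case: cb|case: cc].
have [A A0 HA] := cs1_bounded ca; have [B B0 HB] := cs1_bounded cb; have [C C0 HC] := cs1_bounded cc.
exists (A * B * C), (suppK M); split=> [|h hM k]; first by rewrite !mulr_ge0.
have [ik|nk] := pselect (inbox (suppK M) k); last first.
  by rewrite (Kr_support ca cb cc hM nk) normr0 mulr_ge0 ?ind_ge0// !mulr_ge0.
rewrite ind1// mulr1 /Kr !normrM; apply: ler_pM => //; exact: ler_pM.
Qed.

Lemma pd_vdiff j k : pd j (vdiff ^~ k) = fun=> (j == k2)%:R.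
Proof.
have s1 := smooth_pdable (@smooth_crd R k2); have s2 := @pdable_cst R k.2.
by rewrite /vdiff (pdB j s1 s2) (@pd_crd R k2) pd_cst eq_sym; apply/funext => h; rewrite subr0.
Qed.

Lemma pd_expv j (s : R) k : pd j (fun h => expR (s * vdiff h k)) =
  fun h => s * (j == k2)%:R * expR (s * vdiff h k).
Proof.
have dv := smooth_pdable (smooth_vdiff k).
have dz : pdable (fun h => s * vdiff h k) by apply: smooth_pdable; apply: smoothZ; exact: smooth_vdiff.
rewrite (pd_comp j (fun x : R => @derivable_expR R x) dz) (pdZ j s dv) pd_vdiff.
apply/funext => h; rewrite (_ : d1 expR = expR); first by ring.
by apply: d1_eq => x; exact: is_derive_expR.
Qed.

Lemma pd_xdiff j k : pd j (xdiff ^~ k) = fun h =>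
  (j == k0)%:R * expR (- (vdiff h k) / 2) +
  (j == k2)%:R * (2^-1 * xdiff h k - expR (- (vdiff h k) / 2) * h.1.1).
Proof.
have s1 := smooth_expv (- 2^-1) k; have s2 := smooth_expv (2^-1) k.
have sx := @smooth_crd R k0; have sc := @smooth_cst R k.1.1.
rewrite (_ : xdiff ^~ k = fun h => expR ((- 2^-1) * vdiff h k) * crd k0 h - expR (2^-1 * vdiff h k) * k.1.1); last first.
  by apply/funext => h; rewrite /xdiff expE1 expE2.
rewrite (pdB j (smooth_pdable (smoothM s1 sx)) (smooth_pdable (smoothM s2 sc))).
rewrite (pdM j (smooth_pdable s1) (smooth_pdable sx)) (pdM j (smooth_pdable s2) (smooth_pdable sc)).
rewrite !pd_expv (@pd_crd R k0) pd_cst.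
by apply/funext => h; rewrite [k0 == j]eq_sym /xdiff !expE1 !expE2 /crd /=; field.
Qed.

Lemma pd_ydiff j k : pd j (ydiff ^~ k) = fun h =>
  (j == k1)%:R * expR (vdiff h k / 2) +
  (j == k2)%:R * (expR (vdiff h k / 2) * h.1.2 - 2^-1 * ydiff h k).
Proof.
have s1 := smooth_expv (- 2^-1) k; have s2 := smooth_expv (2^-1) k.
have sx := @smooth_crd R k1; have sc := @smooth_cst R k.1.2.
rewrite (_ : ydiff ^~ k = fun h => expR (2^-1 * vdiff h k) * crd k1 h - expR ((- 2^-1) * vdiff h k) * k.1.2); last first.
  by apply/funext => h; rewrite /ydiff expE1 expE2.
rewrite (pdB j (smooth_pdable (smoothM s2 sx)) (smooth_pdable (smoothM s1 sc))).
rewrite (pdM j (smooth_pdable s2) (smooth_pdable sx)) (pdM j (smooth_pdable s1) (smooth_pdable sc)).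
rewrite !pd_expv (@pd_crd R k1) pd_cst.
by apply/funext => h; rewrite [k1 == j]eq_sym /ydiff !expE1 !expE2 /crd /=; field.
Qed.

Let em c : R -> R := fun t => expR (- 2^-1 * t) * c t.
Let ep c : R -> R := fun t => expR (2^-1 * t) * c t.
Let tm a : R -> R := fun t => t * a t.

(** The derivative of the kernel in its first variable is a combination of
    kernels of the same form, with coefficients linear in [h]. *)
Definition DKr j a b c h k : R :=
  (j == k0)%:R * Kr (d1 a) b (em c) h k + ((j == k1)%:R * Kr a (d1 b) (ep c) h k +
  (j == k2)%:R * (Kr a b (d1 c) h k + (2^-1 * Kr (tm (d1 a)) b c h k +
    (- h.1.1 * Kr (d1 a) b (em c) h k + (- 2^-1 * Kr a (tm (d1 b)) c h k +
     h.1.2 * Kr a (d1 b) (ep c) h k))))).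

Lemma pd_Kr j a b c k : sm1 a -> sm1 b -> sm1 c ->
  pd j (Kr a b c ^~ k) = fun h => DKr j a b c h k.
Proof.
move=> sa sb sc.
have dx := smooth_pdable (smooth_xdiff k); have dy := smooth_pdable (smooth_ydiff k).
have dv := smooth_pdable (smooth_vdiff k).
have da : forall x : R, derivable a x 1 := fun x => @sm1_derivable R a x sa.
have db : forall x : R, derivable b x 1 := fun x => @sm1_derivable R b x sb.
have dc : forall x : R, derivable c x 1 := fun x => @sm1_derivable R c x sc.
have pa := pdable_comp da dx; have pb := pdable_comp db dy; have pc := pdable_comp dc dv.
rewrite /Kr (pdM j (pdableM pa pb) pc) (pdM j pa pb).
rewrite (pd_comp j da dx) (pd_comp j db dy) (pd_comp j dc dv) pd_xdiff pd_ydiff pd_vdiff.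
apply/funext => h; rewrite /DKr /Kr /em /ep /tm !expE1 !expE2; ring.
Qed.

Lemma cs1_em c : cs1 c -> cs1 (em c).
Proof.
apply: cs1_mul; have := sm1_affine (- 2^-1) 0 (sm1_expR R).
by under eq_fun do rewrite addr0.
Qed.
Lemma cs1_ep c : cs1 c -> cs1 (ep c).
Proof.
apply: cs1_mul; have := sm1_affine (2^-1) 0 (sm1_expR R).
by under eq_fun do rewrite addr0.
Qed.
Lemma cs1_tm a : cs1 a -> cs1 (tm a).
Proof. by apply: cs1_mul; exact: sm1_id. Qed.

End Group_kernel.

(** * Convolution operators: smoothness, symmetry and invariance *)

(** The measure of three-space, registered as sigma-finite so that Fubini's
    theorem applies to its product with itself. *)
Definition leb3s (R : realType) : set (mspace3 R) -> \bar R := leb3 R.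
HB.instance Definition _ (R : realType) := Measure.on (@leb3s R).

Lemma leb3_sigma_finite (R : realType) : sigma_finite setT (@leb3s R).
Proof.
exists (fun n : nat => box n%:R); last first.
  by move=> n; split; [exact: measurable_box|exact: leb3_box].
apply/seteqP; split => // p _.
exists (Num.truncn (hnorm p)).+1 => //=; apply/boxP.
by apply: inbox_hnorm; apply: ltW; exact: truncnS_gt.
Qed.

HB.instance Definition _ (R : realType) :=
  Measure_isSigmaFinite.Build _ _ _ (@leb3s R) (@leb3_sigma_finite R).

Section Convolution.
Variables (R : realType) (N : R).
Hypothesis N0 : 0 <= N.
Implicit Types (a b c : R -> R) (h k : space3 R) (u F : space3 R -> R) (j : 'I_3).
Local Notation cs1 := (cs1 N).

Lemma locint_Cc F : Cc F -> locint F.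
Proof.
move=> cF; have mF := continuous_measurable3 cF.1; have [C HC] := Cc_bounded cF.
apply: locint_sq => //; have [_ [M FM]] := cF.
apply: (@bounded_intble _ _ M (C ^+ 2)); first exact: measurable_funX.
- by move=> p; rewrite normrX ler_pXn2r ?nnegrE//; apply: le_trans (HC p).
- by move=> p /FM ->; rewrite expr0n.
Qed.

Lemma kgood_DKr j a b c : cs1 a -> cs1 b -> cs1 c -> kgood (DKr j a b c).
Proof.
move=> ca cb cc; have g := kgood_Kr N0.
have da := cs1_d1 ca; have db := cs1_d1 cb; have dc := cs1_d1 cc.
have em := cs1_em cc; have ep := cs1_ep cc.
have cst (r : R) : lbnd (fun _ : space3 R => r) by exact: lbnd_cst.
have lx : lbnd (fun h : space3 R => - h.1.1).
  by apply: smooth_lbnd; apply: smoothN; exact: (@smooth_crd R k0).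
have ly : lbnd (fun h : space3 R => h.1.2) by exact: (@lbnd_crd R k1).
have z1 := kgoodZ (g _ _ _ (cs1_tm da) cb cc) (cst 2^-1).
have z2 := kgoodZ (g _ _ _ da cb em) lx.
have z3 := kgoodZ (g _ _ _ ca (cs1_tm db) cc) (cst (- 2^-1)).
have z4 := kgoodZ (g _ _ _ ca db ep) ly.
have z := kgoodD (g _ _ _ ca cb dc) (kgoodD z1 (kgoodD z2 (kgoodD z3 z4))).
exact: (kgoodD (kgoodZ (g _ _ _ da cb em) (cst (j == k0)%:R))
  (kgoodD (kgoodZ (g _ _ _ ca db ep) (cst (j == k1)%:R)) (kgoodZ z (cst (j == k2)%:R)))).
Qed.

Lemma is_derive_conv j a b c u h : cs1 a -> cs1 b -> cs1 c -> locint u ->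
  is_derive h (axis R j) (kop (Kr a b c) u) (kop (DKr j a b c) u h).
Proof.
move=> ca cb cc lu.
have H := @is_derive_kop R j (Kr a b c) (DKr j a b c) u h (kgood_Kr N0 ca cb cc) (kgood_DKr j ca cb cc) lu.
apply: H => {}h k; have [sa _] := ca; have [sb _] := cb; have [sc _] := cc.
have := pdableP j h (smooth_pdable (smooth_Kr k sa sb sc)).
by rewrite (pd_Kr j k sa sb sc).
Qed.

(** The derivatives of a convolution are combinations, with coordinates as
    coefficients, of convolutions with kernels of the same form: convolutions and
    coordinates generate an algebra that is closed under derivation. *)
Lemma smooth_conv a b c u : cs1 a -> cs1 b -> cs1 c -> locint u -> smooth (kop (Kr a b c) u).
Proof.
move=> ca cb cc lu.
pose G : set (space3 R -> R) := [set f | (exists j, f = @crd R j) \/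
  exists a b c, [/\ cs1 a, cs1 b, cs1 c & f = kop (Kr a b c) u]].
have Gk a' b' c' : cs1 a' -> cs1 b' -> cs1 c' -> alg G (kop (Kr a' b' c') u).
  by move=> ? ? ?; apply: alg_gen; right; exists a', b', c'.
apply: (@alg_smooth R G); last exact: Gk.
- move=> f [[j ->]|[a' [b' [c' [ca' cb' cc' ->]]]]]; first exact: lbnd_crd.
  exact: (lbnd_kop (kgood_Kr N0 ca' cb' cc') lu).
- move=> f [[j ->]|[a' [b' [c' [ca' cb' cc' ->]]]]]; first exact: pdable_crd.
  by move=> k p; have [] := is_derive_conv k p ca' cb' cc' lu.
move=> f j [[i ->]|[{}a [{}b [{}c [{}ca {}cb {}cc ->]]]]].
  by rewrite (@pd_crd R i); exact: alg_cst.
rewrite (_ : pd j _ = kop (DKr j a b c) u); last first.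
  by apply/funext => h; have [_] := is_derive_conv j h ca cb cc lu.
have g := kgood_Kr N0.
have da := cs1_d1 ca; have db := cs1_d1 cb; have dc := cs1_d1 cc.
have em := cs1_em cc; have ep := cs1_ep cc.
have cst (r : R) : lbnd (fun _ : space3 R => r) by exact: lbnd_cst.
have lx : lbnd (fun h : space3 R => - h.1.1).
  by apply: smooth_lbnd; apply: smoothN; exact: (@smooth_crd R k0).
have ly : lbnd (fun h : space3 R => h.1.2) by exact: (@lbnd_crd R k1).
have g1 := g _ _ _ (cs1_tm da) cb cc; have g2 := g _ _ _ da cb em.
have g3 := g _ _ _ ca (cs1_tm db) cc; have g4 := g _ _ _ ca db ep.
have g5 := g _ _ _ ca cb dc.
have z1 := kgoodZ g1 (cst 2^-1); have z2 := kgoodZ g2 lx.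
have z3 := kgoodZ g3 (cst (- 2^-1)); have z4 := kgoodZ g4 ly.
have y3 := kgoodD z3 z4; have y2 := kgoodD z2 y3; have y1 := kgoodD z1 y2; have y0 := kgoodD g5 y1.
have w0 := kgoodZ g2 (cst (j == k0)%:R); have w1 := kgoodZ g4 (cst (j == k1)%:R).
have w2 := kgoodZ y0 (cst (j == k2)%:R); have w12 := kgoodD w1 w2.
have algZ (r : R) f' : alg G f' -> alg G (fun h => r * f' h).
  by move=> af; apply: alg_mul => //; exact: alg_cst.
have ax : alg G (fun h : space3 R => - h.1.1).
  under eq_fun do rewrite -mulN1r; apply: algZ; apply: alg_gen.
  by left; exists k0.
have ay : alg G (fun h : space3 R => h.1.2) by apply: alg_gen; left; exists k1.
rewrite (_ : kop _ u = fun h =>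
  (j == k0)%:R * kop (Kr (d1 a) b (fun t => expR (- 2^-1 * t) * c t)) u h +
  ((j == k1)%:R * kop (Kr a (d1 b) (fun t => expR (2^-1 * t) * c t)) u h +
   (j == k2)%:R * (kop (Kr a b (d1 c)) u h + (2^-1 * kop (Kr (fun t => t * d1 a t) b c) u h +
   (- h.1.1 * kop (Kr (d1 a) b (fun t => expR (- 2^-1 * t) * c t)) u h +
   (- 2^-1 * kop (Kr a (fun t => t * d1 b t) c) u h +
    h.1.2 * kop (Kr a (d1 b) (fun t => expR (2^-1 * t) * c t)) u h)))))); last first.
  apply/funext => h.
  rewrite [LHS](kopD h w0 w12 lu) (kopD h w1 w2 lu) (kopZ _ h y0 lu) (kopD h g5 y1 lu).
  rewrite (kopD h z1 y2 lu) (kopD h z2 y3 lu) (kopD h z3 z4 lu).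
  by rewrite (kopZ _ h g1 lu) (kopZ _ h g2 lu) (kopZ _ h g3 lu) (kopZ _ h g4 lu) (kopZ _ h g2 lu) (kopZ _ h g4 lu).
apply: alg_add; first by apply: algZ; exact: Gk.
apply: alg_add; first by apply: algZ; exact: Gk.
apply: (algZ _ _); apply: alg_add; first exact: Gk.
apply: alg_add; first by apply: algZ; apply: Gk => //; exact: cs1_tm.
apply: alg_add; first by apply: alg_mul => //; exact: Gk.
apply: alg_add; first by apply: algZ; apply: Gk => //; exact: cs1_tm.
by apply: alg_mul => //; exact: Gk.
Qed.

Lemma measurable_Kr a b c : sm1 a -> sm1 b -> sm1 c ->
  measurable_fun [set: mspace3 R * mspace3 R]
    (fun q : mspace3 R * mspace3 R => Kr a b c q.1 q.2 : R).
Proof.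
move=> sa sb sc.
have m1 (f : R -> R) : sm1 f -> measurable_fun [set: measurableTypeR R] f.
  by move=> sf; apply: continuous_measurable_fun; apply: derivable_continuous1 => x; exact: sm1_derivable.
have mE : measurable_fun [set: measurableTypeR R] (@expR R) by apply: m1; exact: sm1_expR.
have mv : measurable_fun [set: mspace3 R * mspace3 R]
    (fun q : mspace3 R * mspace3 R => vdiff q.1 q.2 : measurableTypeR R).
  apply: measurable_funB.
    by apply: (measurableT_comp measurable_snd); exact: measurable_fst.
  by apply: (measurableT_comp measurable_snd); exact: measurable_snd.
have ms (s : R) : measurable_fun [set: mspace3 R * mspace3 R]
    (fun q : mspace3 R * mspace3 R => expR (s * vdiff q.1 q.2)).
  by apply: (measurableT_comp mE); apply: measurable_funM.
have e1 (q : mspace3 R * mspace3 R) : expR (- vdiff q.1 q.2 / 2) = expR ((- 2^-1) * vdiff q.1 q.2).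
  by congr expR; ring.
have e2 (q : mspace3 R * mspace3 R) : expR (vdiff q.1 q.2 / 2) = expR (2^-1 * vdiff q.1 q.2).
  by congr expR; ring.
apply: measurable_funM; last exact: (measurableT_comp (m1 _ sc)).
apply: measurable_funM.
  apply: (measurableT_comp (m1 _ sa)); rewrite /xdiff; under eq_fun do rewrite e1 e2.
  apply: measurable_funB; apply: measurable_funM => //.
    by apply: (measurableT_comp measurable_fst); apply: (measurableT_comp measurable_fst); exact: measurable_fst.
  by apply: (measurableT_comp measurable_fst); apply: (measurableT_comp measurable_fst); exact: measurable_snd.
apply: (measurableT_comp (m1 _ sb)); rewrite /ydiff; under eq_fun do rewrite e1 e2.
apply: measurable_funB; apply: measurable_funM => //.
  by apply: (measurableT_comp measurable_snd); apply: (measurableT_comp measurable_fst); exact: measurable_fst.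
by apply: (measurableT_comp measurable_snd); apply: (measurableT_comp measurable_fst); exact: measurable_snd.
Qed.

(** Fubini's theorem exchanges a convolution operator with the one that has the
    reflected kernel. *)
Lemma conv_sym a b c u F : cs1 a -> cs1 b -> cs1 c -> locint u -> Cc F ->
  rint (fun h => F h * kop (Kr a b c) u h) =
  rint (fun k => kop (Kr (fun t => a (- t)) (fun t => b (- t)) (fun t => c (- t))) F k * u k).
Proof.
move=> ca cb cc lu cF.
have gK := kgood_Kr N0 ca cb cc.
have gK' := kgood_Kr N0 (cs1_opp ca) (cs1_opp cb) (cs1_opp cc).
have mF := continuous_measurable3 cF.1; have lF := locint_Cc cF.
pose f (q : mspace3 R * mspace3 R) : \bar R := (F q.1 * (Kr a b c q.1 q.2 * u q.2))%:E.
have mf : measurable_fun [set: mspace3 R * mspace3 R] f.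
  apply/measurable_EFinP; apply: measurable_funM.
    by apply: (measurableT_comp mF); exact: measurable_fst.
  apply: measurable_funM; first by apply: measurable_Kr; [case: ca|case: cb|case: cc].
  by apply: (measurableT_comp lu.1); exact: measurable_snd.
have [_ [M FM]] := cF; have [G [jG G0 HG]] := kop_dominated M gK lu.
have jf : ((@leb3s R \x @leb3s R)%E).-integrable setT f.
  apply/(integrable12ltyP _ _ mf).
  apply: (@le_lt_trans _ _ (\int[@leb3s R]_h ((`|F h| * rint G)%:E))%E); last first.
    have jFG : intble (fun h => rint G * `|F h|).
      by apply: intbleZ; have /integrable_abse := Cc_intble cF.
    under eq_integral do rewrite mulrC.
    by rewrite -(rintE jFG) ltry.
  apply: ge0_le_integral => //.
  - by move=> h _; exact: integral_ge0.
  - apply: (@measurable_fun_fubini_tonelli_F _ _ _ _ R (@leb3s R) (fun q => `|f q|)%E) => //.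
    exact: measurableT_comp.
  - by apply/measurable_EFinP; apply: measurable_funM => //; apply: measurableT_comp.
  move=> h _; rewrite EFinM (rintE jG) -ge0_integralZl//; last 2 first.
  - by have /integrableP[] := jG.
  - by move=> k _; rewrite lee_fin.
  apply: ge0_le_integral => //.
  - apply: measurableT_comp => //; apply: (measurableT_comp mf); exact: measurable_pair1.
  - by apply: emeasurable_funM => //; have /integrableP[] := jG.
  move=> k _; rewrite /f /= lee_fin normrM.
  have [hM|hM] := pselect (inbox M h); last by rewrite FM// normr0 !mul0r.
  by apply: ler_wpM2l => //; exact: HG.
have E1 h : ((F h * kop (Kr a b c) u h)%:E = \int[@leb3s R]_k f (h, k))%E.
  rewrite EFinM (rintE (intble_kop h gK lu)) -integralZl//.
  exact: intble_kop.
have E2 k : ((kop (Kr (fun t => a (- t)) (fun t => b (- t)) (fun t => c (- t))) F k * u k)%:E =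
    \int[@leb3s R]_h f (h, k))%E.
  rewrite EFinM (rintE (intble_kop k gK' lF)) -integralZr//; last exact: intble_kop.
  apply: eq_integral => h _; rewrite /f /= -EFinM -Kr_sym; congr EFin; ring.
rewrite /rint /Rintegral; congr fine.
transitivity (\int[@leb3s R]_h \int[@leb3s R]_k f (h, k))%E.
  by apply: eq_integral => h _; exact: E1.
rewrite (Fubini jf); apply: eq_integral => k _; by rewrite E2.
Qed.

Lemma d1_opp a : sm1 a -> d1 (fun t => a (- t)) = fun t => - d1 a (- t).
Proof.
move=> sa; apply: d1_eq => x.
have dN : is_derive x 1 (fun t : R => - t) (- 1) by exact: is_deriveN.
have := is_derive1_comp (d1P (sm1_derivable (x := - x) sa)) dN.
by rewrite mulrN1.
Qed.

(** Left-invariant fields generate right translations, and [h k^-1] is unchanged when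
    both points are translated: the two derivatives cancel. *)
Lemma Kr_invariant j a b c h k : sm1 a -> sm1 b -> sm1 c ->
  cX j h * DKr j a b c h k + X j (Kr a b c h) k = 0.
Proof.
move=> sa sb sc.
have opp (f : R -> R) : sm1 f -> sm1 (fun t => f (- t)).
  by move=> sf; have := sm1_affine (-1) 0 sf; under eq_fun do rewrite mulN1r addr0.
rewrite XE (funext (Kr_sym a b c h)) -/(pd j _ k).
have -> := pd_Kr j h (opp _ sa) (opp _ sb) (opp _ sc).
rewrite /DKr !(d1_opp sa, d1_opp sb, d1_opp sc) /Kr.
have vE : vdiff k h = - vdiff h k by rewrite /vdiff opprB.
have xE : xdiff k h = - xdiff h k by rewrite /xdiff vE opprK; ring.
have yE : ydiff k h = - ydiff h k by rewrite /ydiff vE opprK; ring.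
rewrite xE yE vE !opprK /xdiff /ydiff /vdiff.
set w := h.2 - k.2.
have hz : h.2 = k.2 + w by rewrite /w addrC subrK.
have e1 : - w / 2 = - 2^-1 * w by ring.
have e2 : w / 2 = 2^-1 * w by ring.
have e3 : 2^-1 * - w = - 2^-1 * w by ring.
have e4 : - 2^-1 * - w = 2^-1 * w by ring.
rewrite e1 e2 e3 e4.
have x1 : expR h.2 * expR (- 2^-1 * w) = expR k.2 * expR (2^-1 * w).
  by rewrite -!expRD hz; congr expR; field.
have x2 : expR (- h.2) * expR (2^-1 * w) = expR (- k.2) * expR (- 2^-1 * w).
  by rewrite -!expRD hz; congr expR; field.
case: (ord3P j) => ->; rewrite /cX /= ?mulr1n ?mulr0n.
- move: (d1 a _) (d1 b _) (a _) (b _) (c w) (d1 c w) x1 => da db va vb vc dc.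
  move: (expR h.2) (expR k.2) (expR (- 2^-1 * w)) (expR (2^-1 * w)) => E1 E2 E3 E4 x1.
  transitivity ((E1 * E3 - E2 * E4) * (da * vb * vc)); first by ring.
  by rewrite x1 subrr mul0r.
- move: (d1 a _) (d1 b _) (a _) (b _) (c w) (d1 c w) x2 => da db va vb vc dc.
  move: (expR (- h.2)) (expR (- k.2)) (expR (- 2^-1 * w)) (expR (2^-1 * w)) => E1 E2 E3 E4 x2.
  transitivity ((E1 * E4 - E2 * E3) * (va * db * vc)); first by ring.
  by rewrite x2 subrr mul0r.
- move: (d1 a _) (d1 b _) (a _) (b _) (c w) (d1 c w) => da db va vb vc dc.
  by move: (expR (- 2^-1 * w)) (expR (2^-1 * w)) => E3 E4; field.
Qed.

(** Convolution commutes with the left-invariant fields: integrate by parts in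
    the second variable. *)
Lemma X_conv j a b c F : cs1 a -> cs1 b -> cs1 c -> Ccs F ->
  X j (kop (Kr a b c) F) = kop (Kr a b c) (X j F).
Proof.
move=> ca cb cc cF; apply/funext => h.
have lF := locint_Cc (Ccs_Cc cF); have cXF := Ccs_X j cF; have lXF := locint_Cc (Ccs_Cc cXF).
have gK := kgood_Kr N0 ca cb cc; have gD := kgood_DKr j ca cb cc.
have [sa _] := ca; have [sb _] := cb; have [sc _] := cc; have [sF _] := cF.
have sK := smooth_Kr2 h sa sb sc.
rewrite XE; have [_ ->] := is_derive_conv j h ca cb cc lF.
have jD := intble_kop h gD lF; have jK := intble_kop h gK lXF.
rewrite /kop -(rintZ _ jD).
apply/eqP; rewrite -subr_eq0 -(rintB (intbleZ _ jD) jK) -oppr_eq0 -rintN; last first.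
  exact: intbleB (intbleZ _ jD) jK.
apply/eqP; rewrite -(rint_X j (CcsMl sK cF)); congr rint; apply/funext => k.
rewrite (XM j sK sF) opprB mulrA.
have /eqP := Kr_invariant j h k sa sb sc; rewrite addrC addr_eq0 => /eqP ->.
by rewrite mulNr addrC.
Qed.

Lemma conv_bsupp a b c F : cs1 a -> cs1 b -> cs1 c -> bsupp F -> bsupp (kop (Kr a b c) F).
Proof.
move=> ca cb cc [M FM]; exists (suppK N M) => h nh.
rewrite /kop (_ : (fun k => _) = fun=> 0).
  by rewrite /rint /Rintegral integral0.
apply/funext => k; have [kM|kM] := pselect (inbox M k); last by rewrite FM// mulr0.
by rewrite Kr_sym (Kr_support N0 (cs1_opp ca) (cs1_opp cb) (cs1_opp cc) kM nh) mul0r.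
Qed.

Lemma Ccs_conv a b c F : cs1 a -> cs1 b -> cs1 c -> Ccs F -> Ccs (kop (Kr a b c) F).
Proof.
move=> ca cb cc cF; split; last by apply: conv_bsupp => //; case: cF.
by apply: smooth_conv => //; exact: (locint_Cc (Ccs_Cc cF)).
Qed.

End Convolution.

(** * Convolution on square-integrable functions *)

Lemma locint_cst1 (R : realType) : locint (fun _ : space3 R => 1).
Proof.
split; first exact: measurable_cst.
by move=> M; under eq_fun do rewrite mulr1; exact: intble_ind.
Qed.

Section Total_mass.
Variables (R : realType) (N : R).
Hypothesis N0 : 0 <= N.
Variables (a b c : R -> R).
Hypotheses (ca : cs1 N a) (cb : cs1 N b) (cc : cs1 N c).
Implicit Types (h k : space3 R) (u F : space3 R -> R) (j : 'I_3).
Local Notation K := (Kr a b c).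

Lemma cX_neq0 j h : cX j h != 0.
Proof.
by case: (ord3P j) => ->; rewrite /cX /= ?oner_eq0 ?gt_eqF ?expR_gt0.
Qed.

(** The total mass of the kernel does not depend on the base point: by
    invariance its derivative is the integral of a derivative. *)
Lemma kop1_cst h h' : kop K (fun=> 1) h = kop K (fun=> 1) h'.
Proof.
have d0 j p : is_derive p (axis R j) (kop K (fun=> 1)) 0.
  have [sa _] := ca; have [sb _] := cb; have [sc _] := cc.
  have := is_derive_conv N0 j p ca cb cc (locint_cst1 R).
  rewrite (_ : kop _ _ p = 0)//; apply: (mulfI (cX_neq0 j p)); rewrite mulr0.
  have jD := intble_kop p (kgood_DKr N0 j ca cb cc) (locint_cst1 R).
  have cK : Ccs (K p).
    split; first exact: smooth_Kr2.
    exists (suppK N (hnorm p)) => k; apply: (Kr_support N0 ca cb cc).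
    exact: inbox_hnorm.
  have jX := Ccs_intble (Ccs_X j cK).
  rewrite /kop -(rintZ _ jD) -[RHS]oppr0 -(rint_X j cK) -rintN//; congr rint.
  apply/funext => k; rewrite mulr1.
  by have /eqP := Kr_invariant j p k sa sb sc; rewrite addr_eq0 => /eqP.
have dd : pdable (kop K (fun=> 1)) by move=> j p; have [] := d0 j p.
have pd0 j : pd j (kop K (fun=> 1)) = fun=> 0.
  by apply/funext => p; have [_] := d0 j p.
case: h => -[x y] z; case: h' => -[x' y'] z'.
transitivity (kop K (fun=> 1) (x', y, z)).
  apply: (@is_derive_0_is_cst _ (fun t => kop K (fun=> 1) (t, y, z))) => t.
  by have := is_derive0 t y z dd; rewrite pd0.
transitivity (kop K (fun=> 1) (x', y', z)).
  apply: (@is_derive_0_is_cst _ (fun t => kop K (fun=> 1) (x', t, z))) => t.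
  by have := is_derive1 x' t z dd; rewrite pd0.
apply: (@is_derive_0_is_cst _ (fun t => kop K (fun=> 1) (x', y', t))) => t.
by have := is_derive2 x' y' t dd; rewrite pd0.
Qed.

End Total_mass.

Section Schur.
Variables (R : realType) (N : R).
Hypothesis N0 : 0 <= N.
Variables (a b c : R -> R).
Hypotheses (ca : cs1 N a) (cb : cs1 N b) (cc : cs1 N c).
Implicit Types (h k : space3 R) (u F : space3 R -> R).
Local Notation K := (Kr a b c).
Hypotheses (a0 : forall t, 0 <= a t) (b0 : forall t, 0 <= b t) (c0 : forall t, 0 <= c t).

Lemma Kr_ge0 h k : 0 <= K h k.
Proof. by rewrite /Kr !mulr_ge0. Qed.

(** Jensen's inequality for the finite measure with density [K h]: the integral of
    [(u - s)^2] is nonnegative for every constant [s]. The mass of the measure is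
    increased by one to exclude division by zero. *)
Lemma kop_sqr_le u h : locint u -> locint (fun k => u k ^+ 2) ->
  kop K u h ^+ 2 <= (kop K (fun=> 1) h + 1) * kop K (fun k => u k ^+ 2) h.
Proof.
move=> lu lu2; have g := kgood_Kr N0 ca cb cc.
have j0 := intble_kop h g (locint_cst1 R); have j1 := intble_kop h g lu; have j2 := intble_kop h g lu2.
set Q := kop K (fun k => u k ^+ 2) h; set T := kop K u h; set A := kop K (fun=> 1) h.
have A0 : 0 <= A by apply: rint_ge0 => k; rewrite mulr1; exact: Kr_ge0.
have key (s : R) : 0 <= Q + - 2 * s * T + s ^+ 2 * A.
  have -> : Q + - 2 * s * T + s ^+ 2 * A = rint (fun k => K h k * (u k - s) ^+ 2).
    rewrite /Q /T /A /kop -!rintZ// -!rintD//; last 3 first.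
    - by apply: intbleD => //; exact: intbleZ.
    - exact: intbleZ.
    - exact: intbleZ.
    by congr rint; apply/funext => k; ring.
  by apply: rint_ge0 => k; rewrite mulr_ge0 ?Kr_ge0 ?sqr_ge0.
have A1 : 0 < A + 1 by lra.
have := key (T / (A + 1)).
have -> : Q + - 2 * (T / (A + 1)) * T + (T / (A + 1)) ^+ 2 * A =
   ((A + 1) ^+ 2 * Q - (A + 2) * T ^+ 2) / (A + 1) ^+ 2.
  by field; rewrite gt_eqF.
rewrite pmulr_lge0 ?invr_gt0 ?exprn_gt0// subr_ge0 => H.
have Q0 : 0 <= Q by apply: rint_ge0 => k; rewrite mulr_ge0 ?Kr_ge0 ?sqr_ge0.
have T0 := sqr_ge0 T.
by rewrite -(ler_pM2l A1); nra.
Qed.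

(** Tonelli's theorem: integrating the kernel over its first variable gives the mass
    of the reflected kernel, which is finite and constant. *)
Lemma intble_kop_ge0 F : intble F -> (forall k, 0 <= F k) -> locint F -> intble (kop K F).
Proof.
move=> jF F0 lF; have gK := kgood_Kr N0 ca cb cc.
have gK' := kgood_Kr N0 (cs1_opp ca) (cs1_opp cb) (cs1_opp cc).
have mF := lF.1.
pose f (q : mspace3 R * mspace3 R) : \bar R := (K q.1 q.2 * F q.2)%:E.
have mf : measurable_fun [set: mspace3 R * mspace3 R] f.
  apply/measurable_EFinP; apply: measurable_funM; first by apply: measurable_Kr; [case: ca|case: cb|case: cc].
  by apply: (measurableT_comp mF); exact: measurable_snd.
have f0 q : (0 <= f q)%E by rewrite lee_fin mulr_ge0 ?Kr_ge0.
set K' := Kr (fun t => a (- t)) (fun t => b (- t)) (fun t => c (- t)).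
have E2 k : (\int[@leb3s R]_h f (h, k) = (kop K' (fun=> 1) (0, 0, 0) * F k)%:E)%E.
  have -> : kop K' (fun=> 1) (0, 0, 0) = kop K' (fun=> 1) k.
    exact: (kop1_cst N0 (cs1_opp ca) (cs1_opp cb) (cs1_opp cc)).
  rewrite EFinM (rintE (intble_kop k gK' (locint_cst1 R))) -integralZr//; last exact: (intble_kop k gK' (locint_cst1 R)).
  apply: eq_integral => h _; rewrite /f /= -EFinM -Kr_sym; congr EFin; ring.
have jf : ((@leb3s R \x @leb3s R)%E).-integrable setT f.
  apply/(integrable21ltyP _ _ mf).
  under eq_integral => k _.
    under eq_integral do rewrite gee0_abs//.
    rewrite E2; over.
  have /integrableP[_] := intbleZ (kop K' (fun=> 1) (0, 0, 0)) jF.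
  apply: le_lt_trans; apply: ge0_le_integral => //.
  - by move=> k _; rewrite -E2; apply: integral_ge0.
  - by apply/measurable_EFinP; apply: measurable_funM.
  - by apply: measurableT_comp => //; apply/measurable_EFinP; apply: measurable_funM.
  - by move=> k _; rewrite /= lee_fin ler_norm.
have := @integrable_fubini_F _ _ _ _ R (@leb3s R) (@leb3s R) f jf.
rewrite (_ : fubini_F (@leb3s R) f = EFin \o kop K F)//.
by apply/funext => h; rewrite /fubini_F /= (rintE (intble_kop h gK lF)).
Qed.

(** Schur's test: the square of the convolution is at most the mass of the kernel
    times the convolution of the square, and the latter is integrable. *)
Lemma intble_kop_sqr u : measurable_fun [set: mspace3 R] u -> intble (fun k => u k ^+ 2) ->
  intble (fun h => kop K u h ^+ 2).
Proof.
move=> mu ju; have lu := locint_sq mu ju.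
have lu2 : locint (fun k => u k ^+ 2).
  split; first exact: measurable_funX.
  move=> M; apply: (intble_le _ _ ju).
    by apply: measurable_funM; [exact: measurable_ind|exact: measurable_funX].
  move=> p; have u0 := sqr_ge0 (u p).
  by rewrite (ger0_norm (mulr_ge0 (ind_ge0 M p) u0)) ler_piMl ?ind_le1.
have mT : measurable_fun [set: mspace3 R] (kop K u).
  by apply: continuous_measurable3; apply: smooth_continuous; exact: (smooth_conv N0).
apply: (@intble_le _ _ (fun h => (kop K (fun=> 1) (0, 0, 0) + 1) * kop K (fun k => u k ^+ 2) h)).
- exact: measurable_funX.
- move=> h; rewrite ger0_norm ?sqr_ge0// (kop1_cst N0 ca cb cc (0, 0, 0) h); exact: kop_sqr_le.
- by apply: intbleZ; apply: intble_kop_ge0 => // k; exact: sqr_ge0.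
Qed.

End Schur.

(** * A function whose convolutions all vanish at the origin *)

Section Pi_systems.

(** A strip over a generating set is a countable union of rectangles, because the
    other factor is covered by countably many members of its family; rectangles are
    intersections of strips. *)
Lemma measurable_prod_generated d1 d2 (T1 : measurableType d1) (T2 : measurableType d2)
    (G1 : set (set T1)) (G2 : set (set T2)) (E1 : nat -> set T1) (E2 : nat -> set T2) :
  @measurable _ T1 = <<s G1>> -> @measurable _ T2 = <<s G2>> ->
  (forall n, G1 (E1 n)) -> (forall n, G2 (E2 n)) ->
  \bigcup_n E1 n = setT -> \bigcup_n E2 n = setT ->
  @measurable _ (T1 * T2)%type = <<s [set A `*` B | A in G1 & B in G2]>>.
Proof.
move=> g1 g2 GE1 GE2 U1 U2; set G := [set A `*` B | A in G1 & B in G2].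
have sG : sigma_algebra setT <<s G>> by exact: smallest_sigma_algebra.
have GG A B : G1 A -> G2 B -> <<s G>> (A `*` B).
  by move=> GA GB; apply: sub_sigma_algebra; exists A => //; exists B.
have bc (F : nat -> set (T1 * T2)) : (forall n, <<s G>> (F n)) -> <<s G>> (\bigcup_n F n).
  by case: sG => _ _; apply.
apply/seteqP; split; last first.
  apply: smallest_sub; first exact: sigma_algebra_measurable.
  by move=> _ [A GA [B GB <-]]; apply: measurableX; rewrite ?g1 ?g2; exact: sub_sigma_algebra.
rewrite measurable_prod_measurableType; apply: smallest_sub => // _ [A mA [B mB <-]].
have s1 : measurable A -> <<s G>> (A `*` setT).
  suff : @measurable _ T1 `<=` image_set_system setT fst <<s G>>.
    by move=> /(_ A) H /H; rewrite /image_set_system /= setTI -setXT.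
  rewrite g1; apply: smallest_sub; first exact: sigma_algebra_image.
  move=> C GC; rewrite /image_set_system /= setTI (_ : _ @^-1` _ = \bigcup_n (C `*` E2 n)).
    by apply: bc => n; exact: GG.
  by rewrite -setX_bigcupr U2 setXT.
have s2 : measurable B -> <<s G>> (setT `*` B).
  suff : @measurable _ T2 `<=` image_set_system setT snd <<s G>>.
    by move=> /(_ B) H /H; rewrite /image_set_system /= setTI -setTX.
  rewrite g2; apply: smallest_sub; first exact: sigma_algebra_image.
  move=> C GC; rewrite /image_set_system /= setTI (_ : _ @^-1` _ = \bigcup_n (E1 n `*` C)).
    by apply: bc => n; exact: GG.
  by rewrite -setX_bigcupl U1 setTX.
rewrite (_ : A `*` B = (A `*` setT) `&` (setT `*` B)); last first.
  by apply/seteqP; split=> [[x y] [/= ? ?]|[x y] [[/= ? _] [/= _ ?]]].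
have /sigma_algebraP[//|_ _ _] := sG; apply; [exact: s1|exact: s2].
Qed.

(** Dynkin's theorem: the sets over which [g] has integral zero form a lambda-system.
    The bijection [psi] allows a pi-system that is a product in other coordinates,
    without a change of variables in the integral. *)
Lemma ae0_of_pi_system d d' (T : measurableType d) (S : measurableType d') (R : realType)
    (mu : {measure set T -> \bar R}) (g : T -> \bar R) (psi : T -> S) (phi : S -> T)
    (G : set (set S)) :
  mu.-integrable setT g -> measurable_fun setT psi -> measurable_fun setT phi ->
  cancel psi phi -> @measurable _ S = <<s G>> -> setI_closed G ->
  (\int[mu]_x g x = 0)%E -> (forall A, G A -> (\int[mu]_(x in psi @^-1` A) g x = 0)%E) ->
  {ae mu, forall x, g x = 0%E}.
Proof.
move=> jg mpsi mphi K gS GI gT gA.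
have mp A : measurable A -> measurable (psi @^-1` A).
  by move=> mA; rewrite -[X in measurable X]setTI; exact: mpsi.
have H A : measurable A -> (\int[mu]_(x in psi @^-1` A) g x = 0)%E.
  rewrite gS; move: A; apply: (dynkin_induction (P := fun A => (\int[mu]_(x in psi @^-1` A) g x = 0)%E) gS GI) => //=.
  - move=> B mB B0; move: gT; rewrite -(setvU (psi @^-1` B)) integral_setU//.
    + by rewrite B0 adde0 preimage_setC.
    + by apply: measurableC; exact: mp.
    + exact: mp.
    + by rewrite setvU; have /integrableP[] := jg.
    + by apply/disj_setPLR.
  - move=> F mF tF F0; rewrite preimage_bigcup integral_bigcup//.
    + by rewrite eseries0// => n _ _; exact: F0.
    + apply/trivIsetP => i j _ _ ij; rewrite -preimage_setI.
      by move/trivIsetP : tF => /(_ _ _ _ _ ij) ->//; rewrite preimage_set0.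
    + by move=> k; exact: mp.
    + apply: integrableS jg => //; apply: bigcup_measurable => k _; exact: mp.
have : ae_eq mu setT g (fun=> 0%E).
  apply: integral_ae_eq => //.
  move=> E _ mE; rewrite integral0 -(H (phi @^-1` E)).
    by congr integral; apply/seteqP; split => x /=; rewrite K.
  by rewrite -[X in measurable X]setTI; exact: mphi.
by apply: filterS => x /(_ I).
Qed.

End Pi_systems.

Section Vanishing.
Variable R : realType.
Implicit Types (u : space3 R -> R) (p q : space3 R).

(** The coordinates of [Kr], as seen from the origin, and their inverse. *)
Definition twist (p : mspace3 R) : mspace3 R :=
  (xdiff (0, 0, 0) p, ydiff (0, 0, 0) p, vdiff (0, 0, 0) p).
Definition untwist (q : mspace3 R) : mspace3 R :=
  (- expR (- q.2 / 2) * q.1.1, - expR (q.2 / 2) * q.1.2, - q.2).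

Lemma twistK : cancel twist untwist.
Proof.
move=> [[x y] z]; rewrite /twist /untwist /xdiff /ydiff /vdiff /=.
rewrite !mulr0 !sub0r !opprK !mulrNN !mulrA -!expRD.
rewrite (_ : z / 2 + - z / 2 = 0); last by ring.
by rewrite (_ : - z / 2 + z / 2 = 0) ?expR0 ?mul1r//; ring.
Qed.

Lemma measurable_twist : measurable_fun setT twist.
Proof.
have sx : measurable_fun setT (xdiff (0, 0, 0) : mspace3 R -> measurableTypeR R).
  apply: continuous_measurable3; apply: smooth_continuous.
  rewrite (_ : xdiff _ = fun p => - xdiff p (0, 0, 0)).
    by apply: smoothN; exact: smooth_xdiff.
  by apply/funext => p; rewrite /xdiff /vdiff !opprB; ring.
have sy : measurable_fun setT (ydiff (0, 0, 0) : mspace3 R -> measurableTypeR R).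
  apply: continuous_measurable3; apply: smooth_continuous.
  rewrite (_ : ydiff _ = fun p => - ydiff p (0, 0, 0)).
    by apply: smoothN; exact: smooth_ydiff.
  by apply/funext => p; rewrite /ydiff /vdiff !opprB; ring.
have sz : measurable_fun setT (vdiff (0, 0, 0) : mspace3 R -> measurableTypeR R).
  by apply: measurable_funB => //; exact: measurable_cst.
by apply: measurable_fun_pair => //; exact: measurable_fun_pair.
Qed.

Lemma measurable_untwist : measurable_fun setT untwist.
Proof.
have me (s : R) : smooth (fun q : space3 R => expR (s * q.2)).
  by apply: (sm1_comp (sm1_expR R)); apply: smoothZ; exact: (@smooth_crd R k2).
have sx : measurable_fun setT (fun q : mspace3 R => - expR (- q.2 / 2) * q.1.1 : measurableTypeR R).
  apply: continuous_measurable3; apply: smooth_continuous; apply: smoothM; last exact: (@smooth_crd R k0).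
  apply: smoothN; under eq_fun do rewrite mulNr mulrC -mulNr; exact: me.
have sy : measurable_fun setT (fun q : mspace3 R => - expR (q.2 / 2) * q.1.2 : measurableTypeR R).
  apply: continuous_measurable3; apply: smooth_continuous; apply: smoothM; last exact: (@smooth_crd R k1).
  apply: smoothN; under eq_fun do rewrite mulrC; exact: me.
have sz : measurable_fun setT (fun q : mspace3 R => - q.2 : measurableTypeR R).
  by apply: measurableT_comp => //; exact: measurable_snd.
by apply: measurable_fun_pair => //; exact: measurable_fun_pair.
Qed.

Definition ocboxes2 : set (set (measurableTypeR R * measurableTypeR R)) :=
  [set A `*` B | A in @ocitv R & B in @ocitv R].
Definition ocboxes : set (set (mspace3 R)) := [set A `*` B | A in ocboxes2 & B in @ocitv R].

Definition ocube1 (n : nat) : set (measurableTypeR R) := `]- n%:R, n%:R]%classic.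
Definition ocube (n : nat) : set (mspace3 R) := ocube1 n `*` ocube1 n `*` ocube1 n.

Lemma ocube1_cover : \bigcup_n ocube1 n = setT.
Proof.
apply/seteqP; split => // x _; exists (Num.truncn `|x|).+1 => //.
have := truncnS_gt `|x|; set n := _%:R; rewrite ltr_norml => /andP[x1 x2].
by rewrite /ocube1 /= in_itv /= x1 ltW.
Qed.

Lemma ocboxes_generate : @measurable _ (mspace3 R) = <<s ocboxes>>.
Proof.
have i1 n : @ocitv R (ocube1 n) by exact: is_ocitv.
apply: (@measurable_prod_generated _ _ _ _ ocboxes2 (@ocitv R) (fun n => ocube1 n `*` ocube1 n) ocube1) => //.
- apply: (@measurable_prod_generated _ _ _ _ (@ocitv R) (@ocitv R) ocube1 ocube1) => //; exact: ocube1_cover.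
- by move=> n; exists (ocube1 n) => //; exists (ocube1 n).
- apply/seteqP; split => // -[x y] _.
  exists (Num.truncn (`|x| + `|y|)).+1 => //.
  have := truncnS_gt (`|x| + `|y|); set n := _%:R => xyn.
  have : `|x| < n by apply: le_lt_trans xyn; rewrite lerDl.
  have : `|y| < n by apply: le_lt_trans xyn; rewrite lerDr.
  rewrite !ltr_norml => /andP[y1 y2] /andP[x1 x2].
  by split; rewrite /ocube1 /= in_itv /= ?x1 ?y1 ltW.
- exact: ocube1_cover.
Qed.

Lemma setXI_closed (T1 T2 : Type) (G1 : set (set T1)) (G2 : set (set T2)) :
  setI_closed G1 -> setI_closed G2 -> setI_closed [set A `*` B | A in G1 & B in G2].
Proof.
move=> c1 c2 _ _ [A GA [B GB <-]] [C GC [D GD <-]].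
exists (A `&` C); first exact: c1.
exists (B `&` D); first exact: c2.
by apply/seteqP; split => -[x y] /= [[? ?] [? ?]].
Qed.

Lemma ocboxes_setI : setI_closed ocboxes.
Proof. by apply: setXI_closed; [apply: setXI_closed|]; exact: ocitvI. Qed.

(** The bumps converge to the indicator function of a twisted box, with a fixed
    compact support. *)
Lemma twisted_box_integral u (D : set (mspace3 R)) : locint u -> ocboxes D ->
  (forall N a b c, 0 <= N -> cs1 N a -> cs1 N b -> cs1 N c ->
    (forall t, 0 <= a t) -> (forall t, 0 <= b t) -> (forall t, 0 <= c t) ->
    kop (Kr a b c) u (0, 0, 0) = 0) ->
  intble (fun p => \1_D (twist p) * u p) /\ rint (fun p => \1_D (twist p) * u p) = 0.
Proof.
move=> lu [_ [_ [[s1 t1] _ <-] [_ [[s2 t2] _ <-] <-]] [_ [[s3 t3] _ <-] <-]] /= H.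
clear D; set D : set (mspace3 R) := _ `*` _.
pose N : R := `|s1| + `|t1| + `|s2| + `|t2| + `|s3| + `|t3| + 1.
have N0 : 0 <= N by rewrite /N !addr_ge0.
have cb (s t : R) n : `|s| + `|t| + 1 <= N -> cs1 N (ebump s t n.+1%:R).
  move=> stN; split; first exact: sm1_ebump.
  move=> x xN; apply: ebump_out; first by rewrite ler1n.
  move=> /andP[sx xt]; have := lt_le_trans (le_lt_trans stN xN) (lexx _).
  have := ler_norm t; have := ler_norm (- s); rewrite normrN.
  have := normr_ge0 s; have := normr_ge0 t.
  by have [x0|x0] := leP 0 x; rewrite ?(ger0_norm x0) ?(ltr0_norm x0); lra.
have n1 := normr_ge0 s1; have n2 := normr_ge0 t1; have n3 := normr_ge0 s2; have n4 := normr_ge0 t2.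
have n5 := normr_ge0 s3; have n6 := normr_ge0 t3.
have c1 n : cs1 N (ebump s1 t1 n.+1%:R) by apply: cb; rewrite /N; lra.
have c2 n : cs1 N (ebump s2 t2 n.+1%:R) by apply: cb; rewrite /N; lra.
have c3 n : cs1 N (ebump s3 t3 n.+1%:R) by apply: cb; rewrite /N; lra.
pose K n := Kr (ebump s1 t1 n.+1%:R) (ebump s2 t2 n.+1%:R) (ebump s3 t3 n.+1%:R) (0, 0, 0).
pose f_ n (p : mspace3 R) : \bar R := (K n p * u p)%:E.
pose f (p : mspace3 R) : \bar R := (\1_D (twist p) * u p)%:E.
pose g (p : mspace3 R) : \bar R := (`|ind (suppK N 0) p * u p|)%:E.
have mf : measurable_fun setT f.
  apply/measurable_EFinP; apply: measurable_funM; last exact: lu.1.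
  have mD : measurable_fun setT (\1_D : mspace3 R -> R).
    by apply: measurable_indic; apply: measurableX; [apply: measurableX|]; exact: measurable_itv.
  exact: (measurableT_comp mD measurable_twist).
have mf_ n : measurable_fun setT (f_ n).
  by apply: measurable_int; exact: (intble_kop _ (kgood_Kr N0 (c1 n) (c2 n) (c3 n)) lu).
have jg : (leb3 R).-integrable setT g by have /integrable_abse := lu.2 (suppK N 0).
have ff : {ae leb3 R, forall x, setT x -> f_ ^~ x @ \oo --> f x}.
  apply: aeW => p _; apply/fine_cvgP; split; first exact: nearW.
  apply: cvgM; last exact: cvg_cst.
  have -> : \1_D (twist p) = \1_(`]s1, t1]%classic) (xdiff (0, 0, 0) p) * \1_(`]s2, t2]%classic) (ydiff (0, 0, 0) p) *
      \1_(`]s3, t3]%classic) (vdiff (0, 0, 0) p) :> R.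
    rewrite !indicE -!natrM !mulnb; congr (_%:R); congr nat_of_bool.
    apply/idP/idP; rewrite !inE; first by move=> [[? ?] ?]; apply/andP; split; [apply/andP; split|]; rewrite inE.
    by move=> /andP[/andP[]]; rewrite !inE.
  by apply: cvgM; [apply: cvgM|]; exact: ebump_cvg.
have fg : {ae leb3 R, forall x n, setT x -> (`|f_ n x| <= g x)%E}.
  apply: aeW => p n _; rewrite /f_ /g lee_fin (normrM (K n p)) (normrM (ind _ p)); apply: ler_wpM2r => //.
  have [ip|ip] := pselect (inbox (suppK N 0) p); last first.
    rewrite /K (Kr_support N0 (c1 n) (c2 n) (c3 n) _ ip) ?normr0//.
    by split; rewrite /= normr0.
  have B s t y : 0 <= ebump s t n.+1%:R y <= 1 by rewrite ebump_ge0 ebump_le1.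
  have L (x y z : R) : 0 <= x <= 1 -> 0 <= y <= 1 -> 0 <= z <= 1 -> `|x * y * z| <= 1.
    move=> /andP[x0 x1] /andP[y0 y1] /andP[z0 z1].
    by rewrite ger0_norm ?mulr_ge0// mulr_ile1 ?mulr_ge0// mulr_ile1.
  by rewrite ind1// normr1; apply: L; exact: B.
have [jf _ cv] := dominated_convergence measurableT mf_ mf ff jg fg.
split => //; rewrite /rint /Rintegral.
suff -> : (\int[leb3 R]_p f p = 0)%E by [].
rewrite -(cvg_lim _ cv)//; apply: cvg_lim => //; apply: cvg_near_cst; apply: nearW => n.
apply: etrans (esym (rintE (intble_kop (0, 0, 0) (kgood_Kr N0 (c1 n) (c2 n) (c3 n)) lu))) _.
by congr EFin; apply: (H N) => //; move=> t; exact: ebump_ge0.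
Qed.

(** The integrals of [u] vanish over the preimages under [twist] of half-open boxes,
    which form a pi-system that generates the Borel sets. Since [u] is only locally
    integrable, the argument runs inside each of the sets [ocube n]. *)
Lemma conv_vanish u : locint u ->
  (forall N a b c, 0 <= N -> cs1 N a -> cs1 N b -> cs1 N c ->
    (forall t, 0 <= a t) -> (forall t, 0 <= b t) -> (forall t, 0 <= c t) ->
    kop (Kr a b c) u (0, 0, 0) = 0) ->
  {ae leb3 R, forall p, u p = 0}.
Proof.
move=> lu H.
have cub n : ocboxes (ocube n).
  exists (ocube1 n `*` ocube1 n); last by exists (ocube1 n) => //; exact: is_ocitv.
  by exists (ocube1 n); [|exists (ocube1 n)] => //; exact: is_ocitv.
have A n : {ae leb3 R, forall p, (\1_(ocube n) (twist p) * u p)%:E = 0%E}.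
  have [jn r0] := twisted_box_integral lu (cub n) H.
  apply: (ae0_of_pi_system jn measurable_twist measurable_untwist twistK ocboxes_generate ocboxes_setI).
    by rewrite -[RHS]/(0%:E) -r0 (rintE jn).
  move=> B GB; have GI := ocboxes_setI (cub n) GB.
  have [jI rI] := twisted_box_integral lu GI H.
  rewrite integral_mkcond -[RHS]/(0%:E) -rI (rintE jI); apply: eq_integral => p _.
  rewrite /patch indicI [(\1_(ocube n) \* _) _]/= [\1_B _]indicE.
  rewrite (_ : (p \in twist @^-1` B) = (twist p \in B)); last first.
    by apply/idP/idP; rewrite !inE.
  by case: ifP => _; rewrite ?mulr1 ?mulr0 ?mul0r.
have /ae_foralln : forall n, {ae leb3 R, forall p, (\1_(ocube n) (twist p) * u p)%:E = 0%E} := A.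
apply: filterS => p Hp.
have [n pn] : exists n, ocube n (twist p).
  pose M : R := hnorm (twist p); exists (Num.truncn M).+1.
  have := truncnS_gt M; set n := _%:R => Mn.
  have [] := @inbox_hnorm R (twist p) M (lexx _); case: (twist p) => -[x y] z /= xM yM zM.
  have aux (t : R) : `|t| <= M -> t \in `](- n), n].
    move=> tM; have : `|t| < n by exact: le_lt_trans Mn.
    by rewrite ltr_norml in_itv /= => /andP[-> /ltW].
  by split; [split|]; exact: aux.
by have [] := Hp n; rewrite indicE mem_set// mul1r.
Qed.

End Vanishing.

(** * Resolvent points *)

Section Limits.
Variable R : realType.
Implicit Types (f g h : cfun3 R) (u w : nat -> cfun3 R).

Lemma cvgN_sqnorm u f : (forall n, L2 (u n)) -> L2 f -> cvgN u f ->
  (fun n => sqnorm (u n)) @ \oo --> sqnorm f.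
Proof.
move=> lu lf uf; apply/cvgrPdist_le => e e0.
set F := sqnorm f; have F0 : 0 <= F by exact: sqnorm_ge0.
pose s := e / (2 * (1 + F)).
have s0 : 0 < s by rewrite divr_gt0// mulr_gt0// ltr_pwDl.
have sF : s * F <= e / 2.
  rewrite /s (_ : e / 2 = e / (2 * (1 + F)) * (1 + F)).
    by rewrite ler_pM2l// lerDr.
  by field; rewrite gt_eqF// ltr_pwDl.
have si : 0 < s^-1 + 1 by rewrite addr_gt0 ?invr_gt0.
pose t := e / 2 / (s^-1 + 1).
have t0 : 0 < t by rewrite divr_gt0// divr_gt0.
have tE : t * (s^-1 + 1) = e / 2 by rewrite /t divfK// gt_eqF.
have [N HN] := uf _ t0; exists N => // n /= /HN dn.
set d := fun p => u n p - f p; have ld : L2 d by exact: L2B.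
have -> : u n = fun p => f p + 1%:C * d p.
  by apply/funext => p; rewrite mul1r /d addrC subrK.
rewrite sqnormDZ// -/F mulr1 expr1n mul1r.
have := le_rip s0 lf ld; rewrite -/F; move: dn; rewrite -/d.
have := sqnorm_ge0 d; set D := sqnorm d => D0 Dt.
have : s^-1 * D + D <= e / 2 by rewrite -tE -[X in _ + X]mul1r -mulrDl mulrC ler_wpM2r// ltW.
set x := rip _ _; rewrite (ler_norml (2 * x)) => h1 /andP[h2 h3].
by rewrite ler_norml; apply/andP; split; lra.
Qed.

(** Norm estimates pass from the test functions to the closure of the graph. *)
Lemma le_cvgN u f w g (c : R) : (forall n, L2 (u n)) -> L2 f -> cvgN u f ->
  (forall n, L2 (w n)) -> L2 g -> cvgN w g ->
  (forall n, c * sqnorm (u n) <= sqnorm (w n)) -> c * sqnorm f <= sqnorm g.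
Proof.
move=> lu lf uf lw lg wg H.
have c1 := cvgN_sqnorm lu lf uf; have c2 := cvgN_sqnorm lw lg wg.
have c3 : (fun n => c * sqnorm (u n)) @ \oo --> c * sqnorm f by apply: cvgM => //; exact: cvg_cst.
rewrite -(cvg_lim _ c3)// -(cvg_lim _ c2)//; apply: ler_lim.
- by apply/cvg_ex; eexists; exact: c3.
- by apply/cvg_ex; eexists; exact: c2.
- exact: nearW.
Qed.

Lemma cvgNDZ u f w g (c : R[i]) : (forall n, L2 (u n)) -> L2 f -> cvgN u f ->
  (forall n, L2 (w n)) -> L2 g -> cvgN w g ->
  cvgN (fun n p => w n p + c * u n p) (fun p => g p + c * f p).
Proof.
move=> lu lf uf lw lg wg e e0.
set m := complex.Re c ^+ 2 + complex.Im c ^+ 2.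
have m0 : 0 <= m by rewrite addr_ge0 ?sqr_ge0.
have e4 : 0 < e / 4 by rewrite divr_gt0.
have em : 0 < e / 4 / (m + 1) by rewrite divr_gt0// ltr_wpDl.
have [N1 H1] := wg _ e4; have [N2 H2] := uf _ em.
exists (maxn N1 N2) => n; rewrite geq_max => /andP[n1 n2].
have l1 : L2 (fun p => w n p - g p) by exact: L2B.
have l2 : L2 (fun p => u n p - f p) by exact: L2B.
rewrite (_ : (fun p => _) = fun p => (w n p - g p) + c * (u n p - f p)); last first.
  by apply/funext => p; ring.
apply: le_trans (sqnormD l1 (L2Z c l2)) _; rewrite sqnormZ// -/m.
have := H1 n n1; have := H2 n n2.
set a := sqnorm _; set b := sqnorm _ => ha hb.
have : m * a <= e / 4.
  apply: le_trans (_ : (m + 1) * a <= _); first by rewrite ler_wpM2r ?sqnorm_ge0// lerDl.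
  by rewrite mulrC -ler_pdivlMr// ltr_wpDl.
lra.
Qed.

Lemma sqnorm0_ae f : L2 f -> sqnorm f = 0 -> eqL2 f (fun=> 0).
Proof.
move=> lf f0; have jf := intble_sqmod lf.
have mf : measurable_fun [set: mspace3 R] (fun p => (sqmod f p)%:E).
  by apply/measurable_EFinP; exact: measurable_intble.
have /(ae_eq_integral_abs (leb3 R) measurableT mf) : (\int[leb3 R]_p `|(sqmod f p)%:E| = 0)%E.
  under eq_integral do rewrite /= ger0_norm ?sqmod_ge0//.
  by rewrite -(rintE jf) -[rint _]/(sqnorm f) f0.
apply: filterS => p /(_ I) [] /eqP.
rewrite paddr_eq0 ?sqr_ge0// !sqrf_eq0 => /andP[/eqP r0 /eqP i0].
exact: complex_ext.
Qed.

Lemma eqL2_sub f g f' g' : (forall p, f p = g p -> f' p = g' p) -> eqL2 f g -> eqL2 f' g'.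
Proof. by move=> H [N [mN N0 sN]]; exists N; split => // p np; apply: sN => /= /H. Qed.

End Limits.

Section Quadratic_form.
Variables (R : realType) (Bx By B : R).
Hypothesis hB : B = Num.sqrt (Bx ^+ 2 + By ^+ 2).
Implicit Types (u v w f g h : cfun3 R).

Lemma P_DZ j (b t : R) u w : Tf u -> Tf w ->
  P j b (fun p => u p + t%:C * w p) = fun p => P j b u p + t%:C * P j b w p.
Proof.
move=> [[u1 _] [u2 _]] [[w1 _] [w2 _]].
have eI : (fun p => complex.Im (u p + t%:C * w p)) = fun p => complex.Im (u p) + t * complex.Im (w p).
  by apply/funext => p; rewrite cImD cImM /=; ring.
have eR : (fun p => complex.Re (u p + t%:C * w p)) = fun p => complex.Re (u p) + t * complex.Re (w p).
  by apply/funext => p; rewrite cReD cReM /=; ring.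
apply/funext => p; rewrite /P eI eR (XD j u1 (smoothZ t w1)) (XD j u2 (smoothZ t w2)) (XZ j t w1) (XZ j t w2).
move: (X j _ p) (X j _ p) (X j _ p) (X j _ p) => x1 x2 x3 x4.
case: (u p) (w p) => [a1 a2] [b1 b2].
by apply: complex_ext; rewrite ?(cReD, cImD, cReM, cImM) /=; ring.
Qed.

Lemma half_real : (2^-1 : R[i]) = (2^-1)%:C.
Proof. by rewrite fmorphV rmorph_nat. Qed.

Lemma rip_H u w : Tf u -> L2 w -> 2 * rip (H_Sol Bx By u) w =
  rip (P k0 Bx (P k0 Bx u)) w + rip (P k1 By (P k1 By u)) w + rip (P k2 0 (P k2 0 u)) w.
Proof.
move=> tu lw; rewrite (funext (H_SolE Bx By u)) half_real.
have t0 : Tf (P k0 Bx (P k0 Bx u)) by do 2!apply: Tf_P.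
have t1 : Tf (P k1 By (P k1 By u)) by do 2!apply: Tf_P.
have t2 : Tf (P k2 0 (P k2 0 u)) by do 2!apply: Tf_P.
rewrite ripZl//; last by apply: L2D; [apply: L2D|]; exact: Tf_L2.
rewrite mulrA divff// mul1r ripDl//; [|by apply: L2D; exact: Tf_L2|exact: Tf_L2].
by rewrite ripDl//; exact: Tf_L2.
Qed.

Lemma rip_mulI_self u : rip u (mulI u) = 0.
Proof.
rewrite /rip (_ : redot _ _ = fun=> 0) ?/Rintegral ?integral0//.
by apply/funext => p; rewrite /redot /mulI /=; ring.
Qed.

Lemma sqnorm_mulI u : sqnorm (mulI u) = sqnorm u.
Proof. by rewrite /sqnorm; congr Rintegral; apply/funext => p; rewrite /sqmod /mulI /=; ring. Qed.

Lemma rip_self u : rip u u = sqnorm u.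
Proof. by rewrite /rip /sqnorm; congr Rintegral; apply/funext => p; rewrite /redot /sqmod; ring. Qed.

Lemma form_H u : Tf u -> 2 * rip (H_Sol Bx By u) u =
  sqnorm (P k0 Bx u) + sqnorm (P k1 By u) + sqnorm (P k2 0 u).
Proof.
move=> tu; have su := Tf_smC tu; rewrite (rip_H tu (Tf_L2 tu)).
rewrite (P_sym _ _ (Tf_P _ _ tu) su) (P_sym _ _ (Tf_P _ _ tu) su) (P_sym _ _ (Tf_P _ _ tu) su).
by rewrite !rip_self.
Qed.

Lemma form_H_im u : Tf u -> rip (H_Sol Bx By u) (mulI u) = 0.
Proof.
move=> tu; have su := Tf_smC tu; have si := smC_mulI su.
apply: (@mulfI _ 2) => //; rewrite mulr0 (rip_H tu (Tf_L2 (Tf_mulI tu))).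
rewrite (P_sym _ _ (Tf_P _ _ tu) si) (P_sym _ _ (Tf_P _ _ tu) si) (P_sym _ _ (Tf_P _ _ tu) si).
by rewrite !P_mulI// !rip_mulI_self !addr0.
Qed.

Variables (zeta : R[i]).

Definition H_shift u : cfun3 R := fun p => H_Sol Bx By u p - zeta * u p.
Local Notation A := H_shift.

Lemma Tf_H_shift u : Tf u -> Tf (A u).
Proof. by move=> tu; apply: TfB; [exact: Tf_H|exact: TfZ]. Qed.

Lemma rip_zeta u : L2 u -> rip (fun p => zeta * u p) u = complex.Re zeta * sqnorm u.
Proof.
move=> lu; rewrite /rip /sqnorm -!/(rint _) -rintZ; last exact: intble_sqmod.
by congr rint; apply/funext => p; rewrite /redot /sqmod cReM cImM; ring.
Qed.
Lemma rip_zeta_im u : L2 u -> rip (fun p => zeta * u p) (mulI u) = complex.Im zeta * sqnorm u.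
Proof.
move=> lu; rewrite /rip /sqnorm -!/(rint _) -rintZ; last exact: intble_sqmod.
by congr rint; apply/funext => p; rewrite /redot /sqmod /mulI cReM cImM /=; ring.
Qed.

(* The distance of [zeta] to the half-line from [bottom B] is controlled by its real
   part on the left of that point and by its imaginary part elsewhere. *)
Variable delta : R.
Hypothesis delta0 : 0 < delta.
Hypothesis gap : delta <= bottom B - complex.Re zeta \/ delta <= `|complex.Im zeta|.

Lemma energy_bound u : Tf u -> bottom B * sqnorm u <= rip (H_Sol Bx By u) u.
Proof.
by move=> tu; have := energy_lower_bound hB tu; have := form_H tu; lra.
Qed.

(** Pair [(H - zeta) u] with [u] in the first case, where the form is at least
    [bottom B], and with [i u] in the second, where the form of [H] is real. *)
Lemma H_shift_bounded_below u : Tf u -> delta ^+ 2 * sqnorm u <= sqnorm (A u).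
Proof.
move=> tu; have lu := Tf_L2 tu; have lA := Tf_L2 (Tf_H_shift tu).
have lH := Tf_L2 (Tf_H Bx By tu); have lz := L2Z zeta lu.
have di : 0 < delta^-1 by rewrite invr_gt0.
have key w : L2 w -> sqnorm w = sqnorm u -> delta * sqnorm u <= `|rip (A u) w| ->
    delta ^+ 2 * sqnorm u <= sqnorm (A u).
  move=> lw wu H; have := le_rip di lA lw; rewrite invrK wu normrM ger0_norm// => H2.
  have : delta * sqnorm u <= delta^-1 * sqnorm (A u) by lra.
  rewrite -(ler_pM2l delta0) mulrA -expr2 => H3; apply: le_trans H3 _.
  by rewrite mulrA divff ?mul1r// gt_eqF.
have n0 := sqnorm_ge0 u.
case: gap => g.
  apply: (key u) => //; apply: le_trans (ler_norm _).
  rewrite /A ripBl// rip_zeta//; have := energy_bound tu.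
  have := ler_wpM2r n0 g; lra.
apply: (key (mulI u)); [exact: Tf_L2 (Tf_mulI tu)|exact: sqnorm_mulI|].
have li := Tf_L2 (Tf_mulI tu).
rewrite /A ripBl// rip_zeta_im// form_H_im// sub0r normrN normrM (ger0_norm n0).
exact: ler_wpM2r.
Qed.

Local Notation G := (closure_graph (@test_fun R) (H_Sol Bx By)).

Lemma graph_bounded_below f g : G (f, g) ->
  delta ^+ 2 * sqnorm f <= sqnorm (fun p => g p - zeta * f p).
Proof.
move=> [/= lf lg [u [tu uf ug]]].
have tfu n : Tf (u n) by exact/test_funP.
have lu n : L2 (u n) by exact: Tf_L2.
have lH n : L2 (H_Sol Bx By (u n)) by apply: Tf_L2; exact: Tf_H.
have /(cvgL2P lu lf) cu := uf; have /(cvgL2P lH lg) cH := ug.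
have lA n : L2 (A (u n)) by apply: Tf_L2; exact: Tf_H_shift.
apply: (@le_cvgN _ u f (fun n => A (u n))) => //.
- by apply: L2B => //; exact: L2Z.
- have := cvgNDZ (- zeta) lu lf cu lH lg cH.
  rewrite (_ : (fun p => g p + _) = fun p => g p - zeta * f p); last first.
    by apply/funext => p; rewrite mulNr.
  by rewrite (_ : (fun n p => _) = fun n => A (u n))//; apply/funext => n; apply/funext => p; rewrite mulNr.
- by move=> n; exact: H_shift_bounded_below.
Qed.

(** The range is closed by the bound from below; it is dense as soon as nothing
    but zero is orthogonal to it. *)
Lemma resolvent_criterion :
  (forall k, L2 k -> (forall u, Tf u -> rip k (A u) = 0) -> eqL2 k (fun=> 0)) ->
  resolvent_set G zeta.
Proof.
move=> dense; split.
- move=> h lh.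
  pose V : set (cfun3 R) := [set w | exists2 u, Tf u & w = A u].
  have V0 : V (fun=> 0).
    have T0 : Tf (fun=> 0 : R[i]) by split; exact: Ccs0.
    exists (fun=> 0) => //; apply/funext => p; rewrite /A H_SolE.
    have PE j (b : R) : P j b (fun=> 0) = fun=> 0.
      have s0 := @smooth_cst R 0.
      have X0 : X j (fun=> 0 : R) = fun=> 0.
        by apply/funext => q; have := XZ j 0 s0; rewrite mul0r => ->; rewrite mul0r.
      by apply/funext => q; apply: complex_ext; rewrite /P /= X0; ring.
    by rewrite !PE !addr0 !mulr0 subr0.
  have VL w : V w -> L2 w by move=> [u tu ->]; apply: Tf_L2; exact: Tf_H_shift.
  have AD u w (t : R) : Tf u -> Tf w -> A (fun p => u p + t%:C * w p) = fun p => A u p + t%:C * A w p.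
    move=> tu tw; apply/funext => p; rewrite /A !H_SolE.
    by rewrite !P_DZ//; [move: (P k0 _ _ p) (P k0 _ _ p) (P k1 _ _ p) (P k1 _ _ p) (P k2 _ _ p) (P k2 _ _ p) (u p) (w p) => *; ring|exact: Tf_P..].
  have VD w w' (t : R) : V w -> V w' -> V (fun p => w p + t%:C * w' p).
    move=> [u tu ->] [u' tu' ->]; exists (fun p => u p + t%:C * u' p); last by rewrite AD.
    by apply: TfD => //; exact: TfZ.
  (* the remainder [k] of the projection is orthogonal to the range, hence zero, so
     that [h] is a limit of elements of the range *)
  have [v [k [Vv lk vk orth]]] := projection lh VL V0 VD.
  have k0 : eqL2 k (fun=> 0) by apply: dense => // u tu; apply: orth; exists u.
  have /choice[u uP] : forall n, exists u, Tf u /\ v n = A u.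
    by move=> n; have [u tu ->] := Vv n; exists u.
  have tu n := (uP n).1; have vE n := (uP n).2.
  have lu n : L2 (u n) by exact: Tf_L2.
  have lv n : L2 (v n) by apply: VL.
  have lhk : L2 (fun p => h p - k p) by exact: L2B.
  have AB n m : A (fun p => u n p - u m p) = fun p => v n p - v m p.
    have := AD (u n) (u m) (-1) (tu n) (tu m).
    rewrite !vE (_ : (-1)%:C = -1 :> R[i]); last by rewrite rmorphN.
    by under eq_fun do rewrite mulN1r; move=> ->; apply/funext => p; rewrite mulN1r.
  have [f lf uf] : exists2 f, L2 f & cvgN u f.
    apply: L2_complete => // e e0.
    have d2 : 0 < delta ^+ 2 by rewrite exprn_gt0.
    have e4 : 0 < delta ^+ 2 * e / 4 by rewrite divr_gt0// mulr_gt0.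
    have [N HN] := vk _ e4; exists N => n m Nn Nm.
    rewrite -(ler_pM2l d2); apply: le_trans (H_shift_bounded_below (TfB (tu n) (tu m))) _.
    rewrite AB; apply: le_trans (sqnorm_tri (lv n) lhk (lv m)) _.
    have := HN n Nn; have := HN m Nm; rewrite (sqnorm_opp _ (v m)); lra.
  exists f, (fun p => (h p - k p) + zeta * f p); split.
    split => /=; [exact: lf|by apply: L2D => //; exact: L2Z|].
    have HE n : H_Sol Bx By (u n) = fun p => v n p + zeta * u n p.
      by apply/funext => p; rewrite vE /A subrK.
    exists u; split; first by move=> n; exact: (test_funP (u n)).2 (tu n).
      exact/(cvgL2P lu lf).
    apply/(cvgL2P _ _).
    - by move=> n; apply: Tf_L2; exact: Tf_H.
    - by apply: L2D => //; exact: L2Z.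
    - by rewrite (funext HE); exact: cvgNDZ.
  apply: (eqL2_sub _ k0) => p ->.
  by move: (h p) (zeta * f p) => x y; ring.
- move=> f g Gfg H; have lf : L2 f by case: Gfg.
  have lg : L2 g by case: Gfg.
  apply: sqnorm0_ae => //; have := graph_bounded_below Gfg.
  have -> : sqnorm (fun p => g p - zeta * f p) = 0.
    rewrite /sqnorm /Rintegral; rewrite (ae_eq_integral (fun=> 0%E))//.
    + by rewrite integral0.
    + by apply/measurable_EFinP; apply: measurable_intble; apply: intble_sqmod; apply: L2B => //; exact: L2Z.
    + have [N [mN N0 sN]] := H; exists N; split => // p np; apply: sN => /= Hp; apply: np => _.
      by rewrite /sqmod Hp /= expr0n addr0.
  have d2 : 0 < delta ^+ 2 by rewrite exprn_gt0.
  by rewrite pmulr_rle0// => H0; apply/eqP; rewrite eq_le H0 sqnorm_ge0.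
- exists delta^-1 => f g Gfg; have lf : L2 f by case: Gfg.
  have lg : L2 g by case: Gfg.
  have lB : L2 (fun p => g p - zeta * f p) by apply: L2B => //; exact: L2Z.
  rewrite (normL2_sqnorm lf) (normL2_sqnorm lB) -EFinM lee_fin.
  rewrite ler_pdivlMl//; have := graph_bounded_below Gfg.
  move=> /ler_wsqrtr; rewrite sqrtrM ?sqr_ge0// sqrtr_sqr (gtr0_norm delta0).
  exact.
Qed.

End Quadratic_form.

(** * Nothing but zero is orthogonal to the range *)

Lemma CcsMr (R : realType) (f g : space3 R -> R) : Ccs f -> smooth g -> Ccs (fun p => f p * g p).
Proof. by move=> cf sg; rewrite (_ : (fun p => _) = fun p => g p * f p); [exact: CcsMl|apply/funext => p; rewrite mulrC]. Qed.

Section Complex_convolution.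
Variables (R : realType) (N : R).
Hypothesis N0 : 0 <= N.
Variables (a b c : R -> R).
Hypotheses (ca : cs1 N a) (cb : cs1 N b) (cc : cs1 N c).
Implicit Types (u v w k : cfun3 R) (F : space3 R -> R) (j : 'I_3).
Local Notation K := (Kr a b c).

Definition kopC (Phi : space3 R -> space3 R -> R) u : cfun3 R := fun p =>
  kop Phi (fun q => complex.Re (u q)) p +i* kop Phi (fun q => complex.Im (u q)) p.

Lemma kop_linear Phi F G (r s : R) h : kgood Phi -> locint F -> locint G ->
  kop Phi (fun p => r * F p + s * G p) h = r * kop Phi F h + s * kop Phi G h.
Proof.
move=> gP lF lG; have jF := intble_kop h gP lF; have jG := intble_kop h gP lG.
rewrite /kop -(rintZ r jF) -(rintZ s jG) -rintD; [|exact: intbleZ..].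
by congr rint; apply/funext => k; ring.
Qed.

Lemma Ccs_locint F : Ccs F -> locint F.
Proof. by move=> cF; apply: locint_Cc; exact: Ccs_Cc. Qed.

Lemma Tf_kopC u : Tf u -> Tf (kopC K u).
Proof. by move=> [u1 u2]; split; exact: (Ccs_conv N0 ca cb cc). Qed.

Lemma kopC_P j (B : R) u : Tf u -> kopC K (P j B u) = P j B (kopC K u).
Proof.
move=> [u1 u2]; have g := kgood_Kr N0 ca cb cc; apply/funext => p.
have l1 := Ccs_locint u1; have l2 := Ccs_locint u2.
have x1 := Ccs_locint (Ccs_X j u1); have x2 := Ccs_locint (Ccs_X j u2).
have e1 := X_conv N0 j ca cb cc u1; have e2 := X_conv N0 j ca cb cc u2.
apply: complex_ext; rewrite /kopC /P /= ?e1 ?e2.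
- rewrite -[X in _ = X + _]mul1r -(kop_linear 1 B p g x2 l1); congr (kop K _ p).
  by apply/funext => q; rewrite mul1r.
- rewrite -[X in _ = X + _]mulN1r -(kop_linear (-1) B p g x1 l2); congr (kop K _ p).
  by apply/funext => q; rewrite mulN1r.
Qed.

Lemma kopCD u v : Tf u -> Tf v -> kopC K (fun p => u p + v p) = fun p => kopC K u p + kopC K v p.
Proof.
move=> [u1 u2] [v1 v2]; have g := kgood_Kr N0 ca cb cc; apply/funext => p.
apply: complex_ext; rewrite ?cReD ?cImD /kopC /=.
- rewrite -[X in _ = X + _]mul1r -[X in _ = _ + X]mul1r -(kop_linear 1 1 p g (Ccs_locint u1) (Ccs_locint v1)).
  by congr (kop K _ p); apply/funext => q; rewrite cReD !mul1r.
- rewrite -[X in _ = X + _]mul1r -[X in _ = _ + X]mul1r -(kop_linear 1 1 p g (Ccs_locint u2) (Ccs_locint v2)).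
  by congr (kop K _ p); apply/funext => q; rewrite cImD !mul1r.
Qed.

Lemma kopCZ u (r : R[i]) : Tf u -> kopC K (fun p => r * u p) = fun p => r * kopC K u p.
Proof.
move=> [u1 u2]; have g := kgood_Kr N0 ca cb cc; apply/funext => p.
apply: complex_ext; rewrite ?cReM ?cImM /kopC /=.
- rewrite -mulNr -(kop_linear _ _ p g (Ccs_locint u1) (Ccs_locint u2)).
  by congr (kop K _ p); apply/funext => q; rewrite cReM mulNr.
- rewrite -(kop_linear _ _ p g (Ccs_locint u2) (Ccs_locint u1)).
  by congr (kop K _ p); apply/funext => q; rewrite cImM.
Qed.

(** [H] is a polynomial in the left-invariant fields, with which convolution
    commutes. *)
Lemma kopC_H_shift (Bx By : R) (zeta : R[i]) u : Tf u -> kopC K (H_shift Bx By zeta u) = H_shift Bx By zeta (kopC K u).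
Proof.
move=> tu; have t0 : Tf (P k0 Bx (P k0 Bx u)) by do 2!apply: Tf_P.
have t1 : Tf (P k1 By (P k1 By u)) by do 2!apply: Tf_P.
have t2 : Tf (P k2 0 (P k2 0 u)) by do 2!apply: Tf_P.
rewrite (_ : H_shift Bx By zeta u = fun p => H_Sol Bx By u p + (- zeta) * u p); last first.
  by apply/funext => p; rewrite mulNr.
rewrite (kopCD (Tf_H Bx By tu) (TfZ (- zeta) tu)) (kopCZ _ tu) (funext (H_SolE Bx By u)).
rewrite (kopCZ 2^-1 (TfD (TfD t0 t1) t2)) (kopCD (TfD t0 t1) t2) (kopCD t0 t1).
rewrite !kopC_P//; [|exact: Tf_P..].
by apply/funext => p; rewrite /H_shift H_SolE mulNr.
Qed.

Lemma intble_mul_sq (F G : space3 R -> R) : measurable_fun [set: mspace3 R] F -> measurable_fun [set: mspace3 R] G ->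
  intble (fun p => F p ^+ 2) -> intble (fun p => G p ^+ 2) -> intble (fun p => F p * G p).
Proof.
move=> mF mG jF jG; apply: (intble_le _ _ (intbleD jF jG)); first exact: measurable_funM.
move=> p; rewrite normrM -(real_normK (num_real (F p))) -(real_normK (num_real (G p))).
have := normr_ge0 (F p); have := normr_ge0 (G p); move: `|F p| `|G p| => x y *; nra.
Qed.

Hypotheses (a0 : forall t, 0 <= a t) (b0 : forall t, 0 <= b t) (c0 : forall t, 0 <= c t).

Lemma sq_parts k : L2 k -> [/\ measurable_fun [set: mspace3 R] (fun p => complex.Re (k p)),
   measurable_fun [set: mspace3 R] (fun p => complex.Im (k p)),
   intble (fun p => complex.Re (k p) ^+ 2) & intble (fun p => complex.Im (k p) ^+ 2)].
Proof.
move=> /L2P[[m1 m2] jk]; split => //.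
- apply: (intble_le _ _ jk); first exact: measurable_funX.
  by move=> p; rewrite ger0_norm ?sqr_ge0// /sqmod lerDl sqr_ge0.
- apply: (intble_le _ _ jk); first exact: measurable_funX.
  by move=> p; rewrite ger0_norm ?sqr_ge0// /sqmod lerDr sqr_ge0.
Qed.

(** Elliptic regularity is replaced by convolution, which turns a square-integrable
    function into a smooth one. *)
Lemma kopC_L2 k : L2 k -> smC (kopC K k) /\ L2 (kopC K k).
Proof.
move=> lk; have [m1 m2 j1 j2] := sq_parts lk.
have s : smC (kopC K k).
  by split; apply: (smooth_conv N0 ca cb cc); exact: locint_sq.
split => //; apply/L2P; split; first exact: smC_cmeasurable.
by apply: intbleD; apply: (intble_kop_sqr N0 ca cb cc).
Qed.

End Complex_convolution.

Section Orthogonal.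
Variables (R : realType) (Bx By B : R).
Hypothesis hB : B = Num.sqrt (Bx ^+ 2 + By ^+ 2).
Variables (zeta : R[i]) (delta : R).
Hypothesis delta0 : 0 < delta.
Hypothesis gap : delta <= bottom B - complex.Re zeta \/ delta <= `|complex.Im zeta|.
Implicit Types (u v w k : cfun3 R) (F : space3 R -> R) (j : 'I_3).
Local Notation A := (H_shift Bx By zeta).

(** Moved to the test function, the convolution yields [H - zeta] of another test
    function. *)
Lemma kopC_orth (N : R) (a b c : R -> R) k : 0 <= N -> cs1 N a -> cs1 N b -> cs1 N c ->
  L2 k -> (forall u, Tf u -> rip k (A u) = 0) ->
  forall u, Tf u -> rip (A u) (kopC (Kr a b c) k) = 0.
Proof.
move=> N0 ca cb cc lk orth u tu.
have ca' := cs1_opp ca; have cb' := cs1_opp cb; have cc' := cs1_opp cc.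
have [m1 m2 j1 j2] := sq_parts lk; have [w1 w2] := Tf_H_shift Bx By zeta tu.
have s1 := smooth_conv N0 ca cb cc (locint_sq m1 j1); have s2 := smooth_conv N0 ca cb cc (locint_sq m2 j2).
set K' := Kr (fun t => a (- t)) (fun t => b (- t)) (fun t => c (- t)).
have tT := Tf_kopC N0 ca' cb' cc' tu; have [T1 T2] := Tf_H_shift Bx By zeta tT.
have L (F G : space3 R -> R) : Ccs F -> measurable_fun [set: mspace3 R] G -> intble (fun p => G p ^+ 2) -> intble (fun p => F p * G p).
  move=> cF mG jG; apply: intble_mul_sq => //.
    by apply: continuous_measurable3; apply: smooth_continuous; case: cF.
  by apply: Ccs_intble; apply: (CcsMl (f := F)) => //; case: cF.
have E : rip k (A (kopC K' u)) = 0 by exact: orth.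
rewrite -[RHS]E rip_sym /rip /redot /= -!/(rint _).
rewrite -(kopC_H_shift N0 ca' cb' cc' Bx By zeta tu) /kopC /=.
have e1 := conv_sym N0 ca cb cc (locint_sq m1 j1) (Ccs_Cc w1).
have e2 := conv_sym N0 ca cb cc (locint_sq m2 j2) (Ccs_Cc w2).
have c1 : intble (fun p => complex.Re (A u p) * kop (Kr a b c) (fun q => complex.Re (k q)) p).
  exact: Ccs_intble (CcsMr w1 s1).
have c2 : intble (fun p => complex.Im (A u p) * kop (Kr a b c) (fun q => complex.Im (k q)) p).
  exact: Ccs_intble (CcsMr w2 s2).
have d1 := L _ _ (Ccs_conv N0 ca' cb' cc' w1) m1 j1; have d2 := L _ _ (Ccs_conv N0 ca' cb' cc' w2) m2 j2.
transitivity (rint (fun p => complex.Re (A u p) * kop (Kr a b c) (fun q => complex.Re (k q)) p) +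
  rint (fun p => complex.Im (A u p) * kop (Kr a b c) (fun q => complex.Im (k q)) p)).
  by rewrite -rintD//; congr rint; apply/funext => p; ring.
rewrite e1 e2 -rintD//; congr rint; apply/funext => p; ring.
Qed.

Lemma mulIE u : mulI u = fun p => 'i * u p.
Proof. by apply/funext => p; rewrite /mulI; case: (u p) => x y; apply: complex_ext; rewrite ?cReM ?cImM /=; ring. Qed.

Lemma L2_mulI u : L2 u -> L2 (mulI u).
Proof. by move=> lu; rewrite mulIE; exact: L2Z. Qed.

Lemma H_shift_mulI u : smC u -> A (mulI u) = mulI (A u).
Proof.
move=> su; apply/funext => p; rewrite (mulIE (A u)) /A !H_SolE.
rewrite !(P_mulI _ _ su) !P_mulI; [|exact: smC_P..].
rewrite !mulIE; move: (P _ _ _ p) (P _ _ _ p) (P _ _ _ p) (u p) => x y z t; ring.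
Qed.

Lemma rip_mulI u v : L2 u -> L2 v -> rip (mulI u) v = - rip u (mulI v).
Proof.
move=> lu lv; have j := intble_redot lu (L2_mulI lv).
rewrite /rip -!/(rint _) -(rintN j); congr rint; apply/funext => p.
by rewrite /redot /mulI /=; ring.
Qed.

Lemma redot_zeta_cut chi v p : redot (fun q => zeta * cut chi (cut chi v) q) v p =
  complex.Re zeta * sqmod (cut chi v) p.
Proof.
rewrite /redot /sqmod /cut; move: (v p) (chi p) zeta => [x y] c [z1 z2].
by rewrite !(cReM, cImM) /=; ring.
Qed.
Lemma redot_zeta_cut_im chi v p : redot (fun q => zeta * cut chi (cut chi v) q) (mulI v) p =
  complex.Im zeta * sqmod (cut chi v) p.
Proof.
rewrite /redot /sqmod /cut /mulI; move: (v p) (chi p) zeta => [x y] c [z1 z2].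
by rewrite !(cReM, cImM) /=; ring.
Qed.

(** The arithmetic of [cutoff_bound]: [W] stands for [|chi v|^2], and [p_j], [e_j], [r_j]
    for [|P_j chi v|^2], [|(X_j chi) v|^2] and the product of the two functions. In the
    first case the energy bound absorbs [Re zeta]; in the second the products are
    absorbed with the small weight [s], which may depend on [zeta]. *)
Lemma cutoff_algebra (s W e0 e1 e2 p0 p1 p2 r0 r1 r2 : R) :
  0 < s -> s * complex.Re zeta <= delta / 2 -> 2 * bottom B * W <= p2 + (p0 + p1) ->
  0 <= W -> 0 <= e0 -> 0 <= e1 -> 0 <= e2 ->
  `|2 * r0| <= s * p0 + s^-1 * e0 -> `|2 * r1| <= s * p1 + s^-1 * e1 ->
  `|2 * r2| <= s * p2 + s^-1 * e2 ->
  2 * (complex.Re zeta * W) = (p0 - e0) + (p1 - e1) + (p2 - e2) ->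
  2 * (complex.Im zeta * W) = - 2 * (r0 + r1 + r2) ->
  W <= (1 + s + s^-1) / delta * (e0 + e1 + e2).
Proof.
move=> s0 srz EB W0 E0 E1 E2 b0 b1 b2 h1 h2.
have si : 0 < s^-1 by rewrite invr_gt0.
have sE : 0 <= (s + s^-1) * (e0 + e1 + e2).
  by apply: mulr_ge0; [apply: addr_ge0; exact: ltW|rewrite !addr_ge0].
rewrite mulrAC ler_pdivlMr//.
have H : W * delta = delta * W by rewrite mulrC.
case: gap => g.
  have := ler_wpM2r W0 g; move: sE; rewrite H !mulrDl mulNr mul1r; lra.
have gW := ler_wpM2r W0 g.
have aI : `|complex.Im zeta| * W <= `|r0 + r1 + r2|.
  have <- : `|complex.Im zeta * W| = `|complex.Im zeta| * W by rewrite normrM (ger0_norm W0).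
  have -> : complex.Im zeta * W = - (r0 + r1 + r2) by lra.
  by rewrite normrN.
have tri : 2 * `|r0 + r1 + r2| <= `|2 * r0| + `|2 * r1| + `|2 * r2|.
  rewrite !normrM (ger0_norm (ler0n R 2)) -!mulrDr ler_pM2l//.
  by apply: le_trans (ler_normD _ _) _; rewrite lerD2r; exact: ler_normD.
have sW := ler_wpM2r W0 srz.
have sS : s * (p0 + p1 + p2) = 2 * (s * complex.Re zeta * W) + s * (e0 + e1 + e2).
  by rewrite (_ : p0 + p1 + p2 = 2 * (complex.Re zeta * W) + (e0 + e1 + e2)); [ring|lra].
move: sS sE; rewrite H !mulrDl !mulrDr mul1r.
move: (s^-1) si b0 b1 b2 => t si b0 b1 b2 sS sE.
lra.
Qed.

(** A Caccioppoli inequality: test orthogonality against [chi^2 v] and [i chi^2 v].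
    The commutators with [chi] leave only terms in which [chi] is differentiated. *)
Lemma cutoff_bound : exists2 C : R, 0 <= C & forall v chi, smC v -> L2 v ->
  (forall u, Tf u -> rip (A u) v = 0) -> Ccs chi ->
  sqnorm (cut chi v) <= C * (sqnorm (cut (X k0 chi) v) + sqnorm (cut (X k1 chi) v) +
    sqnorm (cut (X k2 chi) v)).
Proof.
set rz := complex.Re zeta; pose s := delta / (2 * (`|rz| + 1)).
have r1 : 0 < 2 * (`|rz| + 1) by rewrite mulr_gt0// ltr_wpDl.
have s0 : 0 < s by rewrite divr_gt0.
have si : 0 < s^-1 by rewrite invr_gt0.
have srz : s * rz <= delta / 2.
  apply: le_trans (_ : s * (`|rz| + 1) <= _).
    by rewrite ler_pM2l//; have := ler_norm rz; lra.
  by rewrite /s (_ : delta / _ * _ = delta / 2)//; field; rewrite gt_eqF// ltr_wpDl.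
exists ((1 + s + s^-1) / delta); first by rewrite divr_ge0 ?addr_ge0// ltW.
move=> v chi sv lv orth cchi; have sc : smooth chi by case: cchi.
have [v1 v2] := sv.
have tw : Tf (cut chi v).
  by split; rewrite ?Re_cut ?Im_cut; under eq_fun do rewrite mulrC; exact: CcsMl.
have tcw := Tf_cut sc tw.
have te j : Tf (cut (X j chi) v) by apply: (Tf_cut_X j sc sv tw); case: cchi.
pose Bf j : R := nth 0 [:: Bx; By; 0] j.
have fr j := cut_form_re Bf cchi sv j; have fi j := cut_form_im Bf cchi sv j.
set w := cut chi v in tw tcw fr fi *; set e := fun j => cut (X j chi) v.
have t0 j := Tf_P j (Bf j) tw.
have lphi := Tf_L2 tcw; have lz := L2Z zeta lphi; have lH := Tf_L2 (Tf_H Bx By tcw).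
have lI := L2_mulI lv.
have O1 := orth _ tcw.
have O2 : rip (A (cut chi w)) (mulI v) = 0.
  have lA := Tf_L2 (Tf_H_shift Bx By zeta tcw).
  apply: oppr_inj; rewrite oppr0 -(rip_mulI lA lv) -(H_shift_mulI (Tf_smC tcw)).
  by apply: orth; exact: Tf_mulI.
have jw := intble_sqmod (Tf_L2 tw).
have z1 : rip (fun p => zeta * cut chi w p) v = rz * sqnorm w.
  rewrite /rip /sqnorm -!/(rint _) -(rintZ _ jw); congr rint; apply/funext => p.
  exact: redot_zeta_cut.
have z2 : rip (fun p => zeta * cut chi w p) (mulI v) = complex.Im zeta * sqnorm w.
  rewrite /rip /sqnorm -!/(rint _) -(rintZ _ jw); congr rint; apply/funext => p.
  exact: redot_zeta_cut_im.
have h1 : 2 * rip (H_Sol Bx By (cut chi w)) v = (sqnorm (P k0 Bx w) - sqnorm (e k0)) +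
    (sqnorm (P k1 By w) - sqnorm (e k1)) + (sqnorm (P k2 0 w) - sqnorm (e k2)).
  by rewrite (rip_H _ _ tcw lv) (fr k0) (fr k1) (fr k2).
have h2 : 2 * rip (H_Sol Bx By (cut chi w)) (mulI v) =
    - 2 * (rip (P k0 Bx w) (e k0) + rip (P k1 By w) (e k1) + rip (P k2 0 w) (e k2)).
  by rewrite (rip_H _ _ tcw lI) (fi k0) (fi k1) (fi k2) !mulrDr.
have O1' : rip (H_Sol Bx By (cut chi w)) v = rz * sqnorm w.
  by apply/eqP; rewrite -subr_eq0 -z1 -(ripBl lH lz lv); apply/eqP; exact: O1.
have O2' : rip (H_Sol Bx By (cut chi w)) (mulI v) = complex.Im zeta * sqnorm w.
  by apply/eqP; rewrite -subr_eq0 -z2 -(ripBl lH lz lI); apply/eqP; exact: O2.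
have EB := energy_lower_bound hB tw.
have b j := le_rip s0 (Tf_L2 (t0 j)) (Tf_L2 (te j)).
move: h1 h2; rewrite O1' O2' => h1 h2.
exact: (cutoff_algebra s0 srz EB (sqnorm_ge0 w) (sqnorm_ge0 (e k0)) (sqnorm_ge0 (e k1))
  (sqnorm_ge0 (e k2)) (b k0) (b k1) (b k2) h1 h2).
Qed.

End Orthogonal.

(** * Cutoff functions *)

Section Cutoffs.
Variable R : realType.
Implicit Types (f g h F : R -> R) (p : space3 R) (n : R).

Definition tens f g h : space3 R -> R := fun p => f p.1.1 * g p.1.2 * h p.2.

Lemma smooth_tens f g h : sm1 f -> sm1 g -> sm1 h -> smooth (tens f g h).
Proof.
move=> sf sg sh; apply: smoothM; first apply: smoothM.
- exact: (sm1_comp sf (@smooth_crd R k0)).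
- exact: (sm1_comp sg (@smooth_crd R k1)).
- exact: (sm1_comp sh (@smooth_crd R k2)).
Qed.

Lemma pd_coord i j f : sm1 f ->
  pd j (fun p => f (crd i p)) = fun p => d1 f (crd i p) * (i == j)%:R.
Proof.
move=> sf; rewrite (pd_comp j (fun x => @sm1_derivable R f x sf) (@pdable_crd R i)).
by rewrite pd_crd.
Qed.

Lemma pd_tens j f g h : sm1 f -> sm1 g -> sm1 h ->
  pd j (tens f g h) = fun p => (k0 == j)%:R * tens (d1 f) g h p +
    (k1 == j)%:R * tens f (d1 g) h p + (k2 == j)%:R * tens f g (d1 h) p.
Proof.
move=> sf sg sh.
have s0 := sm1_comp sf (@smooth_crd R k0); have s1 := sm1_comp sg (@smooth_crd R k1).
have s2 := sm1_comp sh (@smooth_crd R k2).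
have := pdM j (smooth_pdable (smoothM s0 s1)) (smooth_pdable s2).
rewrite (pdM j (smooth_pdable s0) (smooth_pdable s1)) !pd_coord// => H.
by rewrite [LHS]H; apply/funext => p; rewrite /tens /crd /=; ring.
Qed.

Lemma X0_tens f g h p : sm1 f -> sm1 g -> sm1 h ->
  X k0 (tens f g h) p = expR p.2 * tens (d1 f) g h p.
Proof.
move=> sf sg sh; rewrite XE -/(pd k0 _ p) (pd_tens k0 sf sg sh) /cX /=.
by rewrite !mul0r !addr0 mul1r.
Qed.
Lemma X1_tens f g h p : sm1 f -> sm1 g -> sm1 h ->
  X k1 (tens f g h) p = expR (- p.2) * tens f (d1 g) h p.
Proof.
move=> sf sg sh; rewrite XE -/(pd k1 _ p) (pd_tens k1 sf sg sh) /cX /=.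
by rewrite !mul0r !addr0 add0r mul1r.
Qed.
Lemma X2_tens f g h p : sm1 f -> sm1 g -> sm1 h -> X k2 (tens f g h) p = tens f g (d1 h) p.
Proof.
move=> sf sg sh; rewrite XE -/(pd k2 _ p) (pd_tens k2 sf sg sh) /cX /=.
by rewrite !mul0r !add0r !mul1r.
Qed.

Definition box3 (a b c : R) : set (mspace3 R) :=
  `[- a, a]%classic `*` `[- b, b]%classic `*` `[- c, c]%classic.

Lemma measurable_box3 a b c : measurable (box3 a b c).
Proof. by apply: measurableX; [apply: measurableX|]; exact: measurable_itv. Qed.

Lemma rint_box3 (a b c : R) : 0 < a -> 0 < b -> 0 < c ->
  intble (\1_(box3 a b c)) /\ rint (\1_(box3 a b c)) = 8 * a * b * c.
Proof.
move=> a0 b0 c0; have mB := measurable_box3 a b c.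
have L (t : R) : 0 < t -> (@lebesgue_measure R `[(- t)%R, t]%classic = (2 * t)%:E)%E.
  move=> t0; rewrite lebesgue_measure_itv /= lte_fin gtrN// -EFinB; congr EFin; ring.
have E : (leb3 R (box3 a b c) = (8 * a * b * c)%:E)%E.
  have E2 : (@leb2 R (`[(- a)%R, a]%classic `*` `[(- b)%R, b]%classic) = (2 * a)%:E * (2 * b)%:E)%E.
    rewrite /leb2 /= product_measure1E; [|exact: measurable_itv..].
    by rewrite [X in (X * _)%E](L a a0) [X in (_ * X)%E](L b b0).
  rewrite /leb3 /= product_measure1E; [|by apply: measurableX; exact: measurable_itv|exact: measurable_itv].
  rewrite -[X in (X * _)%E]/(@leb2 R _) E2 [X in (_ * X)%E](L c c0) -!EFinM; congr EFin; ring.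
have I : (\int[leb3 R]_p (\1_(box3 a b c) p)%:E = (8 * a * b * c)%:E)%E.
  by rewrite integral_indic// setIT.
split; last by rewrite /rint /Rintegral I.
apply/integrableP; split; first by apply/measurable_EFinP; exact: measurable_indic.
under eq_integral do rewrite /= ger0_norm//.
by rewrite I ltry.
Qed.

Lemma box3P a b c p : box3 a b c p <-> [/\ `|p.1.1| <= a, `|p.1.2| <= b & `|p.2| <= c].
Proof.
case: p => -[x y] z; rewrite /box3 /= !in_itv /= -!ler_norml.
by split => [[[? ?] ?]|[? ? ?]].
Qed.

Definition rho : R -> R := ebump (- 1) 1 1.

Lemma rho_cs1 : cs1 2 rho.
Proof.
split; first exact: sm1_ebump.
move=> t t2; apply: ebump_out => // /andP[h1 h2]; move: t2; rewrite ltNge ler_norml.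
by move/negP; apply; apply/andP; split; lra.
Qed.
Lemma sm1_rho : sm1 rho. Proof. by case: rho_cs1. Qed.
Lemma rho_ge0 t : 0 <= rho t. Proof. exact: ebump_ge0. Qed.
Lemma rho_le1 t : rho t <= 1. Proof. exact: ebump_le1. Qed.

Lemma rho_inner : exists2 m : R, 0 < m & forall t, `|t| <= 2^-1 -> m <= rho t.
Proof.
have es (x : R) : 2^-1 <= x -> estep (2^-1 : R) <= estep x.
  move=> x2; have x0 : 0 < x by apply: lt_le_trans x2.
  rewrite /estep x0 invr_gt0 ltr0n /= ler_expR lerN2 lef_pV2// posrE//.
have e0 : 0 < estep (2^-1 : R) by apply: estep_gt0.
exists (estep (2^-1 : R) * estep (2^-1)); first exact: mulr_gt0.
move=> t; rewrite ler_norml => /andP[t1 t2]; rewrite /rho /ebump.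
by apply: ler_pM; rewrite ?estep_ge0//; apply: es; lra.
Qed.

Lemma rho_deriv : exists2 D : R, 0 <= D & forall t, `|d1 rho t| <= D /\ `|d1 (d1 rho) t| <= D.
Proof.
have [C C0 HC] := cs1_bounded (ler0n R 2) (cs1_d1 rho_cs1).
have [D D0 HD] := cs1_bounded (ler0n R 2) (cs1_d1 (cs1_d1 rho_cs1)).
exists (C + D); first exact: addr_ge0.
by move=> t; split; [apply: le_trans (HC t) _; rewrite lerDl|apply: le_trans (HD t) _; rewrite lerDr].
Qed.

Definition dil (r : R) F : R -> R := fun x => F (r * x).

Lemma sm1_dil r F : sm1 F -> sm1 (dil r F).
Proof. by move=> sF; have := sm1_affine r 0 sF; under eq_fun do rewrite addr0. Qed.

Lemma d1_dil r F : sm1 F -> d1 (dil r F) = fun x => r * dil r (d1 F) x.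
Proof.
move=> sF; apply: d1_eq => x.
have dr : is_derive x 1 (fun t : R => r * t) r.
  have := @is_deriveM R R (cst r) id x 1 0 1 (is_derive_cst _ _ _) (is_derive_id _ _).
  by rewrite /GRing.scale /= mulr1 mulr0 addr0.
by have := is_derive1_comp (d1P (sm1_derivable (x := r * x) sF)) dr; rewrite mulrC.
Qed.

Lemma rho_out t : 2 < `|t| -> [/\ rho t = 0, d1 rho t = 0 & d1 (d1 rho) t = 0].
Proof.
move=> t2; have c0 := rho_cs1; have c1 := cs1_d1 c0; have c2 := cs1_d1 c1.
by split; [apply: c0.2|apply: c1.2|apply: c2.2].
Qed.

Lemma dil_out r F t : 0 < r -> (forall t, 2 < `|t| -> F t = 0) -> 2 / r < `|t| -> dil r F t = 0.
Proof.
by move=> r0 F0 H; apply: F0; rewrite normrM gtr0_norm// mulrC -ltr_pdivrMr.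
Qed.

(** On the support of the cutoff [|z| <= 2n]; the horizontal scale [e^-2n / n]
    compensates for the growth of the fields [e^z d/dx] and [e^-z d/dy] there. *)
Definition hscale (n : R) : R := expR (- (2 * n)) / n.
Definition cutoff (n : R) : space3 R -> R :=
  tens (dil (hscale n) rho) (dil (hscale n) rho) (dil n^-1 rho).

Lemma hscale_gt0 n : 0 < n -> 0 < hscale n.
Proof. by move=> n0; rewrite divr_gt0 ?expR_gt0. Qed.

Lemma expR_hscale n z : 0 < n -> `|z| <= 2 * n -> expR z * hscale n <= n^-1.
Proof.
move=> n0; rewrite ler_norml => /andP[_ z2]; rewrite /hscale mulrA -expRD.
by rewrite ler_piMl ?invr_ge0 ?(ltW n0)// -[leRHS]expR0 ler_expR; lra.
Qed.

Lemma Ccs_cutoff n : 0 < n -> Ccs (cutoff n).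
Proof.
move=> n0; have h0 := hscale_gt0 n0; have ni : 0 < n^-1 by rewrite invr_gt0.
split; first by apply: smooth_tens; apply: sm1_dil; exact: sm1_rho.
have r0 (t : R) : 2 < `|t| -> rho t = 0 by case/rho_out.
exists (2 / hscale n + 2 * n) => p ip; rewrite /cutoff /tens.
have [x1|x1] := ltP (2 / hscale n) `|p.1.1|; first by rewrite (dil_out h0 r0 x1) !mul0r.
have [x2|x2] := ltP (2 / hscale n) `|p.1.2|; first by rewrite (dil_out h0 r0 x2) mulr0 mul0r.
have [x3|x3] := ltP (2 / n^-1) `|p.2|; first by rewrite (dil_out ni r0 x3) mulr0.
have d0 : 0 <= 2 / hscale n by rewrite divr_ge0// ltW.
rewrite invrK in x3.
by exfalso; apply: ip; split; lra.
Qed.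

(** The metric of Sol is complete: there are cutoffs of arbitrarily small gradient. *)
Lemma cutoff_grad (D n : R) j p : 0 < n -> (forall t, `|d1 rho t| <= D) ->
  `|X j (cutoff n) p| <= D / n.
Proof.
move=> n0 HD; have h0 := hscale_gt0 n0; have ni : 0 < n^-1 by rewrite invr_gt0.
have sr := sm1_rho; have sh := sm1_dil (hscale n) sr; have sn := sm1_dil n^-1 sr.
have D0 : 0 <= D by apply: le_trans (HD 0).
have r1 (t : R) : `|rho t| <= 1 by rewrite ger0_norm ?rho_ge0 ?rho_le1.
have Dn : 0 <= D / n by rewrite divr_ge0// ltW.
have fin (e x y z : R) : expR e * hscale n <= n^-1 ->
    `|expR e * hscale n * (dil (hscale n) (d1 rho) x * (dil (hscale n) rho y * dil n^-1 rho z))| <= D / n.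
  have e0 : 0 <= expR e * hscale n by rewrite mulr_ge0 ?expR_ge0// ltW.
  move=> H; rewrite normrM (ger0_norm e0) [D / n]mulrC; apply: ler_pM => //.
  rewrite -[D]mulr1 normrM; apply: ler_pM => //; first exact: HD.
  by rewrite -[1]mulr1 normrM; apply: ler_pM => //; exact: r1.
case: (ord3P j) => ->.
- rewrite X0_tens// d1_dil//.
  have [z2|z2] := ltP (2 / n^-1) `|p.2|.
    have r0 (t : R) : 2 < `|t| -> rho t = 0 by case/rho_out.
    by rewrite /tens (dil_out ni r0 z2) !mulr0 normr0.
  rewrite invrK in z2; have H := expR_hscale n0 z2.
  rewrite (_ : _ * tens _ _ _ p = (expR p.2 * hscale n) *
    (dil (hscale n) (d1 rho) p.1.1 * (dil (hscale n) rho p.1.2 * dil n^-1 rho p.2))); last by rewrite /tens; ring.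
  exact: fin.
- rewrite X1_tens// d1_dil//.
  have [z2|z2] := ltP (2 / n^-1) `|p.2|.
    have r0 (t : R) : 2 < `|t| -> rho t = 0 by case/rho_out.
    by rewrite /tens (dil_out ni r0 z2) !mulr0 normr0.
  rewrite invrK -normrN in z2; have H := expR_hscale n0 z2.
  rewrite (_ : _ * tens _ _ _ p = (expR (- p.2) * hscale n) *
    (dil (hscale n) (d1 rho) p.1.2 * (dil (hscale n) rho p.1.1 * dil n^-1 rho p.2))); last by rewrite /tens; ring.
  exact: fin.
rewrite X2_tens// d1_dil//.
rewrite (_ : tens _ _ _ p = n^-1 * (dil n^-1 (d1 rho) p.2 *
  (dil (hscale n) rho p.1.1 * dil (hscale n) rho p.1.2))); last by rewrite /tens; ring.
rewrite [D / n]mulrC normrM (gtr0_norm ni); apply: ler_wpM2l; first exact: ltW.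
rewrite -[D]mulr1 normrM; apply: ler_pM => //; first exact: HD.
by rewrite -[1]mulr1 normrM; apply: ler_pM => //; exact: r1.
Qed.

Lemma cutoff_inner (m n : R) p : 1 <= n -> 0 < m -> (forall t, `|t| <= 2^-1 -> m <= rho t) ->
  inbox 2^-1 p -> m ^+ 3 <= cutoff n p.
Proof.
move=> n1 m0 Hm [hx hy hz]; have n0 : 0 < n by apply: lt_le_trans n1.
have h1 : hscale n <= 1.
  rewrite /hscale ler_pdivrMr// mul1r; apply: le_trans n1.
  by rewrite -[leRHS]expR0 ler_expR; lra.
have h0 := hscale_gt0 n0.
have sc (r t : R) : 0 < r -> r <= 1 -> `|t| <= 2^-1 -> m <= dil r rho t.
  move=> r0 r1 t2; apply: Hm; rewrite normrM (gtr0_norm r0).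
  by apply: le_trans t2; rewrite ler_piMl.
rewrite exprS expr2 mulrA /cutoff /tens.
have m' := ltW m0.
apply: ler_pM => //; [exact: mulr_ge0|apply: ler_pM => //; exact: sc|].
by apply: sc => //; rewrite ?invr_gt0 ?invf_le1.
Qed.

End Cutoffs.

Section Density.
Variables (R : realType) (Bx By B : R).
Hypothesis hB : B = Num.sqrt (Bx ^+ 2 + By ^+ 2).
Variables (zeta : R[i]) (delta : R).
Hypothesis delta0 : 0 < delta.
Hypothesis gap : delta <= bottom B - complex.Re zeta \/ delta <= `|complex.Im zeta|.
Implicit Types (u v w k : cfun3 R) (n : R).
Local Notation A := (H_shift Bx By zeta).

(** Otherwise the mass of [v] near the origin is bounded from below, whereas by
    [cutoff_bound] it is at most a multiple of [|v|^2 / n] for every [n]. *)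
Lemma orth_zero v : smC v -> L2 v -> (forall u, Tf u -> rip (A u) v = 0) -> v (0, 0, 0) = 0.
Proof.
move=> sv lv orth; have [v1 v2] := sv.
have [C C0 HC] := cutoff_bound hB delta0 gap.
have [D D0 HD] := rho_deriv R; have [m m0 Hm] := rho_inner R.
have sF : smooth (sqmod v) by apply: smoothD; apply: smoothM.
suff F0 : sqmod v (0, 0, 0) = 0.
  move/eqP: F0; rewrite paddr_eq0 ?sqr_ge0// !sqrf_eq0 => /andP[/eqP ? /eqP ?].
  exact: complex_ext.
apply/eqP; rewrite eq_le sqmod_ge0 andbT leNgt; apply/negP => q0.
set q := sqmod v (0, 0, 0) in q0.
have q2 : 0 < q / 2 by rewrite divr_gt0.
have [r r0 Hr] := continuous_delta 0 0 0 (smooth_continuous sF) q2.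
pose t := Num.min r 2^-1.
have t0 : 0 < t by rewrite lt_min r0 invr_gt0/=.
have [jb Ib] := rint_box3 t0 t0 t0.
have lw n : 0 < n -> L2 (cut (cutoff n) v).
  move=> n0; apply: Tf_L2; split; rewrite ?Re_cut ?Im_cut.
    by apply: (CcsMr (Ccs_cutoff n0)).
  by apply: (CcsMr (Ccs_cutoff n0)).
have le j n : 0 < n -> L2 (cut (X j (cutoff n)) v).
  move=> n0; have cX := Ccs_X j (Ccs_cutoff n0).
  by apply: Tf_L2; split; rewrite ?Re_cut ?Im_cut; [exact: (CcsMr cX v1)|exact: (CcsMr cX v2)].
pose K := m ^+ 6 * (q / 2) * (8 * t * t * t).
have K0 : 0 < K by rewrite !mulr_gt0// exprn_gt0.
have low n : 1 <= n -> K <= sqnorm (cut (cutoff n) v).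
  move=> n1; have n0 : 0 < n by apply: lt_le_trans n1.
  rewrite /K -Ib -rintZ//; apply: le_rint; [exact: intbleZ|exact: intble_sqmod (lw n n0)|].
  move=> p; have [/box3P[hx hy hz]|np] := pselect (box3 t t t p); last first.
    by rewrite indicE memNset// mulr0 sqmod_ge0.
  rewrite indicE mem_set ?mulr1; last exact/box3P.
  have tr : t <= r by rewrite ge_min lexx.
  have th : t <= 2^-1 by rewrite ge_min lexx orbT.
  have ip : inbox 2^-1 p by split; lra.
  have cm := cutoff_inner n1 m0 Hm ip.
  have qv : q / 2 <= sqmod v p.
    have := Hr p.1.1 p.1.2 p.2; rewrite !sub0r !normrN => H.
    have := H (le_trans hx tr) (le_trans hy tr) (le_trans hz tr).
    rewrite -/q (_ : (p.1.1, p.1.2, p.2) = p); last by case: (p) => -[].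
    by rewrite ler_norml => /andP[_]; lra.
  rewrite (_ : sqmod (cut (cutoff n) v) p = cutoff n p ^+ 2 * sqmod v p); last first.
    by rewrite /sqmod Re_cutE Im_cutE; ring.
  apply: ler_pM => //; [by rewrite exprn_ge0// ltW|exact: ltW|].
  rewrite (_ : 6 = 3 * 2)%N// exprM ler_pXn2r ?nnegrE ?exprn_ge0 ?(ltW m0)//.
  by apply: le_trans cm; rewrite exprn_ge0// ltW.
have up j n : 1 <= n -> sqnorm (cut (X j (cutoff n)) v) <= D ^+ 2 / n * sqnorm v.
  move=> n1; have n0 : 0 < n by apply: lt_le_trans n1.
  rewrite /sqnorm -!/(rint _) -rintZ; last exact: intble_sqmod.
  apply: le_rint; [exact: intble_sqmod (le j n n0)|by apply: intbleZ; exact: intble_sqmod|].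
  move=> p; rewrite (_ : sqmod (cut (X j (cutoff n)) v) p = X j (cutoff n) p ^+ 2 * sqmod v p); last first.
    by rewrite /sqmod Re_cutE Im_cutE; ring.
  apply: ler_wpM2r; first exact: sqmod_ge0.
  have := cutoff_grad j p n0 (fun t => (HD t).1) => H.
  rewrite -(real_normK (num_real (X j _ _))); apply: le_trans (_ : (D / n) ^+ 2 <= _).
    by rewrite ler_pXn2r ?nnegrE// divr_ge0// ltW.
  rewrite exprMn; apply: ler_wpM2l; first exact: sqr_ge0.
  by rewrite expr2 ler_piMl ?invf_le1 ?invr_ge0// ltW.
(* [n] is taken so large that the upper bound [M / n] falls below [K] *)
pose M := C * (3 * D ^+ 2 * sqnorm v).
have M0 : 0 <= M by rewrite mulr_ge0// mulr_ge0 ?sqnorm_ge0// mulr_ge0 ?sqr_ge0.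
pose n := M / K + 1.
have n1 : 1 <= n by rewrite lerDr divr_ge0// ltW.
have n0 : 0 < n by apply: lt_le_trans n1.
have := HC v _ sv lv orth (Ccs_cutoff n0).
have := low n n1; have u0 := up k0 n n1; have u1 := up k1 n n1; have u2 := up k2 n n1.
move=> h1 h2.
have h3 : K <= M / n.
  apply: le_trans h1 _; apply: le_trans h2 _; rewrite /M -mulrA; apply: ler_wpM2l => //.
  rewrite (_ : 3 * D ^+ 2 * sqnorm v / n = D ^+ 2 / n * sqnorm v + D ^+ 2 / n * sqnorm v + D ^+ 2 / n * sqnorm v); last by ring.
  exact: (lerD (lerD u0 u1) u2).
move: h3; rewrite ler_pdivlMr// /n mulrDr mulr1 mulrCA divff ?gt_eqF// mulr1.
by rewrite gerDl leNgt K0.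
Qed.

(** All convolutions of [k] are smooth and orthogonal to the range, hence vanish at
    the origin, and this determines [k]. *)
Lemma range_dense k : L2 k -> (forall u, Tf u -> rip k (A u) = 0) -> eqL2 k (fun=> 0).
Proof.
move=> lk orth; have [m1 m2 j1 j2] := sq_parts lk.
have V N (a b c : R -> R) : 0 <= N -> cs1 N a -> cs1 N b -> cs1 N c ->
    (forall t, 0 <= a t) -> (forall t, 0 <= b t) -> (forall t, 0 <= c t) ->
    kopC (Kr a b c) k (0, 0, 0) = 0.
  move=> N0 ca cb cc a0 b0 c0; have [s l] := kopC_L2 N0 ca cb cc a0 b0 c0 lk.
  by apply: orth_zero => //; exact: (kopC_orth N0 ca cb cc lk orth).
have a1 : {ae leb3 R, forall p, complex.Re (k p) = 0}.
  apply: conv_vanish; first exact: locint_sq.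
  by move=> N a b c N0 ca cb cc a0 b0 c0; have [] := V N a b c N0 ca cb cc a0 b0 c0.
have a2 : {ae leb3 R, forall p, complex.Im (k p) = 0}.
  apply: conv_vanish; first exact: locint_sq.
  by move=> N a b c N0 ca cb cc a0 b0 c0; have [] := V N a b c N0 ca cb cc a0 b0 c0.
have [N1 [mN1 N10 s1]] := a1; have [N2 [mN2 N20 s2]] := a2.
exists (N1 `|` N2); split; [exact: measurableU|by rewrite measureU0|].
move=> p np; have [r0|r0] := eqVneq (complex.Re (k p)) 0; last by left; apply: s1 => /eqP; rewrite (negPf r0).
by right; apply: s2 => /= i0; apply: np; exact: complex_ext.
Qed.

Lemma spec_gap : ~ spec_Sol Bx By zeta.
Proof. by apply; apply: (resolvent_criterion hB delta0 gap); exact: range_dense. Qed.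

End Density.

(** A number off the half-line differs from it in the real or in the imaginary
    part. *)
Lemma spec_lower (R : realType) (Bx By B : R) : B = Num.sqrt (Bx ^+ 2 + By ^+ 2) ->
  spec_Sol Bx By `<=` [set x%:C | x in [set x : R | bottom B <= x]].
Proof.
move=> hB zeta sz; exists (complex.Re zeta).
  rewrite /= leNgt; apply/negP => lt.
  have d0 : 0 < bottom B - complex.Re zeta by rewrite subr_gt0.
  by apply: (spec_gap hB d0 _ sz); left.
apply: complex_ext => //=; apply/eqP; rewrite eq_sym; apply/negPn/negP => i0.
have d0 : 0 < `|complex.Im zeta| by rewrite normr_gt0.
by apply: (spec_gap hB d0 _ sz); right.
Qed.

(** * Approximate eigenfunctions *)

Section Modulation.
Variables (R : realType) (kappa : R).
Implicit Types (f g h : R -> R) (F th : space3 R -> R) (G : cfun3 R) (j : 'I_3) (p : space3 R).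

Definition cosx p : R := cos (kappa * p.1.1).
Definition sinx p : R := sin (kappa * p.1.1).
Definition modulate G : cfun3 R := fun p => (cosx p +i* sinx p) * G p.
(** The plane wave is an eigenfunction of the fields up to the factor [i wave j], which
    therefore adds to the magnetic term. *)
Definition wave j p : R := (k0 == j)%:R * (kappa * expR p.2).

Lemma smooth_cosx : smooth cosx.
Proof. exact: (sm1_comp (sm1_dil kappa (sm1_cos_sin R).1) (@smooth_crd R k0)). Qed.
Lemma smooth_sinx : smooth sinx.
Proof. exact: (sm1_comp (sm1_dil kappa (sm1_cos_sin R).2) (@smooth_crd R k0)). Qed.

Lemma X_cosx j p : X j cosx p = - wave j p * sinx p.
Proof.
have sc := (sm1_cos_sin R).1.
rewrite XE -/(pd j _ p) (pd_coord k0 j (sm1_dil kappa sc)) (d1_dil _ sc).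
rewrite (d1_eq (fun x => is_derive_cos x)) /wave /sinx /dil /crd.
by case: (ord3P j) => ->; rewrite /cX /=; ring.
Qed.
Lemma X_sinx j p : X j sinx p = wave j p * cosx p.
Proof.
have sc := (sm1_cos_sin R).2.
rewrite XE -/(pd j _ p) (pd_coord k0 j (sm1_dil kappa sc)) (d1_dil _ sc).
rewrite (d1_eq (fun x => is_derive_sin x)) /wave /cosx /dil /crd.
by case: (ord3P j) => ->; rewrite /cX /=; ring.
Qed.

Lemma smooth_wave j : smooth (wave j).
Proof.
apply: smoothZ; apply: smoothZ; exact: (sm1_comp (sm1_expR R) (@smooth_crd R k2)).
Qed.

Lemma X_wave j p : X j (wave j) p = 0.
Proof.
have sE := sm1_comp (sm1_expR R) (@smooth_crd R k2).
rewrite /wave (XZ j _ (smoothZ kappa sE)) (XZ j kappa sE) XE -/(pd j _ p).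
rewrite (pd_coord k2 j (sm1_expR R)).
by case: (ord3P j) => ->; rewrite /=; ring.
Qed.

Definition P_var j th G : cfun3 R := fun p =>
  (X j (fun q => complex.Im (G q)) p + th p * complex.Re (G p)) +i*
  (- X j (fun q => complex.Re (G q)) p + th p * complex.Im (G p)).

Lemma P_modulate j (B : R) G : smC G -> P j B (modulate G) = modulate (P_var j (fun p => B + wave j p) G).
Proof.
move=> [g1 g2]; have sc := smooth_cosx; have ss := smooth_sinx.
have eI : (fun q => complex.Im (modulate G q)) = fun q => cosx q * complex.Im (G q) + sinx q * complex.Re (G q).
  by apply/funext => q; rewrite /modulate cImM.
have eR : (fun q => complex.Re (modulate G q)) = fun q => cosx q * complex.Re (G q) - sinx q * complex.Im (G q).
  by apply/funext => q; rewrite /modulate cReM.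
apply/funext => p; rewrite /P eI eR (XD j (smoothM sc g2) (smoothM ss g1)) (XB j (smoothM sc g1) (smoothM ss g2)).
rewrite (XM j sc g2) (XM j ss g1) (XM j sc g1) (XM j ss g2) X_cosx X_sinx /modulate /P_var.
move: (X j _ p) (X j _ p) (wave j p) (cosx p) (sinx p) => x1 x2 w c s.
case: (G p) => a b; apply: complex_ext; rewrite /= ?(cReM, cImM) /=; ring.
Qed.

Lemma sqmod_modulate G p : sqmod (modulate G) p = sqmod G p.
Proof.
rewrite /sqmod /modulate cReM cImM /= /cosx /sinx.
have := cos2Dsin2 (kappa * p.1.1); move: (cos _) (sin _) => c s H.
case: (G p) => x y /=; transitivity ((c ^+ 2 + s ^+ 2) * (x ^+ 2 + y ^+ 2)); first by ring.
by rewrite H mul1r.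
Qed.

Lemma smC_P_var j th G : smooth th -> smC G -> smC (P_var j th G).
Proof.
move=> st [g1 g2]; split => /=.
  by apply: smoothD; [exact: smooth_X|exact: smoothM].
by apply: smoothD; [apply: smoothN; exact: smooth_X|exact: smoothM].
Qed.

(** For a real function [F] the second-order and zeroth-order terms are real and the
    first-order term is imaginary; [th] is constant along [X_j]. *)
Lemma P_var_sqr j th F : smooth th -> (forall p, X j th p = 0) -> smooth F ->
  P_var j th (P_var j th (fun p => (F p)%:C)) = fun p =>
    (th p ^+ 2 * F p - X j (X j F) p) +i* (- 2 * th p * X j F p).
Proof.
move=> st th0 sF; have sX := smooth_X j sF; have s0 := @smooth_cst R 0.
have X0 : X j (fun=> 0 : R) = fun=> 0.
  by apply/funext => q; have := XZ j 0 s0; rewrite mul0r => ->; rewrite mul0r.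
have aR q : complex.Re (P_var j th (fun p => (F p)%:C) q) = th q * F q.
  by rewrite /P_var /= X0 add0r.
have aI q : complex.Im (P_var j th (fun p => (F p)%:C) q) = - X j F q.
  by rewrite /P_var /= mulr0 addr0.
apply/funext => p; rewrite [LHS]/P_var (funext aR) (funext aI) aR aI (XN j sX) (XM j st sF) th0.
by apply: complex_ext => /=; ring.
Qed.

(** Real and imaginary part of [(2H - lam)] applied to a modulated real function [F],
    after removal of the plane wave. *)
Definition residual_re (Bx By lam : R) F p : R := ((Bx + kappa * expR p.2) ^+ 2 + By ^+ 2 - lam) * F p -
  (X k0 (X k0 F) p + X k1 (X k1 F) p + X k2 (X k2 F) p).
Definition residual_im (Bx By : R) F p : R := - 2 * ((Bx + kappa * expR p.2) * X k0 F p + By * X k1 F p).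

Lemma sqmod_H_shift_modulate (Bx By lam : R) F p : smooth F ->
  sqmod (H_shift Bx By (2^-1 * lam)%:C (modulate (fun p => (F p)%:C))) p =
  4^-1 * (residual_re Bx By lam F p ^+ 2 + residual_im Bx By F p ^+ 2).
Proof.
move=> sF; have sG : smC (fun p => (F p)%:C) by split => //; exact: smooth_cst.
have st j (B : R) : smooth (fun p => B + wave j p).
  by apply: smoothD; [exact: smooth_cst|exact: smooth_wave].
have X0 j (B : R) q : X j (fun p => B + wave j p) q = 0.
  have sB := @smooth_cst R B; rewrite (XD j sB (smooth_wave j)) X_wave addr0.
  by have := XZ j B (@smooth_cst R 1); rewrite mulr1 => ->; rewrite XE -/(pd j _ q) pd_cst !mulr0.
have PP j (B : R) : P j B (P j B (modulate (fun p => (F p)%:C))) = modulate (fun p =>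
    ((B + wave j p) ^+ 2 * F p - X j (X j F) p) +i* (- 2 * (B + wave j p) * X j F p)).
  rewrite (P_modulate j B sG) (P_modulate j B (smC_P_var j (st j B) sG)).
  by rewrite (P_var_sqr (st j B) (X0 j B) sF).
have -> : sqmod (H_shift Bx By (2^-1 * lam)%:C (modulate (fun p => (F p)%:C))) p =
   sqmod (modulate (fun p => (2^-1)%:C * (residual_re Bx By lam F p +i* residual_im Bx By F p))) p.
  rewrite /sqmod /H_shift H_SolE !PP half_real /modulate /wave /=.
  rewrite /residual_re /residual_im.
  move: (X k0 (X k0 F) p) (X k1 (X k1 F) p) (X k2 (X k2 F) p) (X k0 F p) (X k1 F p) (X k2 F p).
  move: (cosx p) (sinx p) (F p) (expR p.2) => c s f e x00 x11 x22 x0 x1 x2.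
  congr (_ ^+ 2 + _ ^+ 2); rewrite ?(cReB, cImB, cReM, cImM, cReD, cImD) /= ?(cReM, cImM) /=; ring.
by rewrite sqmod_modulate /sqmod cReM cImM /=; field.
Qed.

End Modulation.

Section Weyl.
Variable R : realType.
Implicit Types (f : R -> R) (p : space3 R) (L : R).

(** The trial functions: a solution of the fibre equation, cut off at height [L]
    in the vertical direction and at the much larger scale [1/vscale L] in the
    horizontal directions. *)
Definition vscale L : R := expR (- (4 * L)) / L.
Definition trial f L : space3 R -> R :=
  tens (dil (vscale L) (@rho R)) (dil (vscale L) (@rho R)) (fun z => f z * dil L^-1 (@rho R) z).

Lemma is_derive_mul (a b : R -> R) (x : R) : sm1 a -> sm1 b ->
  is_derive x 1 (fun x => a x * b x) (d1 a x * b x + a x * d1 b x).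
Proof.
move=> sa sb.
have H := @is_deriveM R R a b x 1 _ _ (d1P (sm1_derivable (x := x) sa)) (d1P (sm1_derivable (x := x) sb)).
by apply: (is_derive_eq H); rewrite /GRing.scale /=; ring.
Qed.

Lemma d1M (a b : R -> R) : sm1 a -> sm1 b -> d1 (fun x => a x * b x) = fun x => d1 a x * b x + a x * d1 b x.
Proof. by move=> sa sb; apply: d1_eq => x; exact: is_derive_mul. Qed.

Section Trial.
Variables (Bx By kappa mu K D : R) (f : R -> R) (L : R).
Hypotheses (sf : sm1 f) (L1 : 1 <= L)
  (fK : forall z, `|f z| <= K) (f'K : forall z, `|d1 f z| <= K)
  (ode : forall z, d1 (d1 f) z = ((Bx + kappa * expR z) ^+ 2 - mu) * f z)
  (HD : forall t, `|d1 (@rho R) t| <= D /\ `|d1 (d1 (@rho R)) t| <= D).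

Let L0 : 0 < L. Proof. exact: lt_le_trans L1. Qed.
Let r := vscale L.
Let r0 : 0 < r. Proof. by rewrite divr_gt0 ?expR_gt0. Qed.
Let l := L^-1.
Let l0 : 0 < l. Proof. by rewrite invr_gt0. Qed.
Let l1 : l <= 1. Proof. by rewrite invf_le1. Qed.
Let sr := sm1_rho R.
Let Psi := dil r (@rho R).
Let phi := dil l (@rho R).
Let F := fun z => f z * phi z.
Let sPsi : sm1 Psi := sm1_dil r sr.
Let sphi : sm1 phi := sm1_dil l sr.
Let sF : sm1 F := sm1M sf sphi.

Lemma Ccs_trial : Ccs (trial f L).
Proof.
split; first exact: (smooth_tens sPsi sPsi sF).
have q0 (t : R) : 2 < `|t| -> rho t = 0 by case/rho_out.
exists (2 / r + 2 / l) => p ip; rewrite /trial /tens.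
have [x1|x1] := ltP (2 / r) `|p.1.1|; first by rewrite (dil_out r0 q0 x1) !mul0r.
have [x2|x2] := ltP (2 / r) `|p.1.2|; first by rewrite (dil_out r0 q0 x2) mulr0 mul0r.
have [x3|x3] := ltP (2 / l) `|p.2|; first by rewrite (dil_out l0 q0 x3) !mulr0.
have d0 : 0 <= 2 / r by rewrite divr_ge0// ltW.
have d1 : 0 <= 2 / l by rewrite divr_ge0// ltW.
by exfalso; apply: ip; split; lra.
Qed.

(** The fibre equation cancels the terms in which no cutoff is differentiated. *)
Lemma residual_re_trial p : residual_re kappa Bx By (mu + By ^+ 2) (trial f L) p =
  - (Psi p.1.1 * Psi p.1.2 * (2 * d1 f p.2 * (l * dil l (d1 (@rho R)) p.2) +
      f p.2 * (l ^+ 2 * dil l (d1 (d1 (@rho R))) p.2)) +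
    r ^+ 2 * dil r (d1 (d1 (@rho R))) p.1.1 * Psi p.1.2 * (expR p.2 ^+ 2 * F p.2) +
    Psi p.1.1 * (r ^+ 2 * dil r (d1 (d1 (@rho R))) p.1.2) * (expR (- p.2) ^+ 2 * F p.2)).
Proof.
have sE := sm1_expR R.
have sEn : sm1 (fun z : R => expR (- z)).
  by have := sm1_affine (-1) 0 sE; under eq_fun do rewrite mulN1r addr0.
have sr1 := sm1_d1 sr; have sP1 := sm1_d1 sPsi.
have dP : d1 Psi = fun x => r * dil r (d1 (@rho R)) x by exact: d1_dil.
have dP2 : d1 (d1 Psi) = fun x => r ^+ 2 * dil r (d1 (d1 (@rho R))) x.
  rewrite dP (d1M (sm1_cst r) (sm1_dil r sr1)) (d1_dil r sr1).
  have -> : d1 (fun=> r) = fun=> 0 by apply: d1_eq => x; exact: is_derive_cst.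
  by apply/funext => x; ring.
have dp : d1 phi = fun x => l * dil l (d1 (@rho R)) x by exact: d1_dil.
have dp2 : d1 (d1 phi) = fun x => l ^+ 2 * dil l (d1 (d1 (@rho R))) x.
  rewrite dp (d1M (sm1_cst l) (sm1_dil l sr1)) (d1_dil l sr1).
  have -> : d1 (fun=> l) = fun=> 0 by apply: d1_eq => x; exact: is_derive_cst.
  by apply/funext => x; ring.
have X0E (a b h : R -> R) : sm1 a -> sm1 b -> sm1 h ->
    X k0 (tens a b h) = tens (d1 a) b (fun z => expR z * h z).
  by move=> sa sb sh; apply/funext => q; rewrite X0_tens// /tens; ring.
have X1E (a b h : R -> R) : sm1 a -> sm1 b -> sm1 h ->
    X k1 (tens a b h) = tens a (d1 b) (fun z => expR (- z) * h z).
  by move=> sa sb sh; apply/funext => q; rewrite X1_tens// /tens; ring.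
have X2E (a b h : R -> R) : sm1 a -> sm1 b -> sm1 h -> X k2 (tens a b h) = tens a b (d1 h).
  by move=> sa sb sh; apply/funext => q; rewrite X2_tens.
rewrite /residual_re -[trial f L]/(tens Psi Psi F).
rewrite (X0E _ _ _ sPsi sPsi sF) (X0E _ _ _ sP1 sPsi (sm1M sE sF)).
rewrite (X1E _ _ _ sPsi sPsi sF) (X1E _ _ _ sPsi sP1 (sm1M sEn sF)).
rewrite (X2E _ _ _ sPsi sPsi sF) (X2E _ _ _ sPsi sPsi (sm1_d1 sF)).
have dF : d1 F = fun z => d1 f z * phi z + f z * d1 phi z by exact: d1M.
have dF2 : d1 (d1 F) p.2 = d1 (d1 f) p.2 * phi p.2 + 2 * d1 f p.2 * d1 phi p.2 + f p.2 * d1 (d1 phi) p.2.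
  have s1 := sm1_d1 sf; have s2 := sm1_d1 sphi.
  have dA : d1 (fun z => d1 f z * phi z + f z * d1 phi z) = fun z =>
     (d1 (d1 f) z * phi z + d1 f z * d1 phi z) + (d1 f z * d1 phi z + f z * d1 (d1 phi) z).
    apply: d1_eq => x; exact: (is_deriveD (is_derive_mul x s1 sphi) (is_derive_mul x sf s2)).
  rewrite dF dA; move: (d1 (d1 f) p.2) (d1 f p.2) (f p.2) (phi p.2) (d1 phi p.2) (d1 (d1 phi) p.2) => *; ring.
rewrite /tens dF2 ode dP2 dp2 dp /F.
move: (Psi p.1.1) (Psi p.1.2) (f p.2) (phi p.2) (d1 f p.2) (dil l _ p.2) (dil l _ p.2) => P1 P2 f0 ph f1 r1 r2.
move: (dil r _ p.1.1) (dil r _ p.1.2) (expR p.2) (expR (- p.2)) => q1 q2 e1 e2; ring.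
Qed.

Lemma residual_im_trial p : residual_im kappa Bx By (trial f L) p =
  - 2 * ((Bx + kappa * expR p.2) * expR p.2 * (r * dil r (d1 (@rho R)) p.1.1) * Psi p.1.2 * F p.2 +
    By * expR (- p.2) * Psi p.1.1 * (r * dil r (d1 (@rho R)) p.1.2) * F p.2).
Proof.
have dP : d1 Psi = fun x => r * dil r (d1 (@rho R)) x by exact: d1_dil.
rewrite /residual_im -[trial f L]/(tens Psi Psi F) (X0_tens p sPsi sPsi sF) (X1_tens p sPsi sPsi sF) dP /tens.
move: (Psi p.1.1) (Psi p.1.2) (F p.2) (dil r _ p.1.1) (dil r _ p.1.2) (expR p.2) (expR (- p.2)) => P1 P2 F0 q1 q2 e1 e2.
ring.
Qed.

Let rl : r <= l.
Proof.
rewrite /r /vscale -/l ler_piMl//; first exact: ltW.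
by rewrite -[leRHS]expR0 ler_expR oppr_le0 mulr_ge0// ltW.
Qed.
Let r1 : r <= 1. Proof. exact: le_trans rl l1. Qed.

(* [r = e^-4L / L] compensates for [e^z] and [e^2z] up to the height [2L] *)
Let growth (z : R) : z <= 2 * L -> expR z * r <= l /\ expR z ^+ 2 * r <= l.
Proof.
move=> zL; rewrite /r /vscale -/l expr2 !mulrA -!expRD.
have L0' := L0; split; rewrite ler_piMl ?(ltW l0)// -[leRHS]expR0 ler_expR; lra.
Qed.

Let norm_mul (a b x y : R) : `|x| <= a -> `|y| <= b -> `|x * y| <= a * b.
Proof. by move=> xa yb; rewrite normrM; apply: ler_pM. Qed.
Let norm_add (a b x y : R) : `|x| <= a -> `|y| <= b -> `|x + y| <= a + b.
Proof. by move=> xa yb; apply: le_trans (ler_normD _ _) (lerD xa yb). Qed.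
Let norm_id (x : R) : 0 <= x -> `|x| <= x.
Proof. by move=> x0; rewrite ger0_norm. Qed.

Let K0 : 0 <= K. Proof. exact: le_trans (fK 0). Qed.
Let D0 : 0 <= D. Proof. exact: le_trans (HD 0).1. Qed.
Let dil1 (s t : R) : `|dil s (@rho R) t| <= 1.
Proof. by rewrite ger0_norm ?rho_ge0 ?rho_le1. Qed.
Let FK z : `|F z| <= K.
Proof. by rewrite -[K]mulr1; exact: norm_mul (fK z) (dil1 l z). Qed.

Lemma residual_re_bound p : `|p.2| <= 2 * L ->
  `|residual_re kappa Bx By (mu + By ^+ 2) (trial f L) p| <= l * (5 * (K * D)).
Proof.
move=> pL; have /andP[z1 z2] : - (2 * L) <= p.2 <= 2 * L by rewrite -ler_norml.
have [g1 g2] := growth z2; have zn : - p.2 <= 2 * L by lra.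
have [h1 h2] := growth zn.
rewrite residual_re_trial normrN.
have a1 : `|Psi p.1.1 * Psi p.1.2| <= 1 by rewrite -[1]mulr1; exact: norm_mul (dil1 r _) (dil1 r _).
have a2 : `|2 * d1 f p.2 * (l * dil l (d1 (@rho R)) p.2)| <= 2 * K * (l * D).
  apply: norm_mul; first by apply: norm_mul => //; exact: norm_id.
  by apply: norm_mul; [apply: norm_id; exact: ltW|exact: (HD _).1].
have l2 : `|l ^+ 2| <= l by rewrite ger0_norm ?sqr_ge0// expr2 ler_piMl// ltW.
have a3 : `|f p.2 * (l ^+ 2 * dil l (d1 (d1 (@rho R))) p.2)| <= K * (l * D).
  by apply: norm_mul => //; apply: norm_mul => //; exact: (HD _).2.
have b (x y e : R) : expR e ^+ 2 * r <= l ->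
    `|r ^+ 2 * dil r (d1 (d1 (@rho R))) x * Psi y * (expR e ^+ 2 * F p.2)| <= l * (D * K).
  move=> H; rewrite (_ : _ * _ = (expR e ^+ 2 * r) * (r * Psi y) * (dil r (d1 (d1 (@rho R))) x * F p.2)); last by ring.
  apply: norm_mul; last by apply: norm_mul => //; exact: (HD _).2.
  rewrite -[l]mulr1; apply: norm_mul.
    by rewrite ger0_norm// mulr_ge0 ?sqr_ge0// ltW.
  by rewrite -[1]mulr1; apply: (norm_mul _ (dil1 r y)); rewrite gtr0_norm.
have := norm_add (norm_add (norm_mul a1 (norm_add a2 a3)) (b p.1.1 p.1.2 p.2 g2)) (b p.1.2 p.1.1 (- p.2) h2).
rewrite (_ : r ^+ 2 * dil r (d1 (d1 (@rho R))) p.1.2 * Psi p.1.1 * _ =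
  Psi p.1.1 * (r ^+ 2 * dil r (d1 (d1 (@rho R))) p.1.2) * (expR (- p.2) ^+ 2 * F p.2)); last by ring.
move=> H; apply: le_trans H _; rewrite le_eqVlt; apply/orP; left; apply/eqP.
by move: l => l'; ring.
Qed.

Lemma residual_im_bound p : `|p.2| <= 2 * L ->
  `|residual_im kappa Bx By (trial f L) p| <= l * (2 * (`|Bx| + `|kappa| + `|By|) * (D * K)).
Proof.
move=> pL; have /andP[z1 z2] : - (2 * L) <= p.2 <= 2 * L by rewrite -ler_norml.
have [g1 g2] := growth z2; have zn : - p.2 <= 2 * L by lra.
have [h1 h2] := growth zn.
rewrite residual_im_trial.
have d (x y : R) : `|dil r (d1 (@rho R)) x * (Psi y * F p.2)| <= D * K.
  apply: norm_mul; first exact: (HD _).1.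
  by rewrite -[K]mul1r; exact: norm_mul (dil1 r _) (FK _).
have e0 e : 0 <= expR e * r by rewrite mulr_ge0 ?expR_ge0// ltW.
have a1 : `|Bx * (expR p.2 * r) + kappa * (expR p.2 ^+ 2 * r)| <= `|Bx| * l + `|kappa| * l.
  apply: norm_add; apply: norm_mul => //; rewrite ger0_norm//.
  by rewrite mulr_ge0 ?sqr_ge0// ltW.
have a2 : `|By * (expR (- p.2) * r)| <= `|By| * l by apply: norm_mul => //; rewrite ger0_norm.
have := norm_mul (norm_id (ler0n R 2)) (norm_add (norm_mul a1 (d p.1.1 p.1.2)) (norm_mul a2 (d p.1.2 p.1.1))).
rewrite -normrN; set x := - _; set y := - 2 * _.
have -> : x = y by rewrite /x /y; ring.
move=> H; apply: le_trans H _; rewrite le_eqVlt; apply/orP; left; apply/eqP.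
by move: l => l'; ring.
Qed.

(** The residual is of order [1/L] on the support, whose volume is of order [L/r^2];
    this bounds its squared norm by a multiple of [1/(L r^2)]. *)
Lemma residual_bound : exists2 C : R, C = (5 * (K * D)) ^+ 2 + (2 * (`|Bx| + `|kappa| + `|By|) * (D * K)) ^+ 2 &
  sqnorm (H_shift Bx By (2^-1 * (mu + By ^+ 2))%:C (modulate kappa (fun p => (trial f L p)%:C))) <=
  16 * C * (l / r ^+ 2).
Proof.
eexists; first reflexivity.
set C := (5 * _) ^+ 2 + _; have C0 : 0 <= C by rewrite addr_ge0 ?sqr_ge0.
have [sT bT] := Ccs_trial.
have tu : Tf (modulate kappa (fun p => (trial f L p)%:C)).
  have c1 : Ccs (fun p => cosx kappa p * trial f L p).
    exact: (CcsMl (smooth_cosx kappa) Ccs_trial).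
  have c2 : Ccs (fun p => sinx kappa p * trial f L p).
    exact: (CcsMl (smooth_sinx kappa) Ccs_trial).
  split; first by under eq_fun do rewrite cReM /= mulr0 subr0.
  by under eq_fun do rewrite cImM /= mulr0 add0r.
have R0 : 0 < 2 / r by rewrite divr_gt0.
have L2' : 0 < 2 * L by rewrite mulr_gt0.
have [jb Ib] := rint_box3 R0 R0 L2'.
have -> : 16 * C * (l / r ^+ 2) = 4^-1 * (l ^+ 2 * C) * rint (\1_(box3 (2 / r) (2 / r) (2 * L))).
  by rewrite Ib /l; field; rewrite !gt_eqF.
rewrite -rintZ//; apply: le_rint; [exact: intble_sqmod (Tf_L2 (Tf_H_shift _ _ _ tu))|exact: intbleZ|].
move=> p; rewrite sqmod_H_shift_modulate// indicE.
have q0 (t : R) : 2 < `|t| -> rho t = 0 by case/rho_out.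
have q1 (t : R) : 2 < `|t| -> d1 (@rho R) t = 0 by case/rho_out.
have q2 (t : R) : 2 < `|t| -> d1 (d1 (@rho R)) t = 0 by case/rho_out.
have [/box3P[hx hy hz]|np] := pselect (box3 (2 / r) (2 / r) (2 * L) p).
  rewrite mem_set ?mulr1; last exact/box3P.
  pose x := 5 * (K * D); pose y := 2 * (`|Bx| + `|kappa| + `|By|) * (D * K).
  have x0 : 0 <= l * x by apply: mulr_ge0; [exact: ltW|rewrite /x !mulr_ge0].
  have y0 : 0 <= l * y by apply: mulr_ge0; [exact: ltW|rewrite /y !mulr_ge0// !addr_ge0].
  have -> : l ^+ 2 * C = (l * x) ^+ 2 + (l * y) ^+ 2 by rewrite /C -/x -/y; ring.
  apply: ler_wpM2l; first by rewrite invr_ge0.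
  have bR := residual_re_bound hz; have bI := residual_im_bound hz; rewrite -/x in bR; rewrite -/y in bI.
  apply: lerD.
    by rewrite -(real_normK (num_real (residual_re _ _ _ _ _ _))) ler_pXn2r ?nnegrE.
  by rewrite -(real_normK (num_real (residual_im _ _ _ _ _))) ler_pXn2r ?nnegrE.
rewrite memNset// mulr0.
suff [-> ->] : residual_re kappa Bx By (mu + By ^+ 2) (trial f L) p = 0 /\ residual_im kappa Bx By (trial f L) p = 0.
  by rewrite expr0n addr0 mulr0.
rewrite residual_re_trial residual_im_trial /F.
have [x1|x1] := ltP (2 / r) `|p.1.1|.
  have P0 : Psi p.1.1 = 0 by exact: (dil_out r0 q0 x1).
  by rewrite (dil_out r0 q1 x1) (dil_out r0 q2 x1) P0 !(mul0r, mulr0, addr0, oppr0).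
have [x2|x2] := ltP (2 / r) `|p.1.2|.
  have P0 : Psi p.1.2 = 0 by exact: (dil_out r0 q0 x2).
  by rewrite (dil_out r0 q1 x2) (dil_out r0 q2 x2) P0 !(mul0r, mulr0, addr0, oppr0).
have x3 : 2 / l < `|p.2|.
  by rewrite ltNge; apply/negP => x3; apply: np; apply/box3P; split => //; rewrite /l invrK in x3.
have P0 : phi p.2 = 0 by exact: (dil_out l0 q0 x3).
by rewrite (dil_out l0 q1 x3) (dil_out l0 q2 x3) P0 !(mul0r, mulr0, addr0, oppr0).
Qed.

(** The trial function is bounded from below on a box of fixed height and of width
    [1/r], so that its squared norm is at least a multiple of [1/r^2]. *)
Lemma trial_norm (m t : R) : 0 < m -> (forall t, `|t| <= 2^-1 -> m <= rho t) ->
  0 < t -> t <= 2^-1 -> (forall z, `|z| <= t -> `|f 0| / 2 <= `|f z|) ->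
  (m ^+ 3 * (`|f 0| / 2)) ^+ 2 * (2 * t / r ^+ 2) <=
  sqnorm (modulate kappa (fun p => (trial f L p)%:C)).
Proof.
move=> m0 Hm t0 th ft.
have R0 : 0 < (2 * r)^-1 by rewrite invr_gt0 mulr_gt0.
have [jb Ib] := rint_box3 R0 R0 t0.
have f0 : 0 <= `|f 0| / 2 by rewrite divr_ge0.
have -> : 2 * t / r ^+ 2 = rint (\1_(box3 (2 * r)^-1 (2 * r)^-1 t)).
  by rewrite Ib; field; rewrite gt_eqF.
have sE : sqnorm (modulate kappa (fun p => (trial f L p)%:C)) = rint (fun p => trial f L p ^+ 2).
  rewrite /sqnorm -/(rint _); congr rint; apply/funext => p.
  by rewrite sqmod_modulate /sqmod /= expr0n addr0.
rewrite sE -rintZ//; apply: le_rint; first exact: intbleZ.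
  by apply: Ccs_intble; have [s b] := Ccs_trial; apply: (CcsMl (f := trial f L)).
move=> p; have [/box3P[hx hy hz]|np] := pselect (box3 (2 * r)^-1 (2 * r)^-1 t p); last first.
  by rewrite indicE memNset// mulr0 sqr_ge0.
rewrite indicE mem_set ?mulr1; last exact/box3P.
rewrite -[X in _ <= X](real_normK (num_real _)) ler_pXn2r ?nnegrE//; last first.
  by rewrite mulr_ge0// exprn_ge0// ltW.
have hr (x : R) : `|x| <= (2 * r)^-1 -> m <= `|Psi x|.
  move=> hx'; rewrite ger0_norm ?rho_ge0//; apply: Hm; rewrite normrM (gtr0_norm r0).
  have := ler_wpM2l (ltW r0) hx'; rewrite (_ : r * (2 * r)^-1 = 2^-1)//.
  by field; rewrite gt_eqF.
have hp : m <= `|phi p.2|.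
  rewrite ger0_norm ?rho_ge0//; apply: Hm; rewrite normrM (gtr0_norm l0).
  apply: le_trans th; apply: le_trans hz; by rewrite ler_piMl.
have m' := ltW m0.
rewrite -[trial f L p]/(Psi p.1.1 * Psi p.1.2 * (f p.2 * phi p.2)).
rewrite normrM (normrM (Psi p.1.1)) (normrM (f p.2)).
rewrite (_ : m ^+ 3 * (`|f 0| / 2) = m * m * (`|f 0| / 2 * m)); last by ring.
have pp : m * m <= `|Psi p.1.1| * `|Psi p.1.2| by exact: (ler_pM m' m' (hr _ hx) (hr _ hy)).
have fp : `|f 0| / 2 * m <= `|f p.2| * `|phi p.2| by exact: (ler_pM f0 m' (ft _ hz) hp).
exact: (ler_pM (mulr_ge0 m' m') (mulr_ge0 f0 m') pp fp).
Qed.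

End Trial.

Lemma weyl_algebra (C q e v : R) : 0 <= C -> 0 < q -> 0 < e -> 0 < v ->
  16 * C * ((16 * C / (q * e) + 1)^-1 * v) <= e * (q * v).
Proof.
move=> C0 q0 e0 v0; rewrite [leLHS]mulrA [leRHS]mulrA; apply: ler_wpM2r; first exact: ltW.
have qe : 0 < q * e by rewrite mulr_gt0.
rewrite ler_pdivrMr; last by rewrite ltr_wpDl// divr_ge0 ?mulr_ge0// ltW.
rewrite (_ : e * q * _ = 16 * C + e * q); last by field; rewrite !gt_eqF.
by rewrite lerDl mulr_ge0// ltW.
Qed.

(** Approximate eigenfunctions exclude a bounded inverse. *)
Lemma weyl_criterion (Bx By : R) (zeta : R[i]) :
  (forall e : R, 0 < e -> exists u, [/\ Tf u, 0 < sqnorm u &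
     sqnorm (H_shift Bx By zeta u) <= e * sqnorm u]) ->
  spec_Sol Bx By zeta.
Proof.
move=> H [_ _ [c Hc]].
have c1 : 0 < c ^+ 2 + 1 by rewrite ltr_wpDl ?sqr_ge0.
have e0 : 0 < (c ^+ 2 + 1)^-1 by rewrite invr_gt0.
have [u [tu u0 Hu]] := H _ e0.
have lu := Tf_L2 tu; have lH := Tf_L2 (Tf_H Bx By tu); have lA := Tf_L2 (Tf_H_shift Bx By zeta tu).
have cst (w : cfun3 R) : L2 w -> cvgL2 (fun=> w) w.
  move=> lw; apply/(cvgL2P (fun=> lw) lw) => e e0'; exists 0%N => n _.
  rewrite (_ : sqnorm _ = 0); first exact: ltW.
  rewrite /sqnorm (_ : sqmod _ = fun=> 0) ?/Rintegral ?integral0//.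
  by apply/funext => p; rewrite /sqmod subrr /= expr0n addr0.
have := Hc u (H_Sol Bx By u); rewrite -/(H_shift Bx By zeta u) (normL2_sqnorm lu) (normL2_sqnorm lA) -EFinM lee_fin.
have G : closure_graph (@test_fun R) (H_Sol Bx By) (u, H_Sol Bx By u).
  split => //=; exists (fun=> u); split; [by move=> n; exact: (test_funP u).2 tu|exact: cst|exact: cst].
move=> /(_ G) H1.
have s0 := sqrtr_ge0 (sqnorm u).
have : sqnorm u <= c ^+ 2 * sqnorm (H_shift Bx By zeta u).
  rewrite -(sqr_sqrtr (ltW u0)) -[X in _ * X](sqr_sqrtr (sqnorm_ge0 _)) -exprMn.
  by rewrite ler_pXn2r ?nnegrE//; apply: le_trans H1.
move=> H2; have H3 : c ^+ 2 * sqnorm (H_shift Bx By zeta u) <= c ^+ 2 * ((c ^+ 2 + 1)^-1 * sqnorm u).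
  by apply: ler_wpM2l Hu; exact: sqr_ge0.
have := le_trans H2 H3; rewrite mulrA leNgt => /negP; apply.
by rewrite gtr_pMl// ltr_pdivrMr// mul1r ltrDl.
Qed.

(** A bounded solution of the fibre equation yields a point of the spectrum: by
    [residual_bound] and [trial_norm] the quotient of the squared norms is of order
    [1/L]. *)
Lemma spec_of_fibre (Bx By kappa mu K : R) f : sm1 f ->
  (forall z, `|f z| <= K) -> (forall z, `|d1 f z| <= K) ->
  (forall z, d1 (d1 f) z = ((Bx + kappa * expR z) ^+ 2 - mu) * f z) -> f 0 != 0 ->
  spec_Sol Bx By (2^-1 * (mu + By ^+ 2))%:C.
Proof.
move=> sf fK f'K ode f0.
have [D D0 HD] := rho_deriv R; have [m m0 Hm] := rho_inner R.
have nf : 0 < `|f 0| / 2 by rewrite divr_gt0// normr_gt0.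
have [t [t0 th ft]] : exists t : R, [/\ 0 < t, t <= 2^-1 & forall z, `|z| <= t -> `|f 0| / 2 <= `|f z|].
  have cf : {for 0, continuous f}.
    by apply: derivable_continuous1 => x; exact: sm1_derivable.
  have /cvgrPdist_le/(_ _ nf)/nbhs_ballP[s /= s0 Hs] := cf.
  exists (Num.min (s / 2) 2^-1); split; rewrite ?lt_min ?ge_min ?lexx ?orbT ?invr_gt0 ?divr_gt0//=.
  move=> z; rewrite le_min => /andP[z1 z2].
  have : ball (0 : R) s z by rewrite /ball /= sub0r normrN; apply: le_lt_trans z1 _; rewrite ltr_pdivrMr// ltr_pMr// ltr1n.
  move=> /Hs; have := ler_normD (f 0 - f z) (f z); rewrite subrK; lra.
set C := (5 * (K * D)) ^+ 2 + (2 * (`|Bx| + `|kappa| + `|By|) * (D * K)) ^+ 2.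
have C0 : 0 <= C by rewrite /C addr_ge0// sqr_ge0.
pose q := (m ^+ 3 * (`|f 0| / 2)) ^+ 2 * (2 * t).
have q0 : 0 < q by apply: mulr_gt0; [apply: exprn_gt0; apply: mulr_gt0 => //; exact: exprn_gt0|exact: mulr_gt0].
apply: weyl_criterion => e e0.
pose L := 16 * C / (q * e) + 1.
have qe : 0 < q * e by rewrite mulr_gt0.
have L1 : 1 <= L by rewrite lerDr divr_ge0 ?mulr_ge0// ltW.
have L0 : 0 < L by apply: lt_le_trans L1.
have r0 : 0 < vscale L by rewrite divr_gt0 ?expR_gt0.
have r2 : 0 < (vscale L ^+ 2)^-1 by rewrite invr_gt0 exprn_gt0.
have tn := trial_norm kappa sf L1 m0 Hm t0 th ft.
have [_ -> rb] := residual_bound By sf L1 fK f'K ode HD.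
exists (modulate kappa (fun p => (trial f L p)%:C)); split.
- have [sT bT] := Ccs_trial sf L1; have cT := Ccs_trial sf L1.
  split; first by under eq_fun do rewrite cReM /= mulr0 subr0; exact: (CcsMl (smooth_cosx kappa) cT).
  by under eq_fun do rewrite cImM /= mulr0 add0r; exact: (CcsMl (smooth_sinx kappa) cT).
- by apply: lt_le_trans tn; rewrite mulrA mulr_gt0.
apply: le_trans rb _; rewrite -/C.
apply: le_trans (_ : e * (q * (vscale L ^+ 2)^-1) <= _); last first.
  by rewrite ler_pM2l// /q -[X in X <= _]mulrA.
exact: weyl_algebra.
Qed.

(** For [kappa = 0] the fibre equation has constant coefficients and the solution
    [cos(k z)], with [k^2 = 2 x - B^2]. *)
Lemma spec_half_line (Bx By B : R) : B = Num.sqrt (Bx ^+ 2 + By ^+ 2) ->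
  [set x%:C | x in [set x : R | 2^-1 * B ^+ 2 <= x]] `<=` spec_Sol Bx By.
Proof.
move=> hB _ [x /= xB <-].
have B2 : B ^+ 2 = Bx ^+ 2 + By ^+ 2 by rewrite hB sqr_sqrtr// addr_ge0 ?sqr_ge0.
pose k : R := Num.sqrt (2 * x - B ^+ 2).
have k2 : k ^+ 2 = 2 * x - B ^+ 2 by rewrite sqr_sqrtr//; lra.
have [sc ss] := sm1_cos_sin R.
have -> : x = 2^-1 * (Bx ^+ 2 + k ^+ 2 + By ^+ 2) by rewrite k2 B2; field.
have dc : d1 (dil k cos) = fun x => k * - dil k sin x.
  by rewrite (d1_dil k sc) (d1_eq (fun x => is_derive_cos x)).
have ds : d1 (fun x => k * - dil k sin x) = fun x => - k ^+ 2 * dil k cos x.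
  apply: d1_eq => y; have sd := sm1_dil k ss.
  have dd : is_derive y 1 (dil k sin) (k * dil k cos y).
    have := d1P (sm1_derivable (x := y) sd).
    by rewrite (d1_dil k ss) (d1_eq (fun x => is_derive_sin x)).
  have := @is_deriveM R R (cst (- k)) (dil k sin) y 1 0 _ (is_derive_cst _ _ _) dd.
  rewrite (_ : cst (- k) * dil k sin = fun x => k * - dil k sin x); last first.
    by apply/funext => w; rewrite /= mulrN -mulNr.
  by move=> H; apply: (is_derive_eq H); rewrite /GRing.scale /=; ring.
apply: (@spec_of_fibre Bx By 0 _ (1 + `|k|) (dil k cos)).
- exact: sm1_dil.
- by move=> z; apply: le_trans (cos_max _) _; rewrite lerDl.
- move=> z; rewrite dc normrM normrN; apply: le_trans (_ : `|k| * 1 <= _).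
    by apply: ler_wpM2l => //; exact: sin_max.
  by rewrite mulr1 lerDr.
- by move=> z; rewrite dc ds; ring.
- by rewrite /dil mulr0 cos0 oner_eq0.
Qed.

Lemma exp_bound (s : R) : 0 < s -> exists C : R, forall z, s * z - expR z <= C.
Proof.
move=> s0; exists (s * (ln s - 1)) => z.
have := expR_ge1Dx (z - ln s); rewrite -(ler_pM2l s0).
by rewrite -[X in _ <= X * _](lnK s0) -expRD (_ : ln s + (z - ln s) = z); [lra|ring].
Qed.

(** For [kappa = - sgn Bx] the fibre potential is the Morse potential
    [(|Bx| - e^z)^2], whose ground state is [exp(s z - e^z)] with [s = |Bx| - 1/2] and
    has energy [Bx^2 - s^2 = |Bx| - 1/4]. *)
Lemma spec_bound_state (Bx By : R) : 2^-1 < `|Bx| ->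
  spec_Sol Bx By (2^-1 * (`|Bx| + `|By| ^+ 2 - 4^-1))%:C.
Proof.
move=> hb; set b : R := `|Bx|; have [s sb] : exists s : R, s = b - 2^-1 by exists (b - 2^-1).
have s0 : 0 < s by rewrite sb subr_gt0.
pose f (z : R) : R := expR (s * z - expR z).
have sE := sm1_expR R.
have dg (z : R) : is_derive z 1 (fun z : R => s * z - expR z) (s - expR z).
  have d1' : is_derive z 1 (fun t : R => s * t) s.
    have := @is_deriveM R R (cst s) id z 1 0 1 (is_derive_cst _ _ _) (is_derive_id _ _).
    by rewrite /GRing.scale /= mulr1 mulr0 addr0.
  exact: (is_deriveB d1' (is_derive_expR z)).
have df (z : R) : is_derive z 1 f ((s - expR z) * f z).
  by have := @is_derive1_comp R expR (fun z : R => s * z - expR z) z _ _ (is_derive_expR _) (dg z); rewrite mulrC.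
have sf : sm1 f.
  have := sm1_comp sE (smoothB (smoothZ s (@smooth_crd R k2)) (sm1_comp sE (@smooth_crd R k2))).
  exact.
have ddf (z : R) : is_derive z 1 (fun z => (s - expR z) * f z) (((s - expR z) ^+ 2 - expR z) * f z).
  have H1 := is_deriveB (is_derive_cst s z 1) (is_derive_expR z).
  have := is_deriveM H1 (df z).
  move=> H; apply: (is_derive_eq H); rewrite /GRing.scale /=.
  by rewrite (_ : (cst s - expR) z = s - expR z)//; ring.
have [C1 H1] := exp_bound s0; have s1 : 0 < s + 1 by rewrite ltr_wpDl// ltW.
have [C2 H2] := exp_bound s1.
have f1 z : f z <= expR C1 by rewrite ler_expR.
have f2 z : expR z * f z <= expR C2.
  by rewrite -expRD ler_expR; have := H2 z; lra.
have f0 z : 0 <= f z by exact: expR_ge0.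
have e1 := expR_ge0 C1; have e2 := expR_ge0 C2.
have bb : Num.sg Bx * Bx = b by rewrite /b normrEsg.
have sg2 : Num.sg Bx ^+ 2 = 1.
  rewrite sqr_sg; suff -> : Bx != 0 by [].
  by rewrite -normr_gt0; apply: lt_trans hb; rewrite invr_gt0.
have -> : `|Bx| + `|By| ^+ 2 - 4^-1 = (b - 4^-1) + By ^+ 2.
  by rewrite real_normK ?num_real// -/b; ring.
apply: (@spec_of_fibre Bx By (- Num.sg Bx) _ ((1 + s) * expR C1 + expR C2) f) => //.
- move=> z; rewrite ger0_norm//; apply: le_trans (f1 z) _.
  by rewrite mulrDl mul1r -addrA lerDl addr_ge0// mulr_ge0// (ltW s0).
- move=> z; rewrite (d1_eq df) mulrBl; apply: le_trans (ler_normB _ _) _.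
  rewrite ger0_norm ?mulr_ge0 ?(ltW s0)// ger0_norm ?mulr_ge0 ?expR_ge0//.
  apply: (lerD _ (f2 z)); rewrite mulrDl mul1r ler_wpDl//.
  by apply: ler_wpM2l (f1 z); exact: ltW.
- move=> z; rewrite (d1_eq df) (d1_eq ddf); congr (_ * _).
  rewrite (_ : (Bx + _) ^+ 2 = Bx ^+ 2 - 2 * (Num.sg Bx * Bx) * expR z + Num.sg Bx ^+ 2 * expR z ^+ 2); last by ring.
  rewrite bb sg2 -(real_normK (num_real Bx)) -/b sb; by field.
- by rewrite /f gt_eqF// expR_gt0.
Qed.

End Weyl.

(** * The reflection that exchanges the two horizontal directions *)

Section Swap.
Variable R : realType.
Implicit Types (f : space3 R -> R) (u v g h : cfun3 R) (j : 'I_3) (p : space3 R).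

(** An automorphism of Sol that preserves the measure and exchanges the first two
    left-invariant fields. *)
Definition swap (p : mspace3 R) : mspace3 R := (p.1.2, p.1.1, - p.2).

Lemma swapK : involutive swap.
Proof. by move=> [[x y] z]; rewrite /swap /= opprK. Qed.

Lemma measurable_neg : measurable_fun setT (fun z : measurableTypeR R => - z : measurableTypeR R).
Proof. exact: measurableT_comp. Qed.

Lemma measurable_flip : measurable_fun setT
  (fun q : measurableTypeR R * measurableTypeR R => (q.2, q.1)).
Proof. by apply: measurable_fun_pair; [exact: measurable_snd|exact: measurable_fst]. Qed.

Lemma measurable_swap : measurable_fun setT swap.
Proof.
apply: measurable_fun_pair.
  by apply: (measurableT_comp measurable_flip); exact: measurable_fst.
by apply: (measurableT_comp measurable_neg); exact: measurable_snd.
Qed.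

Lemma lebesgue_neg (A : set (measurableTypeR R)) : measurable A ->
  lebesgue_measure ((fun z : measurableTypeR R => - z : measurableTypeR R) @^-1` A) = lebesgue_measure A.
Proof.
move=> mA; apply/esym.
apply: (@lebesgue_measure_unique R (pushforward lebesgue_measure (fun z : measurableTypeR R => - z : measurableTypeR R))) => //; first exact: measurable_neg.
move=> _ X [[a b] _ <-] /=; rewrite /pushforward (_ : _ @^-1` _ = `[- b, - a[%classic); last first.
  by apply/seteqP; split => x /=; rewrite !in_itv /= => /andP[? ?]; apply/andP; split; lra.
by rewrite !lebesgue_measure_itv /= !lte_fin ltrN2 -!EFinB; case: ifP => // _; congr EFin; ring.
Qed.

Lemma leb2_flip (A : set (measurableTypeR R * measurableTypeR R)) : measurable A ->
  leb2 ((fun q : measurableTypeR R * measurableTypeR R => (q.2, q.1)) @^-1` A) = leb2 A.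
Proof.
move=> mA; apply/esym.
apply: (@product_measure_unique _ _ _ _ R lebesgue_measure lebesgue_measure
  (pushforward (@leb2 R) (fun q : measurableTypeR R * measurableTypeR R => (q.2, q.1)))) => //; first exact: measurable_flip.
move=> ? X Y mX mY.
rewrite -[LHS]/(leb2 ((fun q : measurableTypeR R * measurableTypeR R => (q.2, q.1)) @^-1` (X `*` Y))).
rewrite (_ : _ @^-1` _ = Y `*` X); last by apply/seteqP; split => -[x y] [].
by rewrite /leb2 product_measure1E// muleC.
Qed.

Lemma leb3_swap (A : set (mspace3 R)) : measurable A -> leb3 R (swap @^-1` A) = leb3 R A.
Proof.
move=> mA; apply/esym.
apply: (@product_measure_unique _ _ _ _ R (@leb2 R) lebesgue_measure
  (pushforward (leb3 R) swap)) => //; first exact: measurable_swap.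
move=> ? X Y mX mY.
rewrite -[LHS]/(leb3 R (swap @^-1` (X `*` Y))) (_ : _ @^-1` _ =
  ((fun q : measurableTypeR R * measurableTypeR R => (q.2, q.1)) @^-1` X) `*`
  ((fun z : measurableTypeR R => - z : measurableTypeR R) @^-1` Y)); last first.
  by apply/seteqP; split => -[[x y] z] [].
rewrite /leb3 /= product_measure1E.
- exact: (congr2 mule (leb2_flip mX) (lebesgue_neg mY)).
- by rewrite -[X in measurable X]setTI; exact: measurable_flip.
- by rewrite -[X in measurable X]setTI; exact: measurable_neg.
Qed.

Lemma integral_swap (F : mspace3 R -> \bar R) : measurable_fun setT F -> (forall p, (0 <= F p)%E) ->
  (\int[leb3 R]_p F (swap p) = \int[leb3 R]_p F p)%E.
Proof.
move=> mF F0; have := @ge0_integral_pushforward _ _ _ _ R swap measurable_swap (leb3 R) setT F measurableT mF (fun p _ => F0 p).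
rewrite preimage_setT => <-; apply: eq_measure_integral; first exact: measurable_swap.
by move=> ? A mA _; exact: leb3_swap.
Qed.

Definition swapped u : cfun3 R := fun p => u (swap p).
Local Notation S := swapped.

Lemma swappedK u : S (S u) = u.
Proof. by apply/funext => p; rewrite /S swapK. Qed.

Lemma cmeasurable_swapped u : cmeasurable u -> cmeasurable (S u).
Proof.
by move=> [m1 m2]; split; [exact: (measurableT_comp m1 measurable_swap)|exact: (measurableT_comp m2 measurable_swap)].
Qed.

Lemma normL2_swapped u : cmeasurable u -> normL2 (S u) = normL2 u.
Proof.
move=> mu; rewrite !normL2E; congr (_ `^ _)%E.
apply: (integral_swap (F := fun p => (sqmod u p)%:E)).
  by apply/measurable_EFinP; exact: measurable_sqmod.
by move=> p; rewrite lee_fin sqmod_ge0.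
Qed.

Lemma L2_swapped u : L2 u -> L2 (S u).
Proof. by move=> [mu nu]; split; [exact: cmeasurable_swapped|rewrite normL2_swapped]. Qed.

Lemma eqL2_swapped u v : eqL2 u v -> eqL2 (S u) (S v).
Proof.
move=> [N [mN N0 sN]]; exists (swap @^-1` N); split.
- by rewrite -[X in measurable X]setTI; exact: measurable_swap.
- by rewrite [LHS]leb3_swap.
- by move=> p np; apply: sN => /= H; apply: np.
Qed.

Lemma cvgL2_swapped (w : nat -> cfun3 R) u : (forall n, L2 (w n)) -> L2 u -> cvgL2 w u ->
  cvgL2 (fun n => S (w n)) (S u).
Proof.
move=> lw lu; rewrite /cvgL2 (_ : (fun n => normL2 _) = fun n => normL2 (fun p => w n p - u p))//.
apply/funext => n; rewrite -[LHS]/(normL2 (S (fun p => w n p - u p))).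
by rewrite normL2_swapped//; have /L2P[] := L2B (lw n) lu.
Qed.

(** The reflection takes [X_j] to [sgnj j] times [X_(sj j)]. *)
Definition sj (j : 'I_3) : 'I_3 := nth k2 [:: k1; k0] j.
Definition sgnj (j : 'I_3) : R := nth (-1) [:: 1; 1] j.

Lemma is_derive_swap f (k : 'I_3) p : pdable f ->
  is_derive p (axis R k) (fun q => f (swap q)) (sgnj k * pd (sj k) f (swap p)).
Proof.
move=> df; apply/is_derive_line; case: p => -[x y] z.
case: (ord3P k) => ->; rewrite /sgnj /sj /crd /=.
- rewrite mul1r (_ : (fun t => _) = fun t => f (y, t, - z)); first exact: is_derive1.
  by apply/funext => t; rewrite upd0.
- rewrite mul1r (_ : (fun t => _) = fun t => f (t, x, - z)); first exact: is_derive0.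
  by apply/funext => t; rewrite upd1.
rewrite (_ : (fun t => _) = fun t => f (y, x, - t)); last by apply/funext => t; rewrite upd2.
have dN : is_derive z 1 (fun t : R => - t) (- 1) by exact: is_deriveN.
have := @is_derive1_comp R (fun t => f (y, x, t)) (fun t => - t) z _ _ (is_derive2 y x (- z) df) dN.
by rewrite mulrC.
Qed.

Lemma pd_swap f k : pdable f -> pd k (fun q => f (swap q)) = fun p => sgnj k * pd (sj k) f (swap p).
Proof. by move=> df; apply/funext => p; have [_] := is_derive_swap k p df. Qed.

Lemma inbox_swap M p : inbox M p -> inbox M (swap p).
Proof. by move=> [h0 h1 h2]; split => //=; rewrite normrN. Qed.

Lemma smooth_swap f : smooth f -> smooth (fun q => f (swap q)).
Proof.
move=> sf; apply: (@alg_smooth R [set h | exists2 g, smooth g & h = fun q => g (swap q)]); last first.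
- by apply: alg_gen; exists f.
- move=> _ k [g sg ->]; rewrite (pd_swap k (smooth_pdable sg)).
  apply: alg_mul; first exact: alg_cst.
  by apply: alg_gen; exists (pd (sj k) g) => //; exact: smooth_pd.
- by move=> _ [g sg ->] k p; have [] := is_derive_swap k p (smooth_pdable sg).
- move=> _ [g sg ->] M; have [C HC] := smooth_lbnd sg M.
  by exists C => p ip; apply: HC; exact: inbox_swap.
Qed.

Lemma X_swap f j p : smooth f -> X j (fun q => f (swap q)) p = sgnj j * X (sj j) f (swap p).
Proof.
move=> sf; rewrite !XE -/(pd j _ p) -/(pd (sj j) f _) (pd_swap j (smooth_pdable sf)).
by case: (ord3P j) => ->; rewrite /cX /sj /sgnj /= ?opprK; ring.
Qed.

Lemma Ccs_swap f : Ccs f -> Ccs (fun q => f (swap q)).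
Proof.
move=> [sf [M fM]]; split; first exact: smooth_swap.
by exists M => p np; apply: fM => ip; apply: np; rewrite -[p]swapK; exact: inbox_swap.
Qed.

Lemma Tf_swapped u : Tf u -> Tf (S u).
Proof. by move=> [u1 u2]; split; [exact: (Ccs_swap u1)|exact: (Ccs_swap u2)]. Qed.

Lemma P_swapped j (B : R) u : smC u -> sgnj j = 1 -> P j B (S u) = S (P (sj j) B u).
Proof.
move=> [u1 u2] sg; apply/funext => p; rewrite /P /S (X_swap j p u1) (X_swap j p u2) sg.
by rewrite !mul1r.
Qed.

Lemma P_opp j (B : R) u : smC u -> P j B (fun p => - u p) = fun p => - P j B u p.
Proof.
move=> [u1 u2]; apply/funext => p; rewrite /P.
rewrite (_ : (fun q => complex.Im _) = fun q => - complex.Im (u q)); last first.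
  by apply/funext => q; case: (u q).
rewrite (_ : (fun q => complex.Re _) = fun q => - complex.Re (u q)); last first.
  by apply/funext => q; case: (u q).
rewrite (XN j u1) (XN j u2); move: (X j _ p) (X j _ p) => x y; case: (u p) => a b.
by apply: complex_ext => /=; ring.
Qed.

Lemma Pz_swapped u : smC u -> P k2 0 (S u) = fun p => - S (P k2 0 u) p.
Proof.
move=> [u1 u2]; apply/funext => p; rewrite /P /S (X_swap k2 p u1) (X_swap k2 p u2) /sgnj /sj /=.
by apply: complex_ext => /=; ring.
Qed.

Lemma H_Sol_swapped (Bx By : R) u : Tf u -> H_Sol By Bx (S u) = S (H_Sol Bx By u).
Proof.
move=> tu; have su := Tf_smC tu; have sS := Tf_smC (Tf_swapped tu).
apply/funext => p; rewrite /S !H_SolE -/(S u).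
rewrite (P_swapped _ su (erefl : sgnj k0 = 1)) (P_swapped _ (smC_P _ _ su) (erefl : sgnj k0 = 1)).
rewrite (P_swapped _ su (erefl : sgnj k1 = 1)) (P_swapped _ (smC_P _ _ su) (erefl : sgnj k1 = 1)).
have -> : P k2 0 (P k2 0 (S u)) p = S (P k2 0 (P k2 0 u)) p.
  rewrite (Pz_swapped su) (P_opp _ _ (Tf_smC (Tf_swapped (Tf_P k2 0 tu)))) (Pz_swapped (smC_P k2 0 su)).
  by rewrite opprK.
rewrite [sj k0]/= [sj k1]/= /S; congr (_ * (_ + _)).
by rewrite addrC.
Qed.

Local Notation G Bx By := (closure_graph (@test_fun R) (H_Sol Bx By)).

Lemma graph_swapped (Bx By : R) u v : G Bx By (u, v) -> G By Bx (S u, S v).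
Proof.
move=> [/= lu lv [w [tw cu cv]]].
have tfw n : Tf (w n) by exact: (test_funP _).1 (tw n).
have lw n := Tf_L2 (tfw n); have lH n := Tf_L2 (Tf_H Bx By (tfw n)).
split; [exact: L2_swapped|exact: L2_swapped|exists (fun n => S (w n)); split].
- by move=> n; exact: (test_funP _).2 (Tf_swapped (tfw n)).
- exact: cvgL2_swapped.
- by rewrite (_ : (fun n => _) = fun n => S (H_Sol Bx By (w n)));
    [exact: cvgL2_swapped|apply/funext => n; rewrite (H_Sol_swapped _ _ (tfw n))].
Qed.

(** Composition with the reflection is a unitary involution that carries one graph
    to the other. *)
Lemma resolvent_swap (Bx By : R) : resolvent_set (G Bx By) `<=` resolvent_set (G By Bx).
Proof.
move=> zeta [sur inj [c Hc]]; split.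
- move=> h lh; have [f [g [Gfg E]]] := sur _ (L2_swapped lh).
  exists (S f), (S g); split; first exact: graph_swapped.
  by rewrite -[h]swappedK; exact: eqL2_swapped E.
- move=> f g Gfg E; have := inj _ _ (graph_swapped Gfg) (eqL2_swapped E).
  by move=> /eqL2_swapped; rewrite swappedK.
exists c => f g Gfg; have [/= lf lg _] := Gfg.
have lz : L2 (fun p => g p - zeta * f p) by apply: L2B => //; exact: L2Z.
have H : (normL2 (S f) <= c%:E * normL2 (S (fun p => g p - zeta * f p)%R))%E := Hc _ _ (graph_swapped Gfg).
have /L2P[mz _] := lz; have /L2P[mf _] := lf.
by move: H; rewrite (normL2_swapped mz) (normL2_swapped mf).
Qed.

Lemma spec_swap (Bx By : R) : spec_Sol Bx By = spec_Sol By Bx.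
Proof.
have E : resolvent_set (G Bx By) = resolvent_set (G By Bx).
  by apply/seteqP; split; [exact: (@resolvent_swap Bx By)|exact: (@resolvent_swap By Bx)].
exact: (congr1 setC E).
Qed.

End Swap.

Theorem theorem28 (R : realType) (Bx By B : R)
    (hB : B = Num.sqrt (Bx ^+ 2 + By ^+ 2)) :
  [/\ spec_Sol Bx By = spec_Sol By Bx /\
      [set x%:C | x in [set x : R | 2^-1 * B ^+ 2 <= x]] `<=` spec_Sol Bx By,
      0 <= B <= 2^-1 ->
        spec_Sol Bx By =
          [set x%:C | x in [set x : R | 2^-1 * B ^+ 2 <= x]],
      2^-1 < B ->
        ((2^-1 * (B - 4^-1))%:E <= lambda0_Sol Bx By)%E /\
        (By = 0 -> lambda0_Sol Bx By = (2^-1 * (B - 4^-1))%:E) &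
      2^-1 < `|Bx| ->
        spec_Sol Bx By (2^-1 * (`|Bx| + `|By| ^+ 2 - 4^-1))%:C].
Proof.
have half := spec_half_line hB; have low := spec_lower hB.
have lowE : 2^-1 < B -> ((2^-1 * (B - 4^-1))%:E <= lambda0_Sol Bx By)%E.
  move=> Bh; have nb : (B <= 2^-1) = false by rewrite leNgt Bh.
  apply: le_ereal_inf_tmp => _ [zeta /low[x /= bx <-] <-].
  by rewrite lee_fin; move: bx; rewrite /bottom nb.
split.
- by split; [exact: spec_swap|].
- move=> /andP[_ Bh]; apply/seteqP; split => // zeta /low[x bx <-]; exists x => //=.
  by move: bx; rewrite /= /bottom Bh.
- move=> Bh; split=> [|By0]; first exact: lowE.
  have BE : B = `|Bx| by rewrite hB By0 expr0n addr0 sqrtr_sqr.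
  apply/eqP; rewrite eq_le lowE// andbT; apply: ereal_inf_lbound.
  have bh : 2^-1 < `|Bx| by rewrite -BE.
  exists (2^-1 * (`|Bx| + `|By| ^+ 2 - 4^-1))%:C; first exact: spec_bound_state.
  by rewrite /= By0 normr0 expr0n addr0 -BE.
- exact: spec_bound_state.
Qed.
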